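(* Let $p\in[1,\infty)$. Then the following statements are equivalent. (a) For every bounded interval $I\subset\mathbb{R}$ there exists a constant $C=C(|I|)>0$ such that for all finite sequences $(a_n)$ of complex numbers it holds that $$\int_I\Big|\sum a_nn^{-\frac12-\mathrm{i}t}\Big|^p\,dt\le C\,\Big\|\sum a_nn^{-s}\Big\|_{\mathscr{H}^p}^p .$$ (b) Every local Carleson measure for $H^p(\mathbb{C}_{1/2})$ is also a Carleson measure for $\mathscr{H}^p$. (c) There exists a constant $D>0$ such that every local Carleson measure for $H^p(\mathbb{C}_{1/2})$ of the form $$\mu_S=\sum_n\delta_{s_n}(2\sigma_n-1),$$ with constant $C>0$, is also a Carleson measure for $\mathscr{H}^p$ with $$\int|F(s)|^p\,d\mu_S(s)\le CD\,\|F\|_{\mathscr{H}^p}^p\qquad\text{for all }F\in\mathscr{H}^p .$$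
   Context: Write $s=\sigma+\mathrm{i}t$ and $\mathbb{C}_{1/2}=\{s\in\mathbb{C}:\sigma>1/2\}$. For $p\in[1,\infty)$ the Dirichlet-Hardy space $\mathscr{H}^p$ is the closure (completion) of the finite Dirichlet polynomials $\sum a_nn^{-s}$ in the norm $$\Big\|\sum a_nn^{-s}\Big\|_{\mathscr{H}^p}=\lim_{T\to\infty}\Big(\frac1{2T}\int_{-T}^T\Big|\sum a_nn^{-\mathrm{i}t}\Big|^p\,dt\Big)^{1/p};$$ its elements are Dirichlet series defining analytic functions on $\mathbb{C}_{1/2}$. $H^p(\mathbb{C}_{1/2})$ is the space of analytic functions $f$ on $\mathbb{C}_{1/2}$ with $\|f\|_{H^p(\mathbb{C}_{1/2})}=\sup_{\sigma>1/2}\big(\int_{\mathbb{R}}|f(\sigma+\mathrm{i}t)|^p\,dt\big)^{1/p}<\infty$. For $X=\mathscr{H}^p$ or $X=H^p(\mathbb{C}_{1/2})$, a positive measure $\mu$ on $\mathbb{C}_{1/2}$ is a Carleson measure for $X$ with constant $C>0$ if $\int_{\mathbb{C}_{1/2}}|f(s)|^p\,d\mu(s)\le C\|f\|_X^p$ for all $f\in X$; it is a Carleson measure for $X$ if this holds for some $C>0$. A measure is local if it has bounded support. In (c), the $s_n$ are points of $\mathbb{C}_{1/2}$, $\sigma_n=\operatorname{Re}s_n$, and $\delta_{s_n}$ is the unit point mass at $s_n$. $|I|$ is the length of $I$.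
   Formalization: In (c) the constant D may depend on a bounded set containing the support of the measure (not on S or C); with one D for all local measures (c) fails for every p, e.g. s_n = 1+in, n ≤ N, F = 1, while (a) holds for p = 2. *)

(* Defs.v *)
(* The complex numbers are R[i] over an arbitrary realType R; their topology
   lives on the alias R[i]^o. *)
From mathcomp Require Import all_boot all_order all_algebra.
From mathcomp Require Import complex.
From mathcomp Require Import all_classical all_reals all_analysis.
Set Implicit Arguments.
Unset Strict Implicit.
Unset Printing Implicit Defensive.
Import Order.TTheory GRing.Theory Num.Theory.
Import numFieldNormedType.Exports.
Local Open Scope classical_set_scope.
Local Open Scope ring_scope.
Local Open Scope complex_scope.

(* The real-valued modulus; the norm `|z| of R[i] takes its values in R[i]. *)
Definition cmod {R : realType} (z : R[i]) : R := Normc.normc z.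

Definition cexp {R : realType} (z : R[i]) : R[i] :=
  (expR (complex.Re z))%:C * (cos (complex.Im z) +i* sin (complex.Im z)).

(* n ^ (-s), for n >= 1 *)
Definition dirichlet_term {R : realType} (n : nat) (s : R[i]) : R[i] :=
  cexp (- s * (ln (n%:R : R))%:C).

(* The coefficients a_1, ..., a_N are stored as a`_0, ..., a`_N.-1. *)
Definition dirichlet_poly {R : realType} (a : seq R[i]) (s : R[i]) : R[i] :=
  \sum_(i < size a) a`_i * dirichlet_term i.+1 s.

(* The Dirichlet-Hardy norm when f is a Dirichlet polynomial. *)
Definition besicovitch_norm {R : realType} (p : R) (f : R[i] -> R[i]) : R :=
  lim (((2 * T)^-1 *
        \int[@lebesgue_measure R]_(t in `[- T, T]) (cmod (f (0 +i* t)) `^ p))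
       `^ p^-1 @[T --> +oo%R]).

Definition dirichlet_cauchy {R : realType} (p : R)
    (P : nat -> seq R[i]) : Prop :=
  forall eps : R, 0 < eps -> exists N : nat, forall m n : nat,
    (N <= m)%N -> (N <= n)%N ->
    besicovitch_norm p
      (fun s => dirichlet_poly (P m) s - dirichlet_poly (P n) s) < eps.

(* The completion of the Dirichlet polynomials, by Cauchy sequences. Equivalent
   Cauchy sequences are not identified, but they have the same norm and define
   the same function on the half-plane Re s > 1/2. *)
Record dirichlet_hardy (R : realType) (p : R) := DirichletHardy {
  dh_approx : nat -> seq R[i];
  dh_approx_cauchy : dirichlet_cauchy p dh_approx }.

(* Meaningful for Re s > 1/2 only. *)
Definition dh_fun {R : realType} {p : R} (F : dirichlet_hardy p)
    (s : R[i]) : R[i] :=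
  lim ((dirichlet_poly (dh_approx F n) s : R[i]^o) @[n --> \oo]).

Definition dh_norm {R : realType} {p : R} (F : dirichlet_hardy p) : R :=
  lim (besicovitch_norm p (dirichlet_poly (dh_approx F n)) @[n --> \oo]).

Definition half_plane {R : realType} : set R[i] := [set s | 2^-1 < complex.Re s].

Definition analytic_on {R : realType} (U : set R[i]) (f : R[i] -> R[i]) : Prop :=
  forall s, U s -> derivable (f : R[i]^o -> R[i]^o) s 1.

Definition hardy_norm {R : realType} (p : R) (f : R[i] -> R[i]) : \bar R :=
  ereal_sup ((fun sigma : R =>
    'N[@lebesgue_measure R]_(p%:E)[(fun t => (cmod (f (sigma +i* t)))%:E)]%E)
    @` [set sigma | 2^-1 < sigma]).

Definition hardy {R : realType} (p : R) : set (R[i] -> R[i]) :=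
  [set f | analytic_on half_plane f /\ (hardy_norm p f < +oo)%E].

(* R[i] with its Borel sigma-algebra *)
Definition borelC (R : realType) := g_sigma_algebraType (@open R[i]^o).

(* A Borel measure on the half-plane, extended by zero to R[i]. *)
Definition on_half_plane {R : realType}
    (mu : {measure set (borelC R) -> \bar R}) : Prop :=
  mu (~` half_plane) = 0%E.

Definition msupport {R : realType}
    (mu : {measure set (borelC R) -> \bar R}) : set R[i]^o :=
  [set s | forall U : set R[i]^o, open U -> U s -> (0 < mu U)%E].

Definition local_measure {R : realType}
    (mu : {measure set (borelC R) -> \bar R}) : Prop :=
  bounded_set (msupport mu).

Definition carleson_hardy {R : realType} (p : R)
    (mu : {measure set (borelC R) -> \bar R}) (C : R) : Prop :=
  forall f : R[i] -> R[i], hardy p f ->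
    (\int[mu]_(s in half_plane) (cmod (f s) `^ p)%:E
       <= C%:E * (hardy_norm p f) `^ p)%E.

Definition carleson_dirichlet {R : realType} (p : R)
    (mu : {measure set (borelC R) -> \bar R}) (C : R) : Prop :=
  forall F : dirichlet_hardy p,
    (\int[mu]_(s in half_plane) (cmod (dh_fun F s) `^ p)%:E
       <= (C * dh_norm F `^ p)%:E)%E.

(* mu = \sum_(n in J) (2 Re s_n - 1) delta_(s_n): taking J to be any set of
   indices allows both finite and infinite sequences. *)
Definition weighted_dirac_sum {R : realType} (J : set nat) (s : nat -> R[i])
    (mu : {measure set (borelC R) -> \bar R}) : Prop :=
  forall A : set (borelC R), measurable A ->
    mu A = (\esum_(n in J) ((2 * complex.Re (s n) - 1)%:E * \d_(s n : borelC R) A))%E.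

(* Main.v *)
Require Import Defs.
From HB Require Import structures.
From mathcomp Require Import all_boot all_order all_algebra.
From mathcomp Require Import complex.
From mathcomp Require Import all_classical all_reals all_analysis.
From mathcomp Require Import measurable_realfun.
From mathcomp Require Import ring lra.
(** The theorem compares two ways in which a Dirichlet polynomial [P] is controlled
near the line [Re s = 1/2] by its norm: integrally on the line, or by measures inside
the half-plane. The conditions are linked by the implications (a) => (b) => (c) =>
(a).

(a) => (b). The norm [N x] of the translate [P (x + s)] is a nonincreasing function
of [x >= 0] ([besicovitch_norm_shift_real]), so that the embedding on the boundary
line holds with the same constant on all lines [Re s = x] with [x > 1/2]. Hence
[f s = P s / (s + 1)^2] lies in the Hardy space of the half-plane, with norm at most a
constant times that of [P] ([localized_integral_le]). On the bounded support of a
local measure [|f|] and [|P|] are comparable, and the Carleson inequality for [f] gives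
the one for [P] ([local_carleson_poly]). Applied to point masses, this bounds point
evaluations, and Fatou's lemma then carries the inequality over to the completion
([carleson_poly_dirichlet]).

(b) => (c). If no constant [D] served for all measures with support in [K], there would
be measures [mu_k] with Carleson constants [C_k] for which [C_k 4^k] is not enough.
The sum of the measures [mu_k / (2^k C_k)] is a local Carleson measure; by (b) it has a
constant [C'] on the Dirichlet side, so that [mu_k] has the constant [C' C_k 2^k] there,
a contradiction as soon as [C' <= 2^k].

(c) => (a). By vertical translation the interval may be taken to start at zero. Put
points with gaps [w] on the line [Re s = 1/2 + w/2], with weights [w = 2 Re s - 1]. The
squares centred at these points with side [w/2] are disjoint, and the sub-mean-value
property of [|f|^p] bounds the Carleson constant of this measure independently of [w]
([comb_carleson]). The sums over the points given by (c) tend to the integral over the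
boundary line as [w] tends to zero ([comb_bound_line_integral]).

Two analytic tools are needed along the way. The sub-mean-value property
([sub_mean_value]) is derived from Cauchy's formula on rectangles, itself from Goursat's
theorem, with a constant that is not sharp. The existence and translation invariance of
the limit defining the norm rest on almost periodicity: up to a small error, all
translates of [P] along vertical lines are translates by a bounded amount
([imag_mod_precompact]), and this forces uniform means to exist ([exists_mean]). *)

Set Implicit Arguments.
Unset Strict Implicit.
Unset Printing Implicit Defensive.
Import Order.TTheory GRing.Theory Num.Theory.
Import numFieldNormedType.Exports.
Local Open Scope classical_set_scope.
Local Open Scope ring_scope.
Local Open Scope complex_scope.

(** * The modulus and differentiability on the complex plane *)

Section complex_modulus.
Context {R : realType}.
Implicit Types (z w : R[i]) (x y : R).

Lemma cmod_ge0 z : 0 <= cmod z.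
Proof. by case: z => a b; exact: sqrtr_ge0. Qed.

Lemma cmodM z w : cmod (z * w) = cmod z * cmod w.
Proof. exact: Normc.normcM. Qed.

Lemma cmodV z : cmod z^-1 = (cmod z)^-1.
Proof. exact: Normc.normcV. Qed.

Lemma cmodD z w : cmod (z + w) <= cmod z + cmod w.
Proof. exact: le_normcD. Qed.

Lemma cmodN z : cmod (- z) = cmod z.
Proof. exact: normcN. Qed.

Lemma cmodBC z w : cmod (z - w) = cmod (w - z).
Proof. by rewrite -cmodN opprB. Qed.

Lemma cmod0 : cmod (0 : R[i]) = 0.
Proof. exact: Normc.normc0. Qed.

Lemma cmod_eq0 z : cmod z = 0 -> z = 0.
Proof. exact: Normc.eq0_normc. Qed.

Lemma cmod_gt0 z : z != 0 -> 0 < cmod z.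
Proof.
move=> z0; rewrite lt0r cmod_ge0 andbT.
by apply: contra z0 => /eqP/cmod_eq0 ->.
Qed.

Lemma cmod_sqr z : cmod z ^+ 2 = complex.Re z ^+ 2 + complex.Im z ^+ 2.
Proof. by case: z => a b; rewrite /cmod /= sqr_sqrtr // addr_ge0 // sqr_ge0. Qed.

Lemma normCE z : `|z| = (cmod z)%:C.
Proof. by []. Qed.

Lemma cmod_real x : cmod x%:C = `|x|.
Proof. by rewrite /cmod /= expr0n /= addr0 sqrtr_sqr. Qed.

Lemma cmodCx x y : cmod (x +i* y) = Num.sqrt (x ^+ 2 + y ^+ 2).
Proof. by []. Qed.

Lemma cReD z w : complex.Re (z + w) = complex.Re z + complex.Re w.
Proof. by case: z; case: w. Qed.

Lemma cImD z w : complex.Im (z + w) = complex.Im z + complex.Im w.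
Proof. by case: z; case: w. Qed.

Lemma cReN z : complex.Re (- z) = - complex.Re z.
Proof. by case: z. Qed.

Lemma cImN z : complex.Im (- z) = - complex.Im z.
Proof. by case: z. Qed.

Lemma cReM z w : complex.Re (z * w) =
  complex.Re z * complex.Re w - complex.Im z * complex.Im w.
Proof. by case: z; case: w. Qed.

Lemma cImM z w : complex.Im (z * w) =
  complex.Re z * complex.Im w + complex.Im z * complex.Re w.
Proof. by case: z; case: w. Qed.

Lemma complex_ext z w : complex.Re z = complex.Re w ->
  complex.Im z = complex.Im w -> z = w.
Proof. by case: z => a b; case: w => c d /= -> ->. Qed.

Lemma ReIm_le_cmod z : `|complex.Re z| <= cmod z /\ `|complex.Im z| <= cmod z.
Proof.
split; rewrite -(ler_pXn2r (n := 2)) ?nnegrE ?normr_ge0 ?cmod_ge0 //.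
  by rewrite cmod_sqr real_normK ?num_real // lerDl sqr_ge0.
by rewrite cmod_sqr real_normK ?num_real // lerDr sqr_ge0.
Qed.

Lemma Re_le_cmod z : `|complex.Re z| <= cmod z.
Proof. by have [] := ReIm_le_cmod z. Qed.

Lemma Im_le_cmod z : `|complex.Im z| <= cmod z.
Proof. by have [] := ReIm_le_cmod z. Qed.

Lemma cmod_le z : cmod z <= `|complex.Re z| + `|complex.Im z|.
Proof.
rewrite -(ler_pXn2r (n := 2)) ?nnegrE ?addr_ge0 ?cmod_ge0 // cmod_sqr sqrrD.
by rewrite !real_normK ?num_real // addrAC lerDl mulrn_wge0 // mulr_ge0.
Qed.

Lemma cmod_distr z w : `|cmod z - cmod w| <= cmod (z - w).
Proof.
rewrite ler_norml; apply/andP; split.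
  rewrite lerBrDr addrC lerBlDr.
  by have := cmodD (w - z) z; rewrite subrK cmodBC addrC.
by rewrite lerBlDr; have := cmodD (z - w) w; rewrite subrK.
Qed.

Lemma cmod_sum (I : Type) (r : seq I) (P : pred I) (F : I -> R[i]) :
  cmod (\sum_(i <- r | P i) F i) <= \sum_(i <- r | P i) cmod (F i).
Proof.
elim/big_rec2: _ => [|i x y _ xy]; first by rewrite cmod0.
by rewrite (le_trans (cmodD _ _)) // lerD2l.
Qed.

End complex_modulus.

Section complex_topology.
Context {R : realType}.
Implicit Types (z w : R[i]) (x y : R).

Lemma gt0_realC (e : R[i]) : 0 < e -> 0 < complex.Re e /\ e = (complex.Re e)%:C.
Proof. by case: e => a b; rewrite ltcE /= => /andP[/eqP -> ->]. Qed.

Lemma cdisc_nbhs z (e : R) : 0 < e ->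
  nbhs (z : R[i]^o) [set w | cmod (w - z) < e].
Proof.
move=> e0; apply/nbhs_ballP; exists e%:C; first by rewrite /= ltcR.
by move=> w; rewrite -ball_normE /ball_ /= normCE ltcR cmodBC.
Qed.

Lemma cnbhsP z (A : set R[i]^o) : nbhs (z : R[i]^o) A <->
  exists2 e : R, 0 < e & forall w, cmod (w - z) < e -> A w.
Proof.
split=> [/nbhs_ballP[e /= /gt0_realC[e0 ->]] zA|[e e0 zA]].
  exists (complex.Re e) => // w we; apply: zA.
  by rewrite -ball_normE /ball_ /= normCE ltcR cmodBC.
by apply: filterS (cdisc_nbhs z e0) => w; exact: zA.
Qed.

Lemma ccvgP (T : Type) (F : set_system T) {FF : Filter F} (f : T -> R[i]) z :
  (f t : R[i]^o) @[t --> F] --> (z : R[i]^o) <->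
  forall e : R, 0 < e -> \forall t \near F, cmod (f t - z) < e.
Proof.
split=> [fz e e0|fz A /cnbhsP[e e0 zA]]; first exact: fz _ (cdisc_nbhs z e0).
by apply: filterS (fz e e0) => t; exact: zA.
Qed.

Lemma ccvg_complete (u : nat -> R[i]) :
  (forall e : R, 0 < e -> exists N, forall m n, (N <= m)%N -> (N <= n)%N ->
     cmod (u m - u n) < e) ->
  cvg ((u n : R[i]^o) @[n --> \oo]).
Proof.
move=> uC.
have cv (h : R[i] -> R) : (forall z w, h (z - w) = h z - h w) ->
    (forall z, `|h z| <= cmod z) -> cvgn (fun n => h (u n)).
  move=> hB hle; apply/cauchy_cvgP/cauchy_exP => e e0.
  have [N uN] := uC e e0; exists (h (u N)).
  have : \forall n \near \oo, `|h (u N) - h (u n)| < e.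
    near=> n; rewrite -hB (le_lt_trans (hle _)) // uN //.
    by near: n; exact: nbhs_infty_ge.
  by apply: filterS => n; rewrite -ball_normE.
have /cvg_ex[a ua] : cvgn (fun n => complex.Re (u n)).
  by apply: cv; [move=> z w; rewrite cReD cReN|exact: Re_le_cmod].
have /cvg_ex[b ub] : cvgn (fun n => complex.Im (u n)).
  by apply: cv; [move=> z w; rewrite cImD cImN|exact: Im_le_cmod].
apply/cvg_ex; exists (a +i* b); apply/ccvgP => e e0; near=> n.
rewrite (le_lt_trans (cmod_le _)) // cReD cReN cImD cImN [e]splitr ltrD //.
  rewrite distrC; near: n; move/cvgrPdist_lt : ua; apply; exact: divr_gt0.
rewrite distrC; near: n; move/cvgrPdist_lt : ub; apply; exact: divr_gt0.
Unshelve. all: by end_near. Qed.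

Lemma half_plane_open : open (half_plane : set R[i]^o).
Proof.
rewrite openE => w /= hw; apply/cnbhsP; exists (complex.Re w - 2^-1).
  by rewrite subr_gt0.
move=> v; move: (Re_le_cmod (v - w)); rewrite cReD cReN ler_norml /half_plane /=.
move=> /andP[+ _] ?; lra.
Qed.

(** The classical epsilon-delta form of complex differentiability, in which the
modulus is real-valued. *)
Definition cdiff (f : R[i] -> R[i]) (s d : R[i]) : Prop :=
  forall e : R, 0 < e -> exists2 r : R, 0 < r &
    forall z, cmod (z - s) < r ->
      cmod (f z - f s - d * (z - s)) <= e * cmod (z - s).

Lemma derivable_cdiff (f : R[i] -> R[i]) s :
  derivable (f : R[i]^o -> R[i]^o) s 1 <-> exists d, cdiff f s d.
Proof.
rewrite /derivable; split=> [/cvg_ex[d fd]|[d fd]].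
  exists d => e e0.
  move/(ccvgP (FF := within_filter _ _)) : fd => /(_ e e0).
  rewrite near_withinE => /cnbhsP[r r0 rP]; exists r => // z zr.
  have [->|zs] := eqVneq z s; first by rewrite !subrr mulr0 subrr cmod0 mulr0.
  have /= := rP (z - s); rewrite subr0 => /(_ zr).
  rewrite subr_eq0 => /(_ zs) /ltW.
  rewrite /GRing.scale /= mulr1 subrK => /(ler_wpM2r (cmod_ge0 (z - s))).
  rewrite -cmodM; congr (cmod _ <= _).
  by rewrite mulrBl mulrAC mulVf ?mul1r // subr_eq0.
apply/cvg_ex; exists d; apply/(ccvgP (FF := within_filter _ _)) => e e0.
have e2 : 0 < e / 2 by rewrite divr_gt0.
have [r r0 rP] := fd (e / 2) e2.
rewrite near_withinE; apply/cnbhsP; exists r => // h; rewrite subr0 => hr h0.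
have := rP (h + s); rewrite addrK => /(_ hr).
rewrite /GRing.scale /= mulr1 => H.
apply: (@le_lt_trans _ _ (e / 2)); last by rewrite ltr_pdivrMr // ltr_pMr ?ltr1n.
rewrite -(ler_pM2r (cmod_gt0 h0)) -cmodM; apply: le_trans H.
rewrite le_eqVlt; apply/orP; left; apply/eqP; congr cmod.
by rewrite mulrBl mulrAC mulVf ?mul1r.
Qed.

Lemma cdiff_continuous (f : R[i] -> R[i]) s d : cdiff f s d ->
  forall e : R, 0 < e -> exists2 r : R, 0 < r &
    forall z, cmod (z - s) < r -> cmod (f z - f s) < e.
Proof.
move=> fd e e0; have [r r0 rP] := fd 1 ltr01.
have k0 : 0 < cmod d + 1 by rewrite ltr_wpDl // cmod_ge0.
exists (Num.min r (e / (cmod d + 1))); first by rewrite lt_min r0 divr_gt0.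
move=> z; rewrite lt_min => /andP[/rP + ]; rewrite ltr_pdivlMr // mul1r => H ze.
apply: le_lt_trans ze; rewrite mulrDr mulr1.
have -> : f z - f s = (f z - f s - d * (z - s)) + d * (z - s) by rewrite subrK.
by rewrite (le_trans (cmodD _ _)) // cmodM addrC [_ * cmod d]mulrC lerD2l.
Qed.

End complex_topology.

(** * Integrals along segments and around rectangles *)

Section line_integrals.
Context {R : realType}.
Local Notation leb := (@lebesgue_measure R).
Implicit Types (a b c : R) (h g : R -> R[i]).

Lemma lebesgue_measure_cc a b : a <= b -> leb `[a, b] = (b - a)%:E.
Proof.
move=> ab; rewrite lebesgue_measure_itv /= lte_fin; case: ltP => //= ba.
by rewrite (@le_anti _ _ a b) ?subrr // ab ba.
Qed.

Lemma continuous_at_integrable (u : R -> R) a b :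
  (forall t, a <= t <= b -> {for t, continuous u}) ->
  leb.-integrable `[a, b] (EFin \o u).
Proof.
move=> uc; apply: continuous_compact_integrable; first exact: segment_compact.
by apply: continuous_in_subspaceT => t /set_mem /=; rewrite in_itv /= => /uc.
Qed.

Definition ccont h t := forall e : R, 0 < e -> exists2 r : R, 0 < r &
  forall u, `|u - t| < r -> cmod (h u - h t) < e.

Lemma ccontD h g t : ccont h t -> ccont g t -> ccont (fun u => h u + g u) t.
Proof.
move=> hc gc e e0; have e2 : 0 < e / 2 by rewrite divr_gt0.
have [r r0 hr] := hc _ e2; have [s s0 gs] := gc _ e2.
exists (Num.min r s); first by rewrite lt_min r0.
move=> u; rewrite lt_min => /andP[/hr hu /gs gu].
have -> : h u + g u - (h t + g t) = (h u - h t) + (g u - g t).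
  by rewrite opprD addrACA.
by rewrite (le_lt_trans (cmodD _ _)) // [e]splitr ltrD.
Qed.

Lemma ccontN h t : ccont h t -> ccont (fun u => - h u) t.
Proof.
move=> hc e e0; have [r r0 hr] := hc e e0; exists r => // u /hr.
by rewrite -cmodN opprB addrC opprK.
Qed.

Lemma ccontB h g t : ccont h t -> ccont g t -> ccont (fun u => h u - g u) t.
Proof. by move=> hc gc; apply: ccontD => //; exact: ccontN. Qed.

Lemma ccont_comp (v : R[i] -> R) h t :
  (forall z w, `|v z - v w| <= cmod (z - w)) ->
  ccont h t -> {for t, continuous (fun u => v (h u))}.
Proof.
move=> vh hc; apply/cvgrPdist_lt => e e0; have [r r0 hr] := hc e e0.
apply/nbhs_ballP; exists r => //= u.
rewrite /= distrC => ur.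
by rewrite (le_lt_trans (vh _ _)) // cmodBC hr.
Qed.

Lemma ccont_Re h t : ccont h t -> {for t, continuous (fun u => complex.Re (h u))}.
Proof. by apply: ccont_comp => z w; rewrite -cReN -cReD Re_le_cmod. Qed.

Lemma ccont_Im h t : ccont h t -> {for t, continuous (fun u => complex.Im (h u))}.
Proof. by apply: ccont_comp => z w; rewrite -cImN -cImD Im_le_cmod. Qed.

Lemma ccont_cmod h t : ccont h t -> {for t, continuous (fun u => cmod (h u))}.
Proof. by apply: ccont_comp => z w; exact: cmod_distr. Qed.

Definition ccont_itv h a b := forall t, a <= t <= b -> ccont h t.

Lemma ccont_itvB h g a b : ccont_itv h a b -> ccont_itv g a b ->
  ccont_itv (fun u => h u - g u) a b.
Proof. by move=> hc gc t tab; apply: ccontB; [exact: hc|exact: gc]. Qed.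

Lemma Re_integrable h a b : ccont_itv h a b ->
  leb.-integrable `[a, b] (EFin \o (fun t => complex.Re (h t))).
Proof.
by move=> hc; apply: continuous_at_integrable => t /hc; exact: ccont_Re.
Qed.

Lemma Im_integrable h a b : ccont_itv h a b ->
  leb.-integrable `[a, b] (EFin \o (fun t => complex.Im (h t))).
Proof.
by move=> hc; apply: continuous_at_integrable => t /hc; exact: ccont_Im.
Qed.

Lemma cmod_integrable h a b : ccont_itv h a b ->
  leb.-integrable `[a, b] (EFin \o (fun t => cmod (h t))).
Proof.
by move=> hc; apply: continuous_at_integrable => t /hc; exact: ccont_cmod.
Qed.

Definition cint a b h : R[i] :=
  (\int[leb]_(t in `[a, b]) complex.Re (h t)) +i*
  (\int[leb]_(t in `[a, b]) complex.Im (h t)).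

Lemma cintB h g a b : ccont_itv h a b -> ccont_itv g a b ->
  cint a b (fun t => h t - g t) = cint a b h - cint a b g.
Proof.
move=> hc gc; apply: complex_ext; rewrite ?cReD ?cImD ?cReN ?cImN /=.
  rewrite -RintegralB //; [|exact: Re_integrable..].
  by apply: eq_Rintegral => t _; rewrite cReD cReN.
rewrite -RintegralB //; [|exact: Im_integrable..].
by apply: eq_Rintegral => t _; rewrite cImD cImN.
Qed.

Lemma cintZ (c : R[i]) h a b : ccont_itv h a b ->
  cint a b (fun t => c * h t) = c * cint a b h.
Proof.
move=> hc; have hr := Re_integrable hc; have hi := Im_integrable hc.
have Zl (u : R -> R) k : leb.-integrable `[a, b] (EFin \o u) ->
    leb.-integrable `[a, b] (EFin \o (fun t => k * u t)).
  by move=> ui; exact: (integrableZl _ k ui).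
apply: complex_ext; rewrite ?cReM ?cImM /=.
  rewrite -!RintegralZl // -RintegralB //; [|exact: Zl..].
  by apply: eq_Rintegral => t _; rewrite cReM.
rewrite -!RintegralZl // -RintegralD //; [|exact: Zl..].
by apply: eq_Rintegral => t _; rewrite cImM.
Qed.

Lemma eq_cint h g a b : (forall t, a <= t <= b -> h t = g t) ->
  cint a b h = cint a b g.
Proof.
move=> hg; apply: complex_ext => /=.
  by apply: eq_Rintegral => t /set_mem /=; rewrite in_itv /= => /hg ->.
by apply: eq_Rintegral => t /set_mem /=; rewrite in_itv /= => /hg ->.
Qed.

Lemma cint_cst (z : R[i]) a b : a <= b -> cint a b (fun=> z) = (b - a)%:C * z.
Proof.
move=> ab; have fab : fine (leb `[a, b]) = b - a by rewrite lebesgue_measure_cc.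
apply: complex_ext; rewrite /= Rintegral_cst // fab.
  by rewrite cReM /= mul0r subr0 mulrC.
by rewrite cImM /= mul0r addr0 mulrC.
Qed.

Lemma Rintegral_split (u : R -> R) a b c : a <= c -> c <= b ->
  leb.-integrable `[a, b] (EFin \o u) ->
  \int[leb]_(t in `[a, b]) u t =
  \int[leb]_(t in `[a, c]) u t + \int[leb]_(t in `[c, b]) u t.
Proof.
move=> ac cb ui; apply/eqP; rewrite addrC -subr_eq; apply/eqP.
rewrite Rintegral_itvB ?bnd_simp //.
apply: Rintegral_itv_obnd_cbnd; apply: integrableS ui => //.
by apply: subset_itvr; rewrite bnd_simp.
Qed.

Lemma cint_split h a b c : a <= c -> c <= b -> ccont_itv h a b ->
  cint a b h = cint a c h + cint c b h.
Proof.
move=> ac cb hc; apply: complex_ext; rewrite ?cReD ?cImD /=.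
  by apply: Rintegral_split => //; exact: Re_integrable.
by apply: Rintegral_split => //; exact: Im_integrable.
Qed.

(** Real and imaginary parts are estimated separately, at the cost of a factor 2. *)
Lemma cmod_cint_le h a b : ccont_itv h a b ->
  cmod (cint a b h) <= 2 * \int[leb]_(t in `[a, b]) cmod (h t).
Proof.
move=> hc; rewrite (le_trans (cmod_le _)) //= mulrDl mul1r lerD //.
  rewrite (le_trans (le_normr_Rintegral _ _)) //; first exact: Re_integrable.
  apply: le_Rintegral => //; last by move=> t _; exact: Re_le_cmod.
    by apply: integrable_norm; exact: Re_integrable.
  exact: cmod_integrable.
rewrite (le_trans (le_normr_Rintegral _ _)) //; first exact: Im_integrable.
apply: le_Rintegral => //; last by move=> t _; exact: Im_le_cmod.
  by apply: integrable_norm; exact: Im_integrable.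
exact: cmod_integrable.
Qed.

Lemma cmod_cint_bound h a b M : a <= b -> ccont_itv h a b ->
  (forall t, a <= t <= b -> cmod (h t) <= M) ->
  cmod (cint a b h) <= 2 * (M * (b - a)).
Proof.
move=> ab hc hM; rewrite (le_trans (cmod_cint_le hc)) // ler_pM2l //.
have fab : fine (leb `[a, b]) = b - a by rewrite lebesgue_measure_cc.
rewrite -fab -Rintegral_cst //; apply: le_Rintegral => //.
- exact: cmod_integrable.
- by apply: continuous_at_integrable => t _; exact: cst_continuous.
Qed.

End line_integrals.

Section rectangle_integrals.
Context {R : realType}.
Local Notation leb := (@lebesgue_measure R).
Implicit Types (x y : R) (f g : R[i] -> R[i]).

Definition ccontC f (z : R[i]) := forall e : R, 0 < e -> exists2 r : R, 0 < r &
  forall w, cmod (w - z) < r -> cmod (f w - f z) < e.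

Definition rect_cont f x1 x2 y1 y2 := forall x y, x1 <= x <= x2 ->
  y1 <= y <= y2 -> ccontC f (x +i* y).

Lemma cmod_hor x x' y : cmod ((x +i* y) - (x' +i* y)) = `|x - x'|.
Proof.
suff -> : (x +i* y) - (x' +i* y) = (x - x')%:C by exact: cmod_real.
by apply: complex_ext; rewrite ?cReD ?cImD ?cReN ?cImN /= ?subrr.
Qed.

Lemma cmod_ver x y y' : cmod ((x +i* y) - (x +i* y')) = `|y - y'|.
Proof.
suff -> : (x +i* y) - (x +i* y') = 0 +i* (y - y').
  by rewrite cmodCx expr0n /= add0r sqrtr_sqr.
by apply: complex_ext; rewrite ?cReD ?cImD ?cReN ?cImN /= ?subrr.
Qed.

(** Continuity at the points of the boundary only: the Cauchy kernel has a pole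
inside the rectangles around which it is integrated. *)
Definition rbd_cont f x1 x2 y1 y2 :=
  (forall x, x1 <= x <= x2 -> ccontC f (x +i* y1) /\ ccontC f (x +i* y2)) /\
  (forall y, y1 <= y <= y2 -> ccontC f (x1 +i* y) /\ ccontC f (x2 +i* y)).

Lemma ccontC_hor f x1 x2 y : (forall x, x1 <= x <= x2 -> ccontC f (x +i* y)) ->
  ccont_itv (fun x => f (x +i* y)) x1 x2.
Proof.
move=> fc x xx e e0; have [r r0 rP] := fc x xx e e0.
by exists r => // u ur; apply: rP; rewrite cmod_hor.
Qed.

Lemma ccontC_ver f y1 y2 x : (forall y, y1 <= y <= y2 -> ccontC f (x +i* y)) ->
  ccont_itv (fun y => f (x +i* y)) y1 y2.
Proof.
move=> fc y yy e e0; have [r r0 rP] := fc y yy e e0.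
by exists r => // u ur; apply: rP; rewrite cmod_ver.
Qed.

Lemma rbd_cont_itv f x1 x2 y1 y2 : rbd_cont f x1 x2 y1 y2 ->
  [/\ ccont_itv (fun x => f (x +i* y1)) x1 x2,
      ccont_itv (fun x => f (x +i* y2)) x1 x2,
      ccont_itv (fun y => f (x1 +i* y)) y1 y2 &
      ccont_itv (fun y => f (x2 +i* y)) y1 y2].
Proof.
move=> [fh fv]; split.
- by apply: ccontC_hor => x /fh[].
- by apply: ccontC_hor => x /fh[].
- by apply: ccontC_ver => x /fv[].
- by apply: ccontC_ver => x /fv[].
Qed.

Lemma rect_cont_rbd f x1 x2 y1 y2 : x1 <= x2 -> y1 <= y2 ->
  rect_cont f x1 x2 y1 y2 -> rbd_cont f x1 x2 y1 y2.
Proof.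
by move=> x12 y12 fc; split=> [x xx|y yy]; split; apply: fc;
  rewrite ?lexx ?x12 ?y12.
Qed.

(** The integral of [f] along the counterclockwise boundary of a rectangle,
with opposite sides taken together. *)
Definition rint f x1 x2 y1 y2 : R[i] :=
  cint x1 x2 (fun x => f (x +i* y1) - f (x +i* y2)) +
  (0 +i* 1) * cint y1 y2 (fun y => f (x2 +i* y) - f (x1 +i* y)).

Lemma rintE f x1 x2 y1 y2 : rbd_cont f x1 x2 y1 y2 ->
  rint f x1 x2 y1 y2 =
  cint x1 x2 (fun x => f (x +i* y1)) - cint x1 x2 (fun x => f (x +i* y2)) +
  (0 +i* 1) * (cint y1 y2 (fun y => f (x2 +i* y)) -
               cint y1 y2 (fun y => f (x1 +i* y))).
Proof. by move=> /rbd_cont_itv[h1 h2 h3 h4]; rewrite /rint !cintB. Qed.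

Lemma rect_contS f x1 x2 y1 y2 a1 a2 b1 b2 : x1 <= a1 -> a2 <= x2 ->
  y1 <= b1 -> b2 <= y2 ->
  rect_cont f x1 x2 y1 y2 -> rect_cont f a1 a2 b1 b2.
Proof.
move=> h1 h2 h3 h4 fc x y /andP[xa xb] /andP[ya yb]; apply: fc.
  by rewrite (le_trans h1) // (le_trans xb).
by rewrite (le_trans h3) // (le_trans yb).
Qed.

Lemma rint_splitx f x1 x2 y1 y2 c : x1 <= c -> c <= x2 ->
  rbd_cont f x1 x2 y1 y2 ->
  (forall y, y1 <= y <= y2 -> ccontC f (c +i* y)) ->
  rint f x1 x2 y1 y2 = rint f x1 c y1 y2 + rint f c x2 y1 y2.
Proof.
move=> h1 h2 fc cc; have [fc1 fc2 _ _] := rbd_cont_itv fc; case: fc => fh fv.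
rewrite !rintE; first last.
- by split.
- split=> [x /andP[a b]|y yy]; first by apply: fh; rewrite a (le_trans b).
  by split; [have [] := fv y yy|exact: cc].
- split=> [x /andP[a b]|y yy]; first by apply: fh; rewrite b (le_trans h1).
  by split; [exact: cc|have [] := fv y yy].
rewrite (cint_split h1 h2 fc1) (cint_split h1 h2 fc2).
ring.
Qed.

Lemma rint_splity f x1 x2 y1 y2 c : y1 <= c -> c <= y2 ->
  rbd_cont f x1 x2 y1 y2 ->
  (forall x, x1 <= x <= x2 -> ccontC f (x +i* c)) ->
  rint f x1 x2 y1 y2 = rint f x1 x2 y1 c + rint f x1 x2 c y2.
Proof.
move=> h1 h2 fc cc; have [_ _ fc1 fc2] := rbd_cont_itv fc; case: fc => fh fv.
rewrite !rintE; first last.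
- by split.
- split=> [x xx|y /andP[a b]]; last by apply: fv; rewrite a (le_trans b).
  by split; [have [] := fh x xx|exact: cc].
- split=> [x xx|y /andP[a b]]; last by apply: fv; rewrite b (le_trans h1).
  by split; [exact: cc|have [] := fh x xx].
rewrite (cint_split h1 h2 fc1) (cint_split h1 h2 fc2).
ring.
Qed.

Lemma ccontC_B f g z : ccontC f z -> ccontC g z -> ccontC (fun w => f w - g w) z.
Proof.
move=> hc gc e e0; have e2 : 0 < e / 2 by rewrite divr_gt0.
have [r r0 hr] := hc _ e2; have [s s0 gs] := gc _ e2.
exists (Num.min r s); first by rewrite lt_min r0.
move=> u; rewrite lt_min => /andP[/hr hu /gs gu].
have -> : f u - g u - (f z - g z) = (f u - f z) - (g u - g z) by ring.
by rewrite (le_lt_trans (cmodD _ _)) // cmodN [e]splitr ltrD.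
Qed.

Lemma rbd_contB f g x1 x2 y1 y2 : rbd_cont f x1 x2 y1 y2 ->
  rbd_cont g x1 x2 y1 y2 -> rbd_cont (fun z => f z - g z) x1 x2 y1 y2.
Proof.
move=> [fh fv] [gh gv]; split.
  by move=> x xx; have [? ?] := fh x xx; have [? ?] := gh x xx; split; exact: ccontC_B.
by move=> y yy; have [? ?] := fv y yy; have [? ?] := gv y yy; split; exact: ccontC_B.
Qed.

Lemma rintB f g x1 x2 y1 y2 : rbd_cont f x1 x2 y1 y2 -> rbd_cont g x1 x2 y1 y2 ->
  rint (fun z => f z - g z) x1 x2 y1 y2 =
  rint f x1 x2 y1 y2 - rint g x1 x2 y1 y2.
Proof.
move=> fc gc; rewrite !rintE //; last exact: rbd_contB.
have [f1 f2 f3 f4] := rbd_cont_itv fc; have [g1 g2 g3 g4] := rbd_cont_itv gc.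
rewrite !cintB //; ring.
Qed.

Lemma rintZ c f x1 x2 y1 y2 : rbd_cont f x1 x2 y1 y2 ->
  rint (fun z => c * f z) x1 x2 y1 y2 = c * rint f x1 x2 y1 y2.
Proof.
move=> /rbd_cont_itv[f1 f2 f3 f4]; rewrite /rint.
rewrite (@eq_cint _ _ (fun x => c * (f (x +i* y1) - f (x +i* y2)))); last first.
  by move=> t _; rewrite mulrBr.
rewrite cintZ; last exact: ccont_itvB.
rewrite (@eq_cint _ _ (fun y => c * (f (x2 +i* y) - f (x1 +i* y))) y1); last first.
  by move=> t _; rewrite mulrBr.
rewrite cintZ; last exact: ccont_itvB.
ring.
Qed.

(** Only the increments of an affine function across the rectangle enter, and
these are constant along each side. *)
Lemma rint_affine (a d s : R[i]) x1 x2 y1 y2 : x1 <= x2 -> y1 <= y2 ->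
  rint (fun z => a + d * (z - s)) x1 x2 y1 y2 = 0.
Proof.
move=> x12 y12; rewrite /rint.
have aux z w : a + d * (z - s) - (a + d * (w - s)) = d * (z - w) by ring.
rewrite (@eq_cint _ _ (fun=> d * (0 +i* (y1 - y2)))); last first.
  move=> t _; rewrite [LHS]aux; congr (_ * _).
  by apply: complex_ext; rewrite ?cReD ?cImD ?cReN ?cImN /= ?subrr.
rewrite (@eq_cint _ _ (fun=> d * (x2 - x1)%:C) y1 y2); last first.
  move=> t _; rewrite [LHS]aux; congr (_ * _).
  by apply: complex_ext; rewrite ?cReD ?cImD ?cReN ?cImN /= ?subrr.
rewrite !cint_cst //.
have -> : 0 +i* (y1 - y2) = - ((0 +i* 1) * (y2 - y1)%:C).
  by apply: complex_ext; rewrite ?cReN ?cImN ?cReM ?cImM /=; ring.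
ring.
Qed.

Lemma cmod_i : cmod (0 +i* 1 : R[i]) = 1.
Proof. by rewrite cmodCx expr0n /= expr1n add0r sqrtr1. Qed.

Lemma cmod_rint_le f x1 x2 y1 y2 : rbd_cont f x1 x2 y1 y2 ->
  cmod (rint f x1 x2 y1 y2) <=
  2 * (\int[leb]_(x in `[x1, x2]) cmod (f (x +i* y1)) +
       \int[leb]_(x in `[x1, x2]) cmod (f (x +i* y2)) +
       (\int[leb]_(y in `[y1, y2]) cmod (f (x1 +i* y)) +
        \int[leb]_(y in `[y1, y2]) cmod (f (x2 +i* y)))).
Proof.
move=> fc; rewrite rintE //; have [f1 f2 f3 f4] := rbd_cont_itv fc.
rewrite (le_trans (cmodD _ _)) // cmodM cmod_i mul1r [leRHS]mulrDr lerD //.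
  by rewrite (le_trans (cmodD _ _)) // cmodN mulrDr lerD // cmod_cint_le.
by rewrite (le_trans (cmodD _ _)) // cmodN addrC mulrDr lerD // cmod_cint_le.
Qed.

Lemma cmod_rint_bound f x1 x2 y1 y2 M : x1 <= x2 -> y1 <= y2 ->
  rbd_cont f x1 x2 y1 y2 ->
  (forall x, x1 <= x <= x2 -> cmod (f (x +i* y1)) <= M /\ cmod (f (x +i* y2)) <= M) ->
  (forall y, y1 <= y <= y2 -> cmod (f (x1 +i* y)) <= M /\ cmod (f (x2 +i* y)) <= M) ->
  cmod (rint f x1 x2 y1 y2) <= 4 * M * (x2 - x1 + (y2 - y1)).
Proof.
move=> x12 y12 /rbd_cont_itv[f1 f2 f3 f4] fh fv.
rewrite /rint (le_trans (cmodD _ _)) // cmodM cmod_i mul1r mulrDr lerD //.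
  have -> : 4 * M * (x2 - x1) = 2 * ((M + M) * (x2 - x1)) by ring.
  apply: cmod_cint_bound => //; first exact: ccont_itvB.
  by move=> t /fh[? ?]; rewrite (le_trans (cmodD _ _)) // cmodN lerD.
have -> : 4 * M * (y2 - y1) = 2 * ((M + M) * (y2 - y1)) by ring.
apply: cmod_cint_bound => //; first exact: ccont_itvB.
by move=> t /fv[? ?]; rewrite (le_trans (cmodD _ _)) // cmodN lerD.
Qed.

End rectangle_integrals.

(** * Goursat's theorem *)

Section goursat_theorem.
Context {R : realType}.
Implicit Types (x y : R) (f g : R[i] -> R[i]).

Lemma cdiff_ccontC f s d : cdiff f s d -> ccontC f s.
Proof. exact: cdiff_continuous. Qed.

Definition rect_diff f x1 x2 y1 y2 := forall x y, x1 <= x <= x2 ->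
  y1 <= y <= y2 -> exists d, cdiff f (x +i* y) d.

Lemma rect_diff_cont f x1 x2 y1 y2 :
  rect_diff f x1 x2 y1 y2 -> rect_cont f x1 x2 y1 y2.
Proof. by move=> fd x y xx yy; have [d /cdiff_ccontC] := fd x y xx yy. Qed.

Lemma ccontC_affine (a d s z : R[i]) : ccontC (fun w => a + d * (w - s)) z.
Proof.
move=> e e0; have k0 : 0 < cmod d + 1 by rewrite ltr_wpDl // cmod_ge0.
exists (e / (cmod d + 1)); first by rewrite divr_gt0.
move=> w; rewrite ltr_pdivlMr // => we.
have -> : a + d * (w - s) - (a + d * (z - s)) = d * (w - z) by ring.
rewrite cmodM (le_lt_trans _ we) // mulrC ler_wpM2l ?cmod_ge0 //.
by rewrite lerDl.
Qed.

Lemma rint_quarter f x y h k : 0 <= h -> 0 <= k ->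
  rect_cont f x (x + h) y (y + k) ->
  exists x' y', [/\ x <= x', x' + h / 2 <= x + h, y <= y', y' + k / 2 <= y + k &
    cmod (rint f x (x + h) y (y + k)) <=
    4 * cmod (rint f x' (x' + h / 2) y' (y' + k / 2))].
Proof.
move=> h0 k0 fc.
have eh : x + h / 2 + h / 2 = x + h by rewrite -addrA -splitr.
have ek : y + k / 2 + k / 2 = y + k by rewrite -addrA -splitr.
have h2 : 0 <= h / 2 by rewrite divr_ge0.
have k2 : 0 <= k / 2 by rewrite divr_ge0.
have xh1 : x <= x + h / 2 by rewrite lerDl.
have xh2 : x + h / 2 <= x + h by rewrite -eh lerDl.
have yk1 : y <= y + k / 2 by rewrite lerDl.
have yk2 : y + k / 2 <= y + k by rewrite -ek lerDl.
rewrite (rint_splitx xh1 xh2); first last.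
- by move=> v vv; apply: fc; rewrite ?xh1.
- by apply: rect_cont_rbd fc; rewrite ?lerDl.
rewrite (rint_splity yk1 yk2); first last.
- by move=> v /andP[v1 v2]; apply: fc; rewrite ?yk1 // v1 (le_trans v2).
- by apply: rect_cont_rbd; [|rewrite lerDl|exact: rect_contS fc].
rewrite (rint_splity yk1 yk2); first last.
- by move=> v /andP[v1 v2]; apply: fc; rewrite ?yk1 // v2 (le_trans xh1).
- by apply: rect_cont_rbd; [|rewrite lerDl|exact: rect_contS fc].
set A := rint f x (x + h / 2) y (y + k / 2).
set B := rint f x (x + h / 2) (y + k / 2) (y + k).
set C := rint f (x + h / 2) (x + h) y (y + k / 2).
set D := rint f (x + h / 2) (x + h) (y + k / 2) (y + k).
have tri : cmod (A + B + (C + D)) <= cmod A + cmod B + (cmod C + cmod D).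
  by rewrite (le_trans (cmodD _ _)) // lerD // cmodD.
pose m := cmod (A + B + (C + D)).
have [mA|mA] := leP m (4 * cmod A).
  by exists x, y; rewrite !lexx xh2 yk2.
have [mB|mB] := leP m (4 * cmod B).
  by exists x, (y + k / 2); rewrite !lexx xh2 yk1 ek lexx.
have [mC|mC] := leP m (4 * cmod C).
  by exists (x + h / 2), y; rewrite !lexx xh1 yk2 eh lexx.
exists (x + h / 2), (y + k / 2); rewrite eh ek !lexx xh1 yk1; split=> //.
move: mA mB mC tri; rewrite /m; lra.
Qed.

(** Repeated quartering selects nested rectangles, the [n]-th of which carries at
least [4^-n] of the integral. At their common point the function is affine up to
[o(2^-n)], affine functions integrate to zero, and the perimeter is of order
[2^-n], so that the integral is [o(4^-n)]. *)
Lemma goursat f x1 x2 y1 y2 : x1 <= x2 -> y1 <= y2 ->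
  rect_diff f x1 x2 y1 y2 -> rint f x1 x2 y1 y2 = 0.
Proof.
move=> x12 y12 fd; apply: cmod_eq0; apply/eqP; rewrite eq_le cmod_ge0 andbT.
pose h := x2 - x1; pose k := y2 - y1.
have h0 : 0 <= h by rewrite subr_ge0.
have k0 : 0 <= k by rewrite subr_ge0.
have xh : x2 = x1 + h by rewrite /h addrC subrK.
have yk : y2 = y1 + k by rewrite /k addrC subrK.
pose hn n : R := h / 2 ^+ n; pose kn n : R := k / 2 ^+ n.
have hn0 n : 0 <= hn n by rewrite divr_ge0 // exprn_ge0.
have kn0 n : 0 <= kn n by rewrite divr_ge0 // exprn_ge0.
have hnS n : hn n / 2 = hn n.+1 by rewrite /hn exprSr invfM mulrA.
have knS n : kn n / 2 = kn n.+1 by rewrite /kn exprSr invfM mulrA.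
have fc := rect_diff_cont fd.
pose good n (q : R * R) := [/\ x1 <= q.1, q.1 + hn n <= x2, y1 <= q.2 & q.2 + kn n <= y2].
pose I n (q : R * R) := cmod (rint f q.1 (q.1 + hn n) q.2 (q.2 + kn n)).
have step (nq : nat * (R * R)) : exists q' : R * R, good nq.1 nq.2 ->
    [/\ nq.2.1 <= q'.1, q'.1 + hn nq.1.+1 <= nq.2.1 + hn nq.1,
        nq.2.2 <= q'.2, q'.2 + kn nq.1.+1 <= nq.2.2 + kn nq.1 &
        I nq.1 nq.2 <= 4 * I nq.1.+1 q'].
  case: nq => n [x y] /=.
  have [[/= g1 g2 g3 g4]|ng] := pselect (good n (x, y)); last by exists (x, y).
  have fc' : rect_cont f x (x + hn n) y (y + kn n) by exact: rect_contS fc.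
  have [x' [y' [a1 a2 a3 a4 a5]]] := rint_quarter (hn0 n) (kn0 n) fc'.
  exists (x', y') => _; rewrite /= -hnS -knS; split=> //.
  by rewrite /I /= -hnS -knS.
have [nxt nxtP] := choice step.
pose q := fix q n := if n is m.+1 then nxt (m, q m) else (x1, y1).
have hn00 : hn 0%N = h by rewrite /hn expr0 divr1.
have kn00 : kn 0%N = k by rewrite /kn expr0 divr1.
have qgood n : good n (q n).
  elim: n => [|n IH]; first by rewrite /good /= hn00 kn00 -xh -yk !lexx.
  have [/= b1 b2 b3 b4 _] := nxtP (n, q n) IH.
  have [g1 g2 g3 g4] := IH; split=> /=.
  - exact: le_trans b1.
  - exact: le_trans g2.
  - exact: le_trans b3.
  - exact: le_trans g4.
have qI n : I 0%N (q 0%N) <= 4 ^+ n * I n (q n).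
  elim: n => [|n IH]; first by rewrite expr0 mul1r.
  apply: (le_trans IH); rewrite exprSr -mulrA ler_pM2l ?exprn_gt0 //.
  by have [] := nxtP (n, q n) (qgood n).
have qmono m n : (m <= n)%N -> [/\ (q m).1 <= (q n).1,
    (q n).1 + hn n <= (q m).1 + hn m, (q m).2 <= (q n).2 &
    (q n).2 + kn n <= (q m).2 + kn m].
  move=> /subnK <-; elim: (n - m)%N => [|j [i1 i2 i3 i4]].
    by rewrite add0n !lexx.
  have [/= b1 b2 b3 b4 _] := nxtP ((j + m)%N, q (j + m)%N) (qgood _).
  by rewrite addSn; split=> //=; [exact: le_trans b1|exact: le_trans i2|
     exact: le_trans b3|exact: le_trans i4].
have lim_between (u v : nat -> R) : (forall m n, u m <= v n) ->
    exists l, forall n, u n <= l <= v n.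
  move=> uv; exists (sup (range u)) => n; apply/andP; split.
    apply: ub_le_sup; last by exists n.
    by exists (v 0%N) => _ [m _ <-].
  by apply: ge_sup; [exists (u 0%N), 0%N|move=> _ [m _ <-]].
have [a aP] : exists l, forall n, (q n).1 <= l <= (q n).1 + hn n.
  apply: lim_between => m n; have [/qmono[a1 _ _ _]|/ltnW/qmono[_ a2 _ _]] := leqP m n.
    by rewrite (le_trans a1) // lerDl.
  by rewrite (le_trans _ a2) // lerDl.
have [b bP] : exists l, forall n, (q n).2 <= l <= (q n).2 + kn n.
  apply: lim_between => m n; have [/qmono[_ _ a1 _]|/ltnW/qmono[_ _ _ a2]] := leqP m n.
    by rewrite (le_trans a1) // lerDl.
  by rewrite (le_trans _ a2) // lerDl.
have I0 : I 0%N (q 0%N) = cmod (rint f x1 x2 y1 y2).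
  by rewrite /I /= hn00 kn00 -xh -yk.
have [d fdd] : exists d, cdiff f (a +i* b) d.
  have [g1 g2 g3 g4] := qgood 0%N.
  have /andP[a1 a2] := aP 0%N; have /andP[b1 b2] := bP 0%N.
  apply: fd; first by rewrite (le_trans g1 a1) (le_trans a2 g2).
  by rewrite (le_trans g3 b1) (le_trans b2 g4).
rewrite -I0; apply/ler_addgt0Pl => e e0; rewrite addr0.
(* so that [4^n] times the final bound [4 (e / c) ((h + k) / 2^n)^2] is below [e] *)
pose c := 4 * (h + k) * (h + k) + 1.
have c0 : 0 < c by rewrite ltr_wpDl // !mulr_ge0 // addr_ge0.
have ec : 0 < e / c by rewrite divr_gt0.
have [r r0 rP] := fdd _ ec.
have [n hkr] : exists n, (h + k) / 2 ^+ n < r.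
  exists (Num.truncn ((h + k) / r)).+1; rewrite ltr_pdivrMr ?exprn_gt0 // mulrC.
  rewrite -ltr_pdivrMr // (lt_le_trans (truncnS_gt _)) // -natrX ler_nat.
  exact/ltnW/ltn_expl.
apply: (le_trans (qI n)).
have [g1 g2 g3 g4] := qgood n.
have dist x y : (q n).1 <= x <= (q n).1 + hn n ->
    (q n).2 <= y <= (q n).2 + kn n ->
    cmod ((x +i* y) - (a +i* b)) <= (h + k) / 2 ^+ n.
  move=> /andP[x_1 x_2] /andP[y_1 y_2]; rewrite (le_trans (cmod_le _)) //.
  rewrite cReD cReN cImD cImN /= mulrDl -/(hn n) -/(kn n).
  have /andP[a1 a2] := aP n; have /andP[b1 b2] := bP n.
  by rewrite lerD // ler_norml; apply/andP; split; lra.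
have qx : (q n).1 <= (q n).1 + hn n by rewrite lerDl.
have qy : (q n).2 <= (q n).2 + kn n by rewrite lerDl.
have fcn : rect_cont f (q n).1 ((q n).1 + hn n) (q n).2 ((q n).2 + kn n).
  exact: rect_contS fc.
pose L z := f (a +i* b) + d * (z - (a +i* b)).
have Lc x x' y y' : rect_cont L x x' y y' by move=> ? ? _ _; exact: ccontC_affine.
have -> : I n (q n) = cmod (rint (fun z => f z - L z)
    (q n).1 ((q n).1 + hn n) (q n).2 ((q n).2 + kn n)).
  rewrite rintB ?rint_affine ?subr0 //; first exact: rect_cont_rbd.
  by apply: rect_cont_rbd => //; exact: Lc.
pose M := e / c * ((h + k) / 2 ^+ n).
have : cmod (rint (fun z => f z - L z)
    (q n).1 ((q n).1 + hn n) (q n).2 ((q n).2 + kn n)) <=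
    4 * M * (hn n + kn n).
  have -> : hn n + kn n = (q n).1 + hn n - (q n).1 + ((q n).2 + kn n - (q n).2).
    by ring.
  have EM x y : (q n).1 <= x <= (q n).1 + hn n ->
      (q n).2 <= y <= (q n).2 + kn n -> cmod (f (x +i* y) - L (x +i* y)) <= M.
    move=> xx yy; rewrite /L opprD addrA.
    have xyd := dist x y xx yy.
    have := rP _ (le_lt_trans xyd hkr); move=> /le_trans; apply.
    by rewrite /M ler_pM2l.
  apply: cmod_rint_bound => //.
  - apply: rect_cont_rbd => // x y xx yy.
    exact: ccontC_B (fcn _ _ xx yy) (Lc _ _ _ _ _ _ xx yy).
  - by move=> x xx; split; apply: EM; rewrite ?lexx ?qy ?andbT //.
  - by move=> y yy; split; apply: EM; rewrite ?lexx ?qx ?andbT //.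
move=> IM; have n4 : 0 < 4 ^+ n :> R by rewrite exprn_gt0.
move: IM; rewrite -(ler_pM2l n4) => /le_trans; apply.
have -> : 4 ^+ n * (4 * M * (hn n + kn n)) = e / c * (4 * (h + k) * (h + k)).
  have -> : (4 : R) = 2 ^+ 2 by rewrite -natrX.
  rewrite -exprM mulnC exprM expr2 /M /hn /kn.
  field.
  by rewrite gt_eqF //= expf_neq0.
rewrite mulrAC ler_pdivrMr // ler_pM2l // /c lerDl //.
Qed.

End goursat_theorem.

(** * Borel sets of the plane and supports of measures *)

Section boxes.
Context {R : realType}.
Implicit Types (z : R[i]) (A : set R[i]).

(** A countable base of the topology. *)
Definition cbox (q : rat * rat * rat) : set R[i] :=
  [set z | `|complex.Re z - ratr q.1.1| < ratr q.2 /\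
           `|complex.Im z - ratr q.1.2| < ratr q.2].

Lemma cbox_open q : open (cbox q : set R[i]^o).
Proof.
rewrite openE => z [/= z1 z2].
pose m := Num.min (ratr q.2 - `|complex.Re z - ratr q.1.1|)
                  (ratr q.2 - `|complex.Im z - ratr q.1.2|).
apply/cnbhsP; exists m => [|w]; first by rewrite lt_min !subr_gt0 z1.
rewrite lt_min => /andP[w1 w2]; split.
  apply: le_lt_trans (ler_distD (complex.Re z) _ _) _.
  rewrite -ltrBrDr; apply: le_lt_trans w1.
  by rewrite -cReN -cReD Re_le_cmod.
apply: le_lt_trans (ler_distD (complex.Im z) _ _) _.
rewrite -ltrBrDr; apply: le_lt_trans w2.
by rewrite -cImN -cImD Im_le_cmod.
Qed.

Lemma cbox_small z (e : R) : 0 < e -> exists2 q, cbox q z &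
  forall w, cbox q w -> cmod (w - z) < e.
Proof.
move=> e0; have e4 : 0 < e / 4 by rewrite divr_gt0.
have [r /[!in_itv]/= /andP[r0 r1]] := rat_in_itvoo e4.
have [a /[!in_itv]/= /andP[a0 a1]] : exists a, ratr a \in `]complex.Re z - ratr r, complex.Re z + ratr r[.
  by apply: rat_in_itvoo; lra.
have [b /[!in_itv]/= /andP[b0 b1]] : exists a, ratr a \in `]complex.Im z - ratr r, complex.Im z + ratr r[.
  by apply: rat_in_itvoo; lra.
exists (a, b, r); first by split; rewrite /= ltr_norml; apply/andP; split; lra.
move=> w [/= ]; rewrite !ltr_norml => /andP[w1 w2] /andP[w3 w4].
rewrite (le_lt_trans (cmod_le _)) // cReD cReN cImD cImN.
have -> : e = e / 4 + e / 4 + (e / 4 + e / 4) by field.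
by rewrite ltrD // ltr_norml; apply/andP; split; lra.
Qed.

(** The plane is Lindelof, and countably many boxes suffice. *)
Lemma lindelof_boxes A (C : set (set R[i])) :
  (forall z, A z -> exists2 V, C V & open (V : set R[i]^o) /\ V z) ->
  exists F : nat -> set R[i],
    (forall n, F n = set0 \/
       (exists q, F n = cbox q) /\ exists2 V, C V & F n `<=` V) /\
    A `<=` \bigcup_n F n.
Proof.
move=> AC; pose good q := exists2 V, C V & cbox q `<=` V.
pose F n : set R[i] := if @unpickle (rat * rat * rat)%type n is Some q
  then (if pselect (good q) is left _ then cbox q else set0) else set0.
exists F; split.
  move=> n; rewrite /F; case: unpickle => [q|]; last by left.
  by case: pselect => [[V CV qV]|_]; [right; split; [exists q|exists V]|left].
move=> z /AC[V CV [oV Vz]].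
have /cnbhsP[e e0 eV] : nbhs (z : R[i]^o) V by apply: open_nbhs_nbhs.
have [q qz qe] := cbox_small z e0.
have gq : good q by exists V => // w /qe; exact: eV.
exists (pickle q); first by [].
rewrite /F pickleK; case: (pselect (good q)) => [_|/(_ gq)[]]; exact: qz.
Qed.

Lemma open_bigcup_boxes (U : set R[i]) : open (U : set R[i]^o) ->
  exists F : nat -> set R[i],
    (forall n, F n = set0 \/ exists q, F n = cbox q) /\ U = \bigcup_n F n.
Proof.
move=> oU; have [|F [FP UF]] := @lindelof_boxes U [set U].
  by move=> z Uz; exists U.
exists F; split; first by move=> n; have [->|[]] := FP n; [left|right].
apply/seteqP; split=> // z [n _]; case: (FP n) => [->//|[_ [V -> FV]]].
exact: FV.
Qed.

Lemma measurable_cplx (U : set R[i]) : open (U : set R[i]^o) ->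
  measurable [set xy : R * R | U (xy.1 +i* xy.2)].
Proof.
move=> /open_bigcup_boxes[F [FP ->]].
rewrite (_ : [set _ | _] = \bigcup_n [set xy : R * R | F n (xy.1 +i* xy.2)]) //.
apply: bigcupT_measurable => n; case: (FP n) => [->|[q ->]].
  by rewrite (_ : [set _ | _] = set0) //; exact: measurable0.
rewrite (_ : [set _ | _] =
  `]ratr q.1.1 - ratr q.2, ratr q.1.1 + ratr q.2[%classic `*`
  `]ratr q.1.2 - ratr q.2, ratr q.1.2 + ratr q.2[%classic).
  by apply: measurableX; exact: measurable_itv.
by apply/seteqP; split=> -[x y]; rewrite /cbox /= !in_itv /= !ltr_distl => -[].
Qed.

Lemma measurable_fun_cplx (U : set R[i]) (h : R[i] -> R) :
  open (U : set R[i]^o) ->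
  (forall z, U z -> {for (z : R[i]^o), continuous (h : R[i]^o -> R)}) ->
  measurable_fun [set xy : R * R | U (xy.1 +i* xy.2)]
    (fun xy : R * R => h (xy.1 +i* xy.2)).
Proof.
move=> oU hc; apply: (measurability _ (measurable_realfun.RGenOpens.measurableE R)).
move=> _ [_ [a [b ->] <-]].
have oV : open (U `&` h @^-1` `]a, b[ : set R[i]^o).
  rewrite openE => z [Uz hz]; apply: filterI; first exact: open_nbhs_nbhs.
  by apply: (hc z Uz); apply: open_nbhs_nbhs; split=> //; exact: interval_open.
exact: (measurable_cplx oV).
Qed.

Lemma borelC_open (U : set R[i]) : open (U : set R[i]^o) ->
  measurable (U : set (borelC R)).
Proof. by move=> oU; exact: sub_sigma_algebra. Qed.

Lemma measurable_fun_borelC (U : set R[i]) (h : R[i] -> R) :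
  open (U : set R[i]^o) ->
  (forall z, U z -> {for (z : R[i]^o), continuous (h : R[i]^o -> R)}) ->
  measurable_fun (U : set (borelC R)) (h : borelC R -> R).
Proof.
move=> oU hc; apply: (measurability _ (measurable_realfun.RGenOpens.measurableE R)).
move=> _ [_ [a [b ->] <-]].
have oV : open (U `&` h @^-1` `]a, b[ : set R[i]^o).
  rewrite openE => z [Uz hz]; apply: filterI; first exact: open_nbhs_nbhs.
  by apply: (hc z Uz); apply: open_nbhs_nbhs; split=> //; exact: interval_open.
exact: (borelC_open oV).
Qed.

(** A measure is concentrated on its support, because the complement of the
support is a union of countably many null boxes. *)
Lemma msupport_null (mu : {measure set (borelC R) -> \bar R}) (U : set R[i]) :
  open (U : set R[i]^o) -> msupport mu `&` U = set0 -> mu U = 0%E.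
Proof.
move=> oU sU.
have [z Uz|F [FP UF]] :=
    @lindelof_boxes U [set V | open (V : set R[i]^o) /\ mu V = 0%E].
  have : ~ msupport mu z.
    by move=> zs; have : (msupport mu `&` U) z by []; rewrite sU.
  move=> /existsNP[V /not_implyP[oV /not_implyP[Vz /negP]]].
  by rewrite -leNgt measure_le0 => /eqP V0; exists V.
have mF n : measurable (F n : set (borelC R)).
  case: (FP n) => [->|[[q ->] _]]; first exact: measurable0.
  by apply: borelC_open; exact: cbox_open.
have F0 n : mu.-negligible (F n).
  case: (FP n) => [->|[_ [V [oV V0] FV]]]; first exact: negligible_set0.
  by exists V; split=> //; exact: borelC_open.
apply: measure_negligible; first exact: borelC_open.
by apply: (@negligibleS _ _ _ mu (\bigcup_n (F n : set (borelC R))) U UF); apply: negligible_bigcup.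
Qed.

End boxes.

(** * Cauchy's formula on rectangles *)

Section cauchy_kernel.
Context {R : realType}.
Local Notation leb := (@lebesgue_measure R).
Implicit Types (x y : R) (f g : R[i] -> R[i]).

(** Surrounding a point by a small rectangle leaves four rectangles that avoid
the point, so that an isolated singularity can be circumscribed as tightly as
one likes. *)
Lemma rint_annulus g (x0 y0 : R) x1 x2 y1 y2 u1 u2 v1 v2 :
  x1 <= u1 -> u1 < x0 -> x0 < u2 -> u2 <= x2 ->
  y1 <= v1 -> v1 < y0 -> y0 < v2 -> v2 <= y2 ->
  (forall x y, x1 <= x <= x2 -> y1 <= y <= y2 -> x != x0 \/ y != y0 ->
     exists d, cdiff g (x +i* y) d) ->
  rint g x1 x2 y1 y2 = rint g u1 u2 v1 v2.
Proof.
move=> xu1 ux1 xu2 ux2 yv1 vy1 yv2 vy2 gd.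
have gc x y : x1 <= x <= x2 -> y1 <= y <= y2 -> x != x0 \/ y != y0 ->
    ccontC g (x +i* y).
  by move=> xx yy /(gd x y xx yy)[d /cdiff_ccontC].
have x12 : u1 <= u2 by lra.
have y12 : v1 <= v2 by lra.
have good a1 a2 b1 b2 : x1 <= a1 -> a1 <= a2 -> a2 <= x2 -> y1 <= b1 ->
    b1 <= b2 -> b2 <= y2 ->
    [\/ a2 < x0, x0 < a1, b2 < y0 | y0 < b1] -> rint g a1 a2 b1 b2 = 0.
  move=> h1 h2 h3 h4 h5 h6 h7; apply: goursat => // x y /andP[x_1 x_2] /andP[y_1 y_2].
  apply: gd; first by rewrite (le_trans h1) // (le_trans x_2).
    by rewrite (le_trans h4) // (le_trans y_2).
  case: h7 => h; [left|left|right|right].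
  - by rewrite lt_eqF // (le_lt_trans x_2).
  - by rewrite gt_eqF // (lt_le_trans h).
  - by rewrite lt_eqF // (le_lt_trans y_2).
  - by rewrite gt_eqF // (lt_le_trans h).
have bd a1 a2 b1 b2 : x1 <= a1 -> a1 <= a2 -> a2 <= x2 -> y1 <= b1 ->
    b1 <= b2 -> b2 <= y2 -> a1 != x0 -> a2 != x0 -> b1 != y0 -> b2 != y0 ->
    rbd_cont g a1 a2 b1 b2.
  move=> h1 h2 h3 h4 h5 h6 n1 n2 n3 n4; split=> [x /andP[x_1 x_2]|y /andP[y_1 y_2]].
    have xx : x1 <= x <= x2 by rewrite (le_trans h1) // (le_trans x_2).
    by split; apply: gc => //; [rewrite h4 (le_trans h5)|right|
      rewrite h6 (le_trans h4)|right].
  have yy : y1 <= y <= y2 by rewrite (le_trans h4) // (le_trans y_2).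
  by split; apply: gc => //; [rewrite h1 (le_trans h2)|left|
      rewrite h3 (le_trans h1)|left].
have nu1 : u1 != x0 by rewrite lt_eqF.
have nu2 : u2 != x0 by rewrite gt_eqF.
have nv1 : v1 != y0 by rewrite lt_eqF.
have nv2 : v2 != y0 by rewrite gt_eqF.
have nx1 : x1 != x0 by rewrite lt_eqF //; lra.
have nx2 : x2 != x0 by rewrite gt_eqF //; lra.
have ny1 : y1 != y0 by rewrite lt_eqF //; lra.
have ny2 : y2 != y0 by rewrite gt_eqF //; lra.
have yy12 : y1 <= y2 by lra.
have xu12 : u1 <= x2 by lra.
have yv12 : v1 <= y2 by lra.
have xx12 : x1 <= x2 by lra.
have xx1u2 : x1 <= u2 by lra.
have yy1v2 : y1 <= v2 by lra.
rewrite (@rint_splitx _ g x1 x2 y1 y2 u1) //; first last.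
- by move=> y yy; apply: gc => //; [rewrite xu1|left].
- exact: bd.
rewrite (@good x1 u1 y1 y2) ?lexx //; last exact: Or41.
rewrite (@rint_splitx _ g u1 x2 y1 y2 u2) //; first last.
- by move=> y yy; apply: gc => //; [rewrite xx1u2|left].
- exact: bd.
rewrite (@good u2 x2 y1 y2) ?lexx //; last exact: Or42.
have xu x : u1 <= x <= u2 -> x1 <= x <= x2.
  by move=> /andP[a b]; rewrite (le_trans xu1) // (le_trans b).
rewrite (@rint_splity _ g u1 u2 y1 y2 v1) //; first last.
- by move=> x /xu xx; apply: gc => //; [rewrite yv1|right].
- exact: bd.
rewrite (@good u1 u2 y1 v1) ?lexx //; last exact: Or43.
rewrite (@rint_splity _ g u1 u2 v1 y2 v2) //; first last.
- by move=> x /xu xx; apply: gc => //; [rewrite yy1v2|right].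
- exact: bd.
rewrite (@good u1 u2 v2 y2) ?lexx //; last exact: Or44.
by rewrite !add0r !addr0.
Qed.

Lemma cdiff_div f (s z d : R[i]) : z != s -> cdiff f z d ->
  exists d', cdiff (fun w => f w / (w - s)) z d'.
Proof.
move=> zs fd; apply/derivable_cdiff; apply: (@derivableM R[i] R[i]^o).
  by apply/derivable_cdiff; exists d.
apply: (@derivableV R[i] R[i]^o); first by rewrite subr_eq0.
by apply: derivableB; [exact: derivable_id|exact: derivable_cst].
Qed.

Lemma cdiff_cst (c z : R[i]) : cdiff (fun=> c) z 0.
Proof.
move=> e e0; exists 1 => // w _.
by rewrite subrr mul0r subr0 cmod0 mulr_ge0 ?cmod_ge0 // ltW.
Qed.

Lemma cdiffB_cst f (c z d : R[i]) : cdiff f z d -> cdiff (fun w => f w - c) z d.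
Proof.
move=> fd e e0; have [r r0 rP] := fd e e0; exists r => // w /rP.
by rewrite opprB addrA subrK.
Qed.

(** The difference quotient of [f] at the point is bounded nearby, so that its
integral around arbitrarily small squares vanishes. *)
Lemma rint_cauchy f (x0 y0 : R) x1 x2 y1 y2 :
  x1 < x0 -> x0 < x2 -> y1 < y0 -> y0 < y2 -> rect_diff f x1 x2 y1 y2 ->
  rint (fun z => f z / (z - (x0 +i* y0))) x1 x2 y1 y2 =
  f (x0 +i* y0) * rint (fun z => (z - (x0 +i* y0))^-1) x1 x2 y1 y2.
Proof.
move=> hx1 hx2 hy1 hy2 fd; set s := x0 +i* y0.
have zs x y : x != x0 \/ y != y0 -> x +i* y != s.
  by move=> n; apply/eqP => -[ex ey]; case: n => /eqP.
pose E z := (f z - f s) / (z - s).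
have Ed x y : x1 <= x <= x2 -> y1 <= y <= y2 -> x != x0 \/ y != y0 ->
    exists d, cdiff E (x +i* y) d.
  move=> xx yy /zs n; have [d fdd] := fd x y xx yy.
  by apply: cdiff_div => //; exact: cdiffB_cst fdd.
have gd h x y : rect_diff h x1 x2 y1 y2 -> x1 <= x <= x2 -> y1 <= y <= y2 ->
    x != x0 \/ y != y0 -> ccontC (fun z => h z / (z - s)) (x +i* y).
  move=> hd xx yy /zs n; have [d hdd] := hd x y xx yy.
  by have [d' /cdiff_ccontC] := cdiff_div n hdd.
have bd h : rect_diff h x1 x2 y1 y2 -> rbd_cont (fun z => h z / (z - s)) x1 x2 y1 y2.
  move=> hd; have x12 : x1 <= x2 by lra.
  have y12 : y1 <= y2 by lra.
  split=> [x xx|y yy]; split; apply: gd; rewrite ?lexx ?x12 ?y12 //.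
  - by right; rewrite lt_eqF.
  - by right; rewrite gt_eqF.
  - by left; rewrite lt_eqF.
  - by left; rewrite gt_eqF.
have cd c : rect_diff (fun=> c) x1 x2 y1 y2.
  by move=> x y _ _; exists 0; exact: cdiff_cst.
have E0 : rint E x1 x2 y1 y2 = 0.
  apply: cmod_eq0; apply/eqP; rewrite eq_le cmod_ge0 andbT.
  have [d fdd] : exists d, cdiff f s d by apply: fd; apply/andP; split; exact: ltW.
  have [r r0 rP] := fdd 1 ltr01.
  pose M := cmod d + 1.
  have M0 : 0 < M by rewrite ltr_wpDl // cmod_ge0.
  have EM z : cmod (z - s) < r -> z != s -> cmod (E z) <= M.
    move=> /rP + n; rewrite mul1r /E cmodM cmodV => zr.
    rewrite ler_pdivrMr; last by rewrite cmod_gt0 // subr_eq0.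
    rewrite /M mulrDl mul1r -cmodM [leRHS]addrC.
    by rewrite -[f z - f s](subrK (d * (z - s))) (le_trans (cmodD _ _)) // lerD2r.
  apply/ler_addgt0Pl => e e0; rewrite addr0.
  pose t := Num.min (Num.min (Num.min (x0 - x1) (x2 - x0)) (Num.min (y0 - y1) (y2 - y0)))
    (Num.min (r / 4) (e / (16 * M))).
  have t0 : 0 < t.
    by rewrite !lt_min !subr_gt0 hx1 hx2 hy1 hy2 !divr_gt0 // mulr_gt0.
  have [t1 t2 t3 t4] : [/\ t <= x0 - x1, t <= x2 - x0, t <= y0 - y1 & t <= y2 - y0].
    by split; rewrite !ge_min lexx ?orbT.
  have [t5 t6] : t <= r / 4 /\ t <= e / (16 * M).
    by split; rewrite !ge_min lexx ?orbT.
  rewrite (@rint_annulus E x0 y0 x1 x2 y1 y2 (x0 - t) (x0 + t) (y0 - t) (y0 + t)) //; try lra.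
  have sm x y : x0 - t <= x <= x0 + t -> y0 - t <= y <= y0 + t ->
      cmod ((x +i* y) - s) < r.
    move=> /andP[xa xb] /andP[ya yb].
    rewrite (le_lt_trans (cmod_le _)) // cReD cReN cImD cImN /=.
    have ? : `|x - x0| <= t by rewrite ler_norml; apply/andP; split; lra.
    have ? : `|y - y0| <= t by rewrite ler_norml; apply/andP; split; lra.
    lra.
  apply: (@le_trans _ _ (4 * M * (x0 + t - (x0 - t) + (y0 + t - (y0 - t))))).
    have tx : x0 - t <= x0 + t by lra.
    have ty : y0 - t <= y0 + t by lra.
    have nx1 : x0 - t != x0 by rewrite lt_eqF //; lra.
    have nx2 : x0 + t != x0 by rewrite gt_eqF //; lra.
    have ny1 : y0 - t != y0 by rewrite lt_eqF //; lra.
    have ny2 : y0 + t != y0 by rewrite gt_eqF //; lra.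
    have Ec x y : x0 - t <= x <= x0 + t -> y0 - t <= y <= y0 + t ->
        x != x0 \/ y != y0 -> ccontC E (x +i* y).
      move=> /andP[xa xb] /andP[ya yb] n.
      have xx : x1 <= x <= x2 by apply/andP; split; lra.
      have yy : y1 <= y <= y2 by apply/andP; split; lra.
      by have [d' /cdiff_ccontC] := Ed x y xx yy n.
    apply: cmod_rint_bound => //.
    - split=> [x xx|y yy].
        by split; apply: Ec => //; rewrite ?lexx ?ty //; right.
      by split; apply: Ec => //; rewrite ?lexx ?tx //; left.
    - by move=> x xx; split; apply: EM; [apply: sm => //; rewrite lexx ty|apply: zs; right
        |apply: sm => //; rewrite lexx ty|apply: zs; right].
    - by move=> y yy; split; apply: EM; [apply: sm => //; rewrite lexx tx|apply: zs; left
        |apply: sm => //; rewrite lexx tx|apply: zs; left].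
  have -> : 4 * M * (x0 + t - (x0 - t) + (y0 + t - (y0 - t))) = 16 * M * t by ring.
  by rewrite mulrC -ler_pdivlMr // mulr_gt0.
have kE : rbd_cont (fun z => (z - s)^-1) x1 x2 y1 y2.
  by have := bd _ (cd 1); congr rbd_cont; apply/funext => z; rewrite mul1r.
have EE : (fun z => f z / (z - s) - f s / (z - s)) = E.
  by apply/funext => z; rewrite /E mulrBl.
have := rintB (bd _ fd) (bd _ (cd (f s))); rewrite EE E0 => /esym/eqP.
by rewrite subr_eq0 => /eqP ->; exact: rintZ.
Qed.

(** The integral of the Cauchy kernel around its pole is [2 pi i]; the bound
below is enough, and follows from the positivity of the imaginary part of
the integrand on each of the four sides. *)
Lemma rint_kernel_ge (x0 y0 : R) x1 x2 y1 y2 r : 0 < r ->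
  x0 - r <= x1 <= x0 - r / 2 -> x0 + r / 2 <= x2 <= x0 + r ->
  y0 - r <= y1 <= y0 - r / 2 -> y0 + r / 2 <= y2 <= y0 + r ->
  1 <= cmod (rint (fun z => (z - (x0 +i* y0))^-1) x1 x2 y1 y2).
Proof.
move=> r0 /andP[xa xb] /andP[xc xd] /andP[ya yb] /andP[yc yd].
set k := fun z => _.
have kI u v : complex.Im (k (u +i* v)) = - (v - y0) / ((u - x0) ^+ 2 + (v - y0) ^+ 2).
  by rewrite /k /= mulNr.
have kR u v : complex.Re (k (u +i* v)) = (u - x0) / ((u - x0) ^+ 2 + (v - y0) ^+ 2).
  by rewrite /k /=.
have kc x y : x != x0 \/ y != y0 -> ccontC k (x +i* y).
  move=> n; have zs : x +i* y != x0 +i* y0.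
    by apply/eqP => -[ex ey]; case: n => /eqP.
  have [d /cdiff_ccontC] := cdiff_div zs (cdiff_cst 1 (x +i* y)).
  by congr ccontC; apply/funext => z; rewrite mul1r.
have /rbd_cont_itv[f1 f2 f3 f4] : rbd_cont k x1 x2 y1 y2.
  split=> [x _|y _]; split; apply: kc.
  - by right; rewrite lt_eqF //; lra.
  - by right; rewrite gt_eqF //; lra.
  - by left; rewrite lt_eqF //; lra.
  - by left; rewrite gt_eqF //; lra.
apply: le_trans (Im_le_cmod _); apply: le_trans (ler_norm _).
have iM z : complex.Im ((0 +i* 1) * z) = complex.Re z :> R.
  by rewrite cImM /= mul0r add0r mul1r.
rewrite /rint cImD iM.
have low (u v : R) : `|u| <= r -> r / 2 <= v -> v <= r ->
    (4 * r)^-1 <= v / (u ^+ 2 + v ^+ 2).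
  move=> ur v1 v2; have uv : 0 < u ^+ 2 + v ^+ 2.
    by rewrite ltr_wpDl ?sqr_ge0 // exprn_gt0 //; lra.
  rewrite ler_pdivlMr // mulrC ler_pdivrMr ?mulr_gt0 //.
  have u2 : u ^+ 2 <= r ^+ 2.
    by rewrite -(real_normK (num_real u)) lerXn2r // ?nnegrE // ltW.
  have v3 : v ^+ 2 <= r ^+ 2 by rewrite lerXn2r // ?nnegrE; lra.
  have : r / 2 * (4 * r) <= v * (4 * r) by rewrite ler_pM2r // mulr_gt0.
  rewrite !expr2 in u2 v3 *; nra.
have side (h : R -> R) (a b : R) : r <= b - a ->
    leb.-integrable `[a, b] (EFin \o h) ->
    (forall t, a <= t <= b -> (2 * r)^-1 <= h t) ->
    2^-1 <= \int[leb]_(t in `[a, b]) h t.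
  move=> rab hi hr; have fab : fine (leb `[a, b]) = b - a.
    by rewrite lebesgue_measure_cc //; lra.
  apply: (@le_trans _ _ ((2 * r)^-1 * (b - a))).
    rewrite invfM -mulrA ler_pMr ?invr_gt0 // mulrC ler_pdivlMr // mul1r //.
  rewrite -fab -Rintegral_cst //; apply: le_Rintegral => //.
  by apply: continuous_at_integrable => t _; exact: cst_continuous.
clearbody k.
apply: (@le_trans _ _ (2^-1 + 2^-1)); first by lra.
have e2 : (2 * r)^-1 = (4 * r)^-1 + (4 * r)^-1 by field; rewrite gt_eqF.
have nx t : x1 <= t <= x2 -> `|t - x0| <= r.
  by move=> /andP[ta tb]; rewrite ler_norml; apply/andP; split; lra.
have ny t : y1 <= t <= y2 -> `|t - y0| <= r.
  by move=> /andP[ta tb]; rewrite ler_norml; apply/andP; split; lra.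
have rx : r <= x2 - x1 by lra.
have ry : r <= y2 - y1 by lra.
apply: lerD; apply: side => //.
- by apply: Im_integrable; exact: ccont_itvB.
- move=> t /nx tx; rewrite cImD cImN !kI e2; apply: lerD.
    by rewrite -(sqrrN (y1 - y0)); apply: low => //; lra.
  by rewrite mulNr opprK; apply: low => //; lra.
- by apply: Re_integrable; exact: ccont_itvB.
- move=> t /ny ty; rewrite cReD cReN !kR e2; apply: lerD.
    by rewrite [X in _ / X]addrC; apply: low => //; lra.
  by rewrite -mulNr -(sqrrN (x1 - x0)) [X in _ / X]addrC; apply: low => //; lra.
Qed.

End cauchy_kernel.

(** * The sub-mean-value property *)

Section powers.
Context {R : realType}.
Implicit Types (u v l B p : R).

(** With a whole exponent [n >= p], Bernoulli's inequality [1 - n (1 - t) <= t ^ n]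
gives the Lipschitz bound without differentiating. *)
Lemma powR_lipschitz p B : 1 <= p -> 0 <= B ->
  exists2 L, 0 < L & forall u v, 0 <= u <= B -> 0 <= v <= B ->
    `|u `^ p - v `^ p| <= L * `|u - v|.
Proof.
move=> p1 B0; have p0 : 0 < p by rewrite (lt_le_trans ltr01).
pose n := (Num.truncn p).+1.
have pn : p <= n%:R by exact/ltW/truncnS_gt.
have bern (t : R) : 0 <= t <= 1 -> 1 - n%:R * (1 - t) <= t ^+ n.
  move=> /andP[t0 t1]; elim: n {pn} => [|m IH].
    by rewrite mul0r subr0 expr0.
  rewrite exprS; have m0 : 0 <= m%:R :> R by [].
  have : t * (1 - m%:R * (1 - t)) <= t * t ^+ m by rewrite ler_wpM2l.
  apply: le_trans; rewrite -subr_ge0 -natr1.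
  rewrite (_ : _ - _ = m%:R * (1 - t) ^+ 2); last by ring.
  by rewrite mulr_ge0 // sqr_ge0.
exists (n%:R * (B `^ (p - 1) + 1)).
  by rewrite mulr_gt0 // ltr_wpDl // powR_ge0.
move=> u v; wlog uv : u v / u <= v.
  move=> H hu hv; have [|/ltW] := leP u v => uv; first exact: H.
  by rewrite distrC (distrC u) H.
move=> /andP[u0 uB] /andP[v0 vB].
have [v00|v1] := eqVneq v 0.
  have -> : u = v by apply/eqP; rewrite eq_le uv v00.
  by rewrite !subrr normr0 mulr0.
have {}v1 : 0 < v by rewrite lt0r v1.
rewrite distrC (distrC u) ger0_norm; last first.
  by rewrite subr_ge0 ge0_ler_powR // ltW.
rewrite ger0_norm ?subr_ge0 //.
pose t := u / v.
have t0 : 0 <= t by rewrite divr_ge0.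
have t1 : t <= 1 by rewrite ler_pdivrMr // mul1r.
have ut : u = v * t by rewrite mulrCA mulfV ?mulr1 // gt_eqF.
have vp : v `^ p = v * v `^ (p - 1) by rewrite mulr_powRB1.
have tn : 1 - n%:R * (1 - t) <= t `^ p.
  apply: (le_trans (bern t _)); first by rewrite t0.
  have [->|tn0] := eqVneq t 0; first by rewrite expr0n powR_ge0.
  by rewrite -powR_mulrn // ger_powR // lt0r tn0 t0.
have vB1 : v `^ (p - 1) <= B `^ (p - 1).
  by rewrite ge0_ler_powR ?nnegrE // subr_ge0.
have uE : u `^ p = v `^ p * t `^ p by rewrite ut powRM.
have vt : v - u = v * (1 - t) by rewrite mulrBr mulr1 -ut.
rewrite uE -[X in X - _]mulr1 -mulrBr vp vt.
have q0 := powR_ge0 v (p - 1).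
apply: (@le_trans _ _ (v * v `^ (p - 1) * (n%:R * (1 - t)))).
  by rewrite ler_wpM2l ?mulr_ge0 // lerBlDl -lerBlDr.
have -> : v * v `^ (p - 1) * (n%:R * (1 - t)) = n%:R * v `^ (p - 1) * (v * (1 - t)) by ring.
rewrite ler_wpM2r ?mulr_ge0 ?subr_ge0 // ler_wpM2l //.
by rewrite (le_trans vB1) // lerDl.
Qed.

Lemma cvg_powR (T : Type) (F : set_system T) {FF : Filter F} (g : T -> R) l p :
  1 <= p -> (forall t, 0 <= g t) -> 0 <= l ->
  g t @[t --> F] --> l -> g t `^ p @[t --> F] --> l `^ p.
Proof.
move=> p1 g0 l0 gl; have l1 : 0 <= l + 1 by rewrite addr_ge0.
have [L L0 LP] := powR_lipschitz p1 l1.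
apply/cvgrPdist_lt => e e0.
have m0 : 0 < Num.min 1 (e / L) by rewrite lt_min ltr01 divr_gt0.
move/cvgrPdist_lt : gl => /(_ _ m0); apply: filterS => t.
rewrite lt_min => /andP[t1 t2]; apply: (@le_lt_trans _ _ (L * `|l - g t|)).
  apply: LP; first by rewrite l0 lerDl ler01.
  by rewrite g0 /=; move: t1; rewrite ltr_norml => /andP[]; lra.
by rewrite mulrC -ltr_pdivlMr.
Qed.

(** A substitute for Jensen's inequality, up to a constant factor, when [l] is the
[p]-th root of a mean of the [p]-th powers. *)
Lemma le_powR_affine u l p : 1 <= p -> 0 <= u -> 0 < l ->
  u <= l + l / l `^ p * u `^ p.
Proof.
move=> p1 u0 l0; have [ul|/ltW lu] := leP u l.
  by rewrite (le_trans ul) // lerDl mulr_ge0 ?powR_ge0 // divr_ge0 ?powR_ge0 // ltW.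
apply: (@le_trans _ _ (l / l `^ p * u `^ p)); last by rewrite lerDr ltW.
have t1 : 1 <= u / l by rewrite ler_pdivlMr // mul1r.
have t0 : 0 <= u / l by rewrite (le_trans ler01).
have -> : u `^ p = l `^ p * (u / l) `^ p.
  by rewrite -powRM //; [rewrite mulrCA mulfV ?mulr1 // gt_eqF|exact: ltW].
rewrite mulrA mulfVK ?gt_eqF ?powR_gt0 //.
rewrite mulrC -ler_pdivrMr //.
by rewrite le1r_powR.
Qed.

End powers.

Section cauchy_estimate.
Context {R : realType}.
Local Notation leb := (@lebesgue_measure R).
Implicit Types (x y : R) (f : R[i] -> R[i]) (h : R[i] -> R).

Lemma continuous_cmod_powR f (z : R[i]) (p : R) : 1 <= p -> ccontC f z ->
  {for (z : R[i]^o), continuous ((fun w => cmod (f w) `^ p) : R[i]^o -> R)}.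
Proof.
move=> p1 fc.
apply: (cvg_powR (FF := nbhs_filter (z : R[i]^o)) p1 (fun=> cmod_ge0 _) (cmod_ge0 _)).
apply/(cvgrPdist_lt (FF := nbhs_filter (z : R[i]^o))) => e e0.
have [d d0 dP] := fc e e0; apply/cnbhsP; exists d => // w /dP; apply: le_lt_trans.
by rewrite distrC cmod_distr.
Qed.

Section tonelli.
Variables (U : set R[i]) (h : R[i] -> R) (X Y : set R).
Hypotheses (oU : open (U : set R[i]^o)) (h0 : forall z, 0 <= h z)
  (hc : forall z, U z -> {for (z : R[i]^o), continuous (h : R[i]^o -> R)})
  (mX : measurable X) (mY : measurable Y)
  (XYU : forall x y, X x -> Y y -> U (x +i* y)).

(* extending by zero reduces to integrals over the whole plane *)
Let G : R * R -> \bar R := (fun xy => (h (xy.1 +i* xy.2))%:E) \_ (X `*` Y).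

Let mG : measurable_fun [set: R * R] G.
Proof.
apply/(measurable_restrictT _ _).1; first exact: measurableX.
apply/measurable_EFinP.
apply: measurable_funS (measurable_fun_cplx oU hc); first exact: measurable_cplx.
by move=> [x y] [/= Xx Yy]; exact: XYU.
Qed.

Let G0 xy : (0 <= G xy)%E.
Proof. by rewrite /G /patch; case: ifP => // _; rewrite lee_fin. Qed.

Let G1 x : (\int[leb]_y G (x, y) =
  ((fun x => \int[leb]_(y in Y) (h (x +i* y))%:E) \_ X) x)%E.
Proof.
rewrite /G /patch; case: ifPn => xX.
  rewrite [RHS]integral_mkcond; apply: eq_integral => y _.
  rewrite /patch; congr (if _ then _ else _).
  by apply/idP/idP => [/set_mem[_ /mem_set]|/set_mem Yy] //;
     apply/mem_set; split=> //; exact: set_mem.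
rewrite integral0_eq // => y _; case: ifPn => // /set_mem[/= /mem_set].
by rewrite (negbTE xX).
Qed.

Let G2 y : (\int[leb]_x G (x, y) =
  ((fun y => \int[leb]_(x in X) (h (x +i* y))%:E) \_ Y) y)%E.
Proof.
rewrite /G /patch; case: ifPn => yY.
  rewrite [RHS]integral_mkcond; apply: eq_integral => x _.
  rewrite /patch; congr (if _ then _ else _).
  by apply/idP/idP => [/set_mem[/mem_set]|/set_mem Xx] //;
     apply/mem_set; split=> //; exact: set_mem.
rewrite integral0_eq // => x _; case: ifPn => // /set_mem[/= _ /mem_set].
by rewrite (negbTE yY).
Qed.

Lemma measurable_int_ver : measurable_fun X
  (fun x => \int[leb]_(y in Y) (h (x +i* y))%:E)%E.
Proof.
apply/(measurable_restrictT _ _).2 => //.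
have := measurable_fun_fubini_tonelli_F (m2 := leb) G mG G0.
by congr measurable_fun; apply/funext => x; rewrite -G1.
Qed.

Lemma measurable_int_hor : measurable_fun Y
  (fun y => \int[leb]_(x in X) (h (x +i* y))%:E)%E.
Proof.
apply/(measurable_restrictT _ _).2 => //.
have := measurable_fun_fubini_tonelli_G (m1 := leb) G mG G0.
by congr measurable_fun; apply/funext => y; rewrite -G2.
Qed.

Lemma tonelli_cplx :
  (\int[leb]_(x in X) \int[leb]_(y in Y) (h (x +i* y))%:E =
   \int[leb]_(y in Y) \int[leb]_(x in X) (h (x +i* y))%:E)%E.
Proof.
rewrite [LHS]integral_mkcond [RHS]integral_mkcond.
transitivity (\int[leb]_x \int[leb]_y G (x, y))%E.
  by apply: eq_integral => x _; rewrite G1.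
transitivity (\int[leb]_y \int[leb]_x G (x, y))%E.
  exact: (fubini_tonelli (m1 := leb) (m2 := leb) G mG G0).
by apply: eq_integral => x _; rewrite G2.
Qed.

End tonelli.

Lemma integral_itv_cst (a b c : R) : a <= b ->
  (\int[leb]_(x in `[a, b]) (cst c%:E) x = (c * (b - a))%:E)%E.
Proof.
move=> ab; transitivity (c%:E * leb `[a, b])%E; first exact: integral_cst.
by rewrite lebesgue_measure_cc // EFinM.
Qed.

Lemma exists_lt_average (H : R -> \bar R) (a b B : R) : a < b ->
  measurable_fun `[a, b] H -> (forall x, (0 <= H x)%E) ->
  (\int[leb]_(x in `[a, b]) H x < (B * (b - a))%:E)%E ->
  exists x, a <= x <= b /\ (H x < B%:E)%E.
Proof.
move=> ab mH H0 HB; apply: contrapT => nH; move: HB; rewrite ltNge => /negP; apply.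
have [B0|B0] := leP 0 B; last first.
  apply: (@le_trans _ _ 0%E); last exact: integral_ge0.
  by rewrite lee_fin; apply: mulr_le0_ge0; [exact: ltW|rewrite subr_ge0 ltW].
rewrite -integral_itv_cst ?(ltW ab) //.
apply: ge0_le_integral => //.
move=> x; rewrite /= in_itv /= => xab; rewrite leNgt; apply/negP => Hx.
by apply: nH; exists x.
Qed.

(** The mean of [u] over a side is bounded through the [p]-mean, with a parameter
[l] that is chosen as the root of the mean. *)
Lemma Rintegral_side_le (u v : R -> R) (a b a' b' c l B p : R) :
  1 <= p -> 0 < l -> 0 <= c -> a <= b -> a <= a' -> b' <= b ->
  (forall t, a <= t <= b -> {for t, continuous u}) -> (forall t, 0 <= u t) ->
  leb.-integrable `[a', b'] (EFin \o v) ->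
  (forall t, a' <= t <= b' -> v t <= c * u t) ->
  (\int[leb]_(t in `[a, b]) (u t `^ p)%:E <= B%:E)%E ->
  \int[leb]_(t in `[a', b']) v t <= c * (l * (b - a) + l / l `^ p * B).
Proof.
move=> p1 l0 c0 ab aa bb uc u0 vi vu uB.
have uab := continuous_at_integrable uc.
have S : ([set` `[a', b']] : set R) `<=` [set` `[a, b]] by apply: subset_itv; rewrite bnd_simp.
have ui : leb.-integrable `[a', b'] (EFin \o u) by apply: integrableS uab.
have upc t : a <= t <= b -> {for t, continuous (fun t => u t `^ p)}.
  by move=> /uc tc; exact: cvg_powR.
have mup : measurable_fun `[a, b] (EFin \o (fun t => u t `^ p)).
  exact: (measurable_int leb (continuous_at_integrable upc)).
apply: (@le_trans _ _ (c * \int[leb]_(t in `[a', b']) u t)).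
  rewrite -RintegralZl //; apply: le_Rintegral => //; first exact: (integrableZl _ c ui).
rewrite ler_wpM2l // -lee_fin /Rintegral fineK; last exact: integrable_fin_num.
apply: (@le_trans _ _ (\int[leb]_(t in `[a, b]) (u t)%:E)%E).
  apply: ge0_subset_integral => //; first exact: (measurable_int leb).
  by move=> t _; rewrite lee_fin.
have k0 : 0 <= l / l `^ p by rewrite divr_ge0 ?powR_ge0 // ltW.
apply: (@le_trans _ _ (\int[leb]_(t in `[a, b]) (cst l%:E t +
    (l / l `^ p)%:E * (u t `^ p)%:E))%E).
  apply: ge0_le_integral => //.
  - by move=> t _; rewrite lee_fin.
  - exact: (measurable_int leb).
  - by apply: emeasurable_funD => //; exact: measurable_funeM.
  - by move=> t _; rewrite -EFinM -EFinD lee_fin le_powR_affine.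
rewrite ge0_integralD //.
- rewrite integral_itv_cst // ge0_integralZl_EFin //; last first.
    by move=> t _; rewrite lee_fin powR_ge0.
  by rewrite EFinD; apply: leeD => //; rewrite [leRHS]EFinM; apply: lee_wpmul2l => //; rewrite lee_fin.
- by move=> t _; rewrite lee_fin ltW.
- by move=> t _; rewrite -EFinM lee_fin mulr_ge0 // powR_ge0.
- exact: measurable_funeM.
Qed.

(** Cauchy's formula on a rectangle whose four sides lie in the outer half of
the square of half side [r] around the point. *)
Lemma cauchy_four_sides f (p x0 y0 r x1 x2 y1 y2 B : R) :
  1 <= p -> 0 < r -> 0 < B ->
  (forall x y, x0 - r <= x <= x0 + r -> y0 - r <= y <= y0 + r ->
     exists d, cdiff f (x +i* y) d) ->
  x0 - r <= x1 <= x0 - r / 2 -> x0 + r / 2 <= x2 <= x0 + r ->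
  y0 - r <= y1 <= y0 - r / 2 -> y0 + r / 2 <= y2 <= y0 + r ->
  (forall x, x = x1 \/ x = x2 -> (\int[leb]_(y in `[(y0 - r)%R, (y0 + r)%R])
     (cmod (f (x +i* y)) `^ p)%:E <= B%:E)%E) ->
  (forall y, y = y1 \/ y = y2 -> (\int[leb]_(x in `[(x0 - r)%R, (x0 + r)%R])
     (cmod (f (x +i* y)) `^ p)%:E <= B%:E)%E) ->
  r * cmod (f (x0 +i* y0)) `^ p <= 48 `^ p * B.
Proof.
move=> p1 r0 B0 fd x1P x2P y1P y2P VB WB; set s := x0 +i* y0.
(* the value of the constant 48 enters only in the last estimate *)
have [k kE] : exists k : R, k = 48 by exists 48.
have k0 : 0 < k by rewrite kE.
rewrite -kE.
have p0 : 0 < p by rewrite (lt_le_trans ltr01).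
have fc x y : x0 - r <= x <= x0 + r -> y0 - r <= y <= y0 + r -> ccontC f (x +i* y).
  by move=> xx yy; have [d /cdiff_ccontC] := fd x y xx yy.
pose l := (B / r) `^ p^-1.
have Br0 : 0 < B / r by rewrite divr_gt0.
have l0 : 0 < l by rewrite powR_gt0.
have lp : l `^ p = B / r by rewrite -powRrM mulVf ?powRr1 ?ltW // gt_eqF.
have kge := rint_kernel_ge r0 x1P x2P y1P y2P.
move: (x1P) (x2P) (y1P) (y2P) => /andP[xa xb] /andP[xc xd] /andP[ya yb] /andP[yc yd].
have r2 : 0 < r / 2 by rewrite divr_gt0.
have [hx1 hx2 hy1 hy2] : [/\ x1 < x0, x0 < x2, y1 < y0 & y0 < y2].
  by clear -xb xc yb yc r2; split; lra.
have [x12 y12] : x1 <= x2 /\ y1 <= y2 by split; apply/ltW; [exact: lt_trans hx2|exact: lt_trans hy2].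
have rr c : c - r <= c + r by rewrite lerD2l ge0_cp // ltW.
have [x1R x2R] : x0 - r <= x1 <= x0 + r /\ x0 - r <= x2 <= x0 + r.
  by clear -xa xb xc xd r2; split; apply/andP; split; lra.
have [y1R y2R] : y0 - r <= y1 <= y0 + r /\ y0 - r <= y2 <= y0 + r.
  by clear -ya yb yc yd r2; split; apply/andP; split; lra.
have fd' : rect_diff f x1 x2 y1 y2.
  move=> x y /andP[u1 u2] /andP[v1 v2]; apply: fd.
    by rewrite (le_trans xa) // (le_trans u2).
  by rewrite (le_trans ya) // (le_trans v2).
have fr := @rint_cauchy _ f x0 y0 x1 x2 y1 y2.
pose g z := f z / (z - s).
have fsg : cmod (f s) <= cmod (rint g x1 x2 y1 y2).
  rewrite /g fr //.
  by rewrite cmodM ler_peMr // cmod_ge0.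
suff gl : cmod (rint g x1 x2 y1 y2) <= k * l.
  have : cmod (f s) `^ p <= (k * l) `^ p.
    by rewrite ge0_ler_powR ?nnegrE ?cmod_ge0 ?mulr_ge0 ?(le_trans fsg) // ltW.
  rewrite (powRM _ (ltW k0) (ltW l0)) lp => /(ler_wpM2l (ltW r0)) hs.
  apply: (le_trans hs); rewrite le_eqVlt; apply/orP; left; apply/eqP.
  by field; rewrite gt_eqF.
have far x y : r / 2 <= `|x - x0| \/ r / 2 <= `|y - y0| -> r / 2 <= cmod ((x +i* y) - s).
  case=> xr; apply: (le_trans xr).
    by apply: le_trans (Re_le_cmod _); rewrite cReD cReN.
  by apply: le_trans (Im_le_cmod _); rewrite cImD cImN.
have gf x y : r / 2 <= `|x - x0| \/ r / 2 <= `|y - y0| ->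
    cmod (g (x +i* y)) <= 2 / r * cmod (f (x +i* y)).
  move=> /far xy; rewrite /g cmodM cmodV mulrC ler_wpM2r ?cmod_ge0 //.
  by rewrite -[2 / r]invf_div lef_pV2 // posrE // (lt_le_trans r2).
have gc x y : x1 <= x <= x2 -> y1 <= y <= y2 ->
    r / 2 <= `|x - x0| \/ r / 2 <= `|y - y0| -> ccontC g (x +i* y).
  move=> xx yy /far xy; have [d dd] := fd' x y xx yy.
  have zs : x +i* y != s.
    apply/eqP => e; move: xy; by rewrite e subrr cmod0 leNgt r2.
  by have [d' /cdiff_ccontC] := cdiff_div zs dd.
have [nx1 nx2] : r / 2 <= `|x1 - x0| /\ r / 2 <= `|x2 - x0|.
  clear -xb xc hx1 hx2; rewrite ler0_norm ?ger0_norm; [split; lra|lra|lra].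
have [ny1 ny2] : r / 2 <= `|y1 - y0| /\ r / 2 <= `|y2 - y0|.
  clear -yb yc hy1 hy2; rewrite ler0_norm ?ger0_norm; [split; lra|lra|lra].
have gbd : rbd_cont g x1 x2 y1 y2.
  split=> [x xx|y yy]; split; apply: gc; rewrite ?lexx ?x12 ?y12 //.
  - by right.
  - by right.
  - by left.
  - by left.
have [g1 g2 g3 g4] := rbd_cont_itv gbd.
(* the kernel is at most [2 / r] on the sides, and the two terms of the affine
   bound contribute [2 l r] and [l r] *)
have lE c : 2 / r * (l * (c + r - (c - r)) + l / l `^ p * B) = 6 * l.
  by rewrite lp; field; rewrite !gt_eqF.
have hor y : y0 - r <= y <= y0 + r -> r / 2 <= `|y - y0| -> (\int[leb]_(x in `[(x0 - r)%R, (x0 + r)%R]) (cmod (f (x +i* y)) `^ p)%:E <= B%:E)%E ->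
    ccont_itv (fun x => g (x +i* y)) x1 x2 ->
    \int[leb]_(x in `[x1, x2]) cmod (g (x +i* y)) <= 6 * l.
  move=> yy yr yB gy; rewrite -(lE x0).
  apply: (Rintegral_side_le (u := fun x => cmod (f (x +i* y)))) => //.
  - by rewrite divr_ge0 // ltW.
  - move=> t tt; apply: ccont_cmod; move: t tt; apply: ccontC_hor => x xx.
    exact: fc.
  - by move=> t; exact: cmod_ge0.
  - exact: cmod_integrable.
  - by move=> t _; apply: gf; right.
have ver x : x0 - r <= x <= x0 + r -> r / 2 <= `|x - x0| -> (\int[leb]_(y in `[(y0 - r)%R, (y0 + r)%R]) (cmod (f (x +i* y)) `^ p)%:E <= B%:E)%E ->
    ccont_itv (fun y => g (x +i* y)) y1 y2 ->
    \int[leb]_(y in `[y1, y2]) cmod (g (x +i* y)) <= 6 * l.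
  move=> xx xr xB gx; rewrite -(lE y0).
  apply: (Rintegral_side_le (u := fun y => cmod (f (x +i* y)))) => //.
  - by rewrite divr_ge0 // ltW.
  - move=> t tt; apply: ccont_cmod; move: t tt; apply: ccontC_ver => y yy.
    exact: fc.
  - by move=> t; exact: cmod_ge0.
  - exact: cmod_integrable.
  - by move=> t _; apply: gf; left.
rewrite (le_trans (cmod_rint_le gbd)) //.
(* four sides with [6 l] each and the factor 2 lost in [cmod_cint_le] make 48 *)
have -> : k * l = 2 * (6 * l + 6 * l + (6 * l + 6 * l)) by rewrite kE; ring.
rewrite ler_pM2l //; apply: lerD; apply: lerD.
- by apply: hor => //; apply: WB; left.
- by apply: hor => //; apply: WB; right.
- by apply: ver => //; apply: VB; left.
- by apply: ver => //; apply: VB; right.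
Qed.

End cauchy_estimate.

Section mean_value_property.
Context {R : realType}.
Local Notation leb := (@lebesgue_measure R).
Implicit Types (x y : R) (f : R[i] -> R[i]).

(** On each of the two outer strips, of width [r / 2], some line lies below the
average. *)
Lemma two_good_lines (H : R -> \bar R) (c r : R) : 0 < r ->
  measurable_fun [set` `[c - r, c + r]] H -> (forall x, (0 <= H x)%E) ->
  forall i B, (\int[leb]_(x in `[(c - r)%R, (c + r)%R]) H x = i%:E)%E ->
  2 * i / r < B ->
  exists x1 x2, [/\ c - r <= x1 <= c - r / 2, c + r / 2 <= x2 <= c + r,
    (H x1 < B%:E)%E & (H x2 < B%:E)%E].
Proof.
move=> r0 mH H0 i B Hi iB.
have iB' : i < B * (r / 2).
  by move: iB; rewrite ltr_pdivrMr // mulrA ltr_pdivlMr // mulrC.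
have pick a b : c - r <= a -> b <= c + r -> b - a = r / 2 ->
    exists x, a <= x <= b /\ (H x < B%:E)%E.
  move=> ca bc ba.
  have S : ([set` `[a, b]] : set R) `<=` [set` `[c - r, c + r]].
    by apply: subset_itv; rewrite bnd_simp.
  apply: (exists_lt_average _ _ H0); first by lra.
    exact: measurable_funS mH.
  apply: (@le_lt_trans _ _ i%:E); last by rewrite lte_fin ba.
  by rewrite -Hi; apply: ge0_subset_integral => //.
have [||//|x1 [x1P x1B]] := pick (c - r) (c - r / 2); [lra|lra|lra|].
have [||//|x2 [x2P x2B]] := pick (c + r / 2) (c + r); [lra|lra|lra|].
by exists x1, x2.
Qed.

Lemma le_of_forall_average (r c i a : R) : 0 < r -> 0 < c ->
  (forall B, 2 * i / r < B -> r * a <= c * B) -> r ^+ 2 * a <= 2 * c * i.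
Proof.
move=> r0 c0 H; rewrite expr2 -mulrA -ler_pdivlMl //.
have -> : r^-1 * (2 * c * i) = c * (2 * i / r) by ring.
rewrite -ler_pdivrMl //; apply/ler_addgt0Pl => e e0.
by rewrite ler_pdivrMl // H // ltrDr.
Qed.

(** The value of an analytic function at the centre of a square is controlled by
its [p]-mean over the square. Cauchy's formula holds on every rectangle whose
four sides lie in the outer half of the square, and the sides can be chosen
among the lines on which the [p]-th power has no more than its average. *)
Lemma sub_mean_value (U : set R[i]) f (p x0 y0 r : R) :
  open (U : set R[i]^o) -> analytic_on U f -> 1 <= p -> 0 < r ->
  (forall x y, x0 - r <= x <= x0 + r -> y0 - r <= y <= y0 + r -> U (x +i* y)) ->
  ((r ^+ 2 * cmod (f (x0 +i* y0)) `^ p)%:E <= (2 * 48 `^ p)%:E *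
     \int[leb]_(x in `[(x0 - r)%R, (x0 + r)%R]) \int[leb]_(y in `[(y0 - r)%R, (y0 + r)%R])
        (cmod (f (x +i* y)) `^ p)%:E)%E.
Proof.
move=> oU af p1 r0 QU; set s := x0 +i* y0.
(* only the sign of the constant 48 matters here *)
have [k kE] : exists k : R, k = 48 by exists 48.
have k0 : 0 < k by rewrite kE.
have K0 : 0 < 2 * k `^ p by rewrite mulr_gt0 // powR_gt0.
rewrite -kE.
have fd z : U z -> exists d, cdiff f z d by move=> /af /derivable_cdiff.
have fc z : U z -> ccontC f z by move=> /fd[d /cdiff_ccontC].
pose h z := cmod (f z) `^ p.
have h0 z : 0 <= h z by rewrite powR_ge0.
have p0 : 0 < p by rewrite (lt_le_trans ltr01).
have hc z : U z -> {for (z : R[i]^o), continuous (h : R[i]^o -> R)}.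
  by move=> /fc zc; exact: continuous_cmod_powR.
have mX : measurable `[x0 - r, x0 + r]%classic by exact: measurable_itv.
have mY : measurable `[y0 - r, y0 + r]%classic by exact: measurable_itv.
have XYU x y : `[x0 - r, x0 + r]%classic x -> `[y0 - r, y0 + r]%classic y -> U (x +i* y).
  by rewrite /= !in_itv /=; exact: QU.
have mV := measurable_int_ver oU h0 hc mX mY XYU.
have mW := measurable_int_hor oU h0 hc mX mY XYU.
have VW := tonelli_cplx oU h0 hc mX mY XYU.
clear mX mY XYU hc h0; rewrite /h {h} in mV mW VW.
have V0 x : (0 <= \int[leb]_(y in `[(y0 - r)%R, (y0 + r)%R]) (cmod (f (x +i* y)) `^ p)%:E)%E.
  by apply: integral_ge0 => y _; rewrite lee_fin powR_ge0.
have W0 y : (0 <= \int[leb]_(x in `[(x0 - r)%R, (x0 + r)%R]) (cmod (f (x +i* y)) `^ p)%:E)%E.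
  by apply: integral_ge0 => x _; rewrite lee_fin powR_ge0.
have VB := two_good_lines r0 mV V0.
have WB := two_good_lines r0 mW W0.
rewrite -VW in WB; clear mV mW VW W0.
have I0 := @integral_ge0 _ _ _ leb `[x0 - r, x0 + r] _ (fun x _ => V0 x).
clear V0; move: I0 VB WB; set I := (\int[leb]_(x in _) _)%E.
case: I => [i| |] // I0 VB WB; last by rewrite gt0_muley; [exact: leey|rewrite lte_fin; exact: K0].
rewrite -EFinM lee_fin; apply: (le_of_forall_average r0 (powR_gt0 p k0)) => B iB.
have [x1 [x2 [x1P x2P x1B x2B]]] := VB i B erefl iB.
have [y1 [y2 [y1P y2P y1B y2B]]] := WB i B erefl iB.
have B0 : 0 < B.
  apply: le_lt_trans iB; rewrite divr_ge0 ?(ltW r0) //.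
  by move: I0; rewrite lee_fin => i0; rewrite mulr_ge0.
clear VB WB I0; rewrite kE; apply: (cauchy_four_sides p1 r0 B0 _ x1P x2P y1P y2P).
- by move=> x y xx yy; apply: fd; exact: QU.
- by move=> x [] ->; [exact: ltW x1B|exact: ltW x2B].
- by move=> y [] ->; [exact: ltW y1B|exact: ltW y2B].
Qed.

End mean_value_property.

(** * Sums over equally spaced points *)

Section hardy_carleson.
Context {R : realType}.
Local Notation leb := (@lebesgue_measure R).
Implicit Types (x y : R) (f : R[i] -> R[i]).

Lemma hardy_norm_ge0 (p : R) f : (0 <= hardy_norm p f)%E.
Proof.
apply: (@le_trans _ _ ('N[leb]_(p%:E)[(fun t => (cmod (f (1 +i* t)))%:E)])%E).
  exact: Lnorm_ge0.
apply: ereal_sup_ubound; exists 1 => //=.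
by rewrite invf_lt1 // ltr1n.
Qed.

Lemma hardy_line_le (p : R) f x : 0 < p -> 2^-1 < x ->
  (\int[leb]_t (cmod (f (x +i* t)) `^ p)%:E <= (hardy_norm p f) `^ p)%E.
Proof.
move=> p0 hx; have -> : (\int[leb]_t (cmod (f (x +i* t)) `^ p)%:E =
    'N[leb]_(p%:E)[(fun t => (cmod (f (x +i* t)))%:E)] `^ p)%E.
  rewrite poweR_Lnorm; last by rewrite gt_eqF.
  apply: eq_integral => t _.
  by rewrite /= ger0_norm // cmod_ge0.
apply: gt0_ler_poweR; first exact: ltW.
- by rewrite in_itv /= leey andbT Lnorm_ge0.
- by rewrite in_itv /= leey andbT hardy_norm_ge0.
- by apply: ereal_sup_ubound; exists x.
Qed.

(** The supremum over lines and the power are exchanged by monotonicity. *)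
Lemma hardy_norm_powR_le (p m : R) f : 0 < p -> 0 <= m ->
  (forall x, 2^-1 < x -> (\int[leb]_t (cmod (f (x +i* t)) `^ p)%:E <= m%:E)%E) ->
  ((hardy_norm p f) `^ p <= m%:E)%E.
Proof.
move=> p0 m0 fm; have -> : m%:E = ((m `^ p^-1)%:E `^ p)%E.
  by rewrite poweR_EFin -powRrM mulVf ?powRr1 // gt_eqF.
apply: gt0_ler_poweR; first exact: ltW.
- by rewrite in_itv /= leey andbT hardy_norm_ge0.
- by rewrite in_itv /= leey andbT lee_fin powR_ge0.
apply: ge_ereal_sup => _ [x /= hx <-].
have -> : (m `^ p^-1)%:E = (m%:E `^ p^-1)%E by [].
rewrite unlock; apply: gt0_ler_poweR.
- by rewrite invr_ge0 ltW.
- rewrite in_itv /= leey andbT; apply: integral_ge0 => t _.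
  by rewrite lee_fin powR_ge0.
- by rewrite in_itv /= leey andbT lee_fin.
apply: le_trans (fm x hx); rewrite le_eqVlt; apply/orP; left; apply/eqP.
by apply: eq_integral => t _; rewrite /= ger0_norm // cmod_ge0.
Qed.

Lemma sum_integral_disjoint_le (g : R -> \bar R) (r c : R) n : 0 < r ->
  measurable_fun setT g -> (forall t, (0 <= g t)%E) ->
  (\sum_(0 <= j < n) \int[leb]_(t in `[(4 * r * j%:R + c - r)%R,
      (4 * r * j%:R + c + r)%R]) g t <= \int[leb]_t g t)%E.
Proof.
move=> r0 mg g0.
pose F j : set R := `[4 * r * j%:R + c - r, 4 * r * j%:R + c + r]%classic.
have mF j : measurable (F j) by exact: measurable_itv.
have tF : trivIset setT F.
  apply: ltn_trivIset => k m mk; apply/seteqP; split => // t.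
  rewrite /F /= !in_itv /= => -[/andP[a1 a2] /andP[b1 b2]].
  have : m%:R + 1 <= k%:R :> R by rewrite natr1 ler_nat.
  rewrite -(ler_pM2l (x := 4 * r)) ?mulr_gt0 // mulrDr mulr1 => ?.
  lra.
rewrite -(ge0_integral_bigsetU leb mF) ?iota_uniq //.
- apply: ge0_subset_integral => //; apply: bigsetU_measurable => j _; exact: mF.
- exact: sub_trivIset tF.
- exact: measurable_funTS.
Qed.

Lemma analytic_ccontC f (U : set R[i]) z : analytic_on U f -> U z -> ccontC f z.
Proof. by move=> af /af /derivable_cdiff[d /cdiff_ccontC]. Qed.

Lemma continuous_line f (U : set R[i]) x : analytic_on U f ->
  (forall t, U (x +i* t)) -> continuous (fun t => cmod (f (x +i* t))).
Proof.
move=> af Ux t; apply: ccont_cmod.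
have : ccont_itv (fun t => f (x +i* t)) t t.
  by apply: ccontC_ver => u _; exact: analytic_ccontC af (Ux u).
by move=> /(_ t); apply; rewrite lexx.
Qed.

Lemma continuous_line_powR f (U : set R[i]) p x : 1 <= p -> analytic_on U f ->
  (forall t, U (x +i* t)) -> continuous (fun t => cmod (f (x +i* t)) `^ p).
Proof.
move=> p1 af Ux t.
apply: (cvg_powR (FF := nbhs_filter t) p1 (fun=> cmod_ge0 _) (cmod_ge0 _)).
exact: continuous_line af Ux t.
Qed.

Lemma measurable_line f (U : set R[i]) p x : 1 <= p -> analytic_on U f ->
  (forall t, U (x +i* t)) ->
  measurable_fun setT (fun t => (cmod (f (x +i* t)) `^ p)%:E).
Proof.
move=> p1 af Ux; apply/measurable_EFinP; apply: continuous_measurable_fun.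
exact: continuous_line_powR p1 af Ux.
Qed.

(** Points at height [x0] spaced by [4 r] are the centres of disjoint squares of
half side [r], so that the sub-mean-value property adds up to at most one
integral over a strip of width [2 r]. *)
Lemma lattice_carleson f (p x0 c r m : R) n : 1 <= p -> 0 < r ->
  2^-1 < x0 - r -> analytic_on half_plane f ->
  (forall x, 2^-1 < x -> (\int[leb]_t (cmod (f (x +i* t)) `^ p)%:E <= m%:E)%E) ->
  \sum_(0 <= j < n) r * cmod (f (x0 +i* (4 * r * j%:R + c))) `^ p <=
  4 * 48 `^ p * m.
Proof.
move=> p1 r0 hx af fm.
(* only the sign of the constant 48 matters here *)
have [k kE] : exists k : R, k = 48 by exists 48.
have k0 : 0 < k by rewrite kE.
rewrite -kE.
have K0 : 0 <= 2 * k `^ p by rewrite mulr_ge0 // powR_ge0.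
pose y j := 4 * r * j%:R + c.
pose X := [set` `[x0 - r, x0 + r]] : set R.
pose Y j := [set` `[y j - r, y j + r]] : set R.
have XU x : X x -> 2^-1 < x.
  by rewrite /X /= in_itv /= => /andP[xx _]; exact: lt_le_trans xx.
have hc z : half_plane z ->
    {for (z : R[i]^o), continuous ((fun w => cmod (f w) `^ p) : R[i]^o -> R)}.
  by move=> hz; apply: continuous_cmod_powR p1 _; exact: analytic_ccontC af hz.
pose V j x := (\int[leb]_(t in Y j) (cmod (f (x +i* t)) `^ p)%:E)%E.
have V0 j x : (0 <= V j x)%E by apply: integral_ge0 => t _; rewrite lee_fin powR_ge0.
have mV j : measurable_fun X (V j).
  apply: (measurable_int_ver half_plane_open _ hc).
  - by move=> z; exact: powR_ge0.
  - exact: measurable_itv.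
  - exact: measurable_itv.
  - by move=> x t /XU.
have one j : ((r ^+ 2 * cmod (f (x0 +i* y j)) `^ p)%:E <=
    (2 * k `^ p)%:E * \int[leb]_(x in X) V j x)%E.
  rewrite kE; apply: (sub_mean_value half_plane_open af p1 r0) => x t xx _.
  by apply: XU; rewrite /X /= in_itv.
have VT x : X x -> (\sum_(0 <= j < n) V j x <= m%:E)%E.
  move=> /XU xx; apply: le_trans (fm x xx); apply: sum_integral_disjoint_le => //.
  - by apply: measurable_line p1 af _ => t.
  - by move=> t; rewrite lee_fin powR_ge0.
have sumV : (\sum_(0 <= j < n) \int[leb]_(x in X) V j x <= (m * (2 * r))%:E)%E.
  rewrite -ge0_integral_sum //; last exact: measurable_itv.
  have -> : 2 * r = (x0 + r) - (x0 - r) by ring.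
  rewrite -integral_itv_cst; last by rewrite lerD2l ge0_cp // ltW.
  apply: ge0_le_integral.
  - exact: measurable_itv.
  - by move=> x _; apply: sume_ge0 => j _; exact: V0.
  - by apply: emeasurable_sum => j; exact: mV.
  - exact: measurable_cst.
  - exact: VT.
rewrite -(ler_pM2l r0) -lee_fin.
have -> : r * (4 * k `^ p * m) = 2 * k `^ p * (m * (2 * r)) by ring.
rewrite mulr_sumr -sumEFin [leRHS]EFinM.
apply: (@le_trans _ _ (\sum_(0 <= j < n) (2 * k `^ p)%:E * \int[leb]_(x in X) V j x)%E).
  by apply: lee_sum => j _; rewrite mulrA -expr2; exact: one.
rewrite -ge0_sume_distrr; last by move=> j _; apply: integral_ge0.
by apply: lee_wpmul2l => //; rewrite lee_fin.
Qed.

End hardy_carleson.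

(** * Dirichlet polynomials *)

Section complex_exponential.
Context {R : realType}.
Implicit Types (z w s : R[i]) (x y : R).

Lemma cexpD z w : cexp (z + w) = cexp z * cexp w.
Proof.
rewrite /cexp cReD cImD expRD cosD sinD.
by apply: complex_ext; rewrite !(cReM, cImM) /=; ring.
Qed.

Lemma cexp0 : cexp 0 = 1 :> R[i].
Proof.
rewrite /cexp /= expR0 cos0 sin0.
by apply: complex_ext; rewrite !(cReM, cImM) /=; ring.
Qed.

Lemma cmod_cexp z : cmod (cexp z) = expR (complex.Re z).
Proof.
rewrite /cexp cmodM cmod_real ger0_norm ?expR_ge0 // cmodCx cos2Dsin2.
by rewrite sqrtr1 mulr1.
Qed.

Lemma is_derive_linear_approx (f : R -> R) (x d : R) : is_derive x 1 f d ->
  forall e, 0 < e -> exists2 r : R, 0 < r &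
    forall h, `|h| < r -> `|f (x + h) - f x - d * h| <= e * `|h|.
Proof.
move=> [df fd] e e0; move: df; rewrite /derivable => /cvg_ex[l fl].
have ld : l = d by rewrite -fd; apply/esym/cvg_lim.
move: fl; rewrite ld => /cvgrPdist_lt /(_ e e0).
rewrite near_withinE => /nbhs_ballP[r /= r0 rP]; exists r => // h hr.
have [->|h0] := eqVneq h 0; first by rewrite addr0 mulr0 subr0 subrr normr0 mulr0.
have := rP h; rewrite /ball /= sub0r normrN => /(_ hr h0) /ltW.
rewrite /GRing.scale /= mulr1 distrC => /(ler_wpM2r (normr_ge0 h)).
rewrite -normrM; congr (`|_| <= _).
by rewrite mulrBl mulrAC mulVf // mul1r [h + x]addrC.
Qed.

(** The real derivatives of the exponential, sine and cosine at zero are combined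
to avoid any theory of power series. *)
Lemma cdiff_cexp0 : cdiff (@cexp R) 0 1.
Proof.
move=> e e0; pose k := Num.min 1 (e / 8).
have k0 : 0 < k by rewrite lt_min ltr01 divr_gt0.
have [k1 k2] : k <= 1 /\ k <= e / 8 by split; rewrite ge_min lexx ?orbT.
have [r1 r10 E] := is_derive_linear_approx (is_derive_expR 0) k0.
have [r2 r20 S] := is_derive_linear_approx (is_derive_sin 0) k0.
have [r3 r30 C] := is_derive_linear_approx (is_derive_cos 0) k0.
pose r := Num.min (Num.min r1 (Num.min r2 r3)) (Num.min 1 (e / 32)).
exists r; first by rewrite !lt_min r10 r20 r30 ltr01 divr_gt0.
move=> z; rewrite subr0 !lt_min => /andP[/andP[z1 /andP[z2 z3]] /andP[z4 z5]].
rewrite cexp0 mul1r; case: z z1 z2 z3 z4 z5 => x y z1 z2 z3 z4 z5.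
set m := cmod (x +i* y) in z1 z2 z3 z4 z5 *.
have [xm ym] : `|x| <= m /\ `|y| <= m := ReIm_le_cmod (x +i* y).
have m0 : 0 <= m := cmod_ge0 _.
have := E x (le_lt_trans xm z1); rewrite add0r expR0 mul1r => Ex.
have := S y (le_lt_trans ym z2); rewrite add0r sin0 cos0 mul1r subr0 => Sy.
have := C y (le_lt_trans ym z3); rewrite add0r sin0 cos0 oppr0 mul0r subr0 => Cy.
rewrite (le_trans (cmod_le _)) //.
rewrite /cexp !(cReM, cImM, cReD, cImD, cReN, cImN) /= !mul0r subr0 addr0.
have ex : `|expR x - 1| <= 2 * m.
  rewrite -[expR x - 1](subrK x) (le_trans (ler_normD _ _)) //.
  have : k * `|x| <= 1 * m by rewrite ler_pM // ltW.
  clear -Ex xm; lra.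
have eM : expR x <= 3.
  have := ler_norm (expR x - 1); clear -ex z4; lra.
have A : `|expR x * cos y - 1 - x| <= e / 2 * m.
  have -> : expR x * cos y - 1 - x = expR x * (cos y - 1) + (expR x - 1 - x) by ring.
  rewrite (le_trans (ler_normD _ _)) // normrM (ger0_norm (expR_ge0 _)).
  have h1 : expR x * `|cos y - 1| <= 3 * (k * m).
    by rewrite ler_pM ?expR_ge0 // (le_trans Cy) // ler_wpM2l // ltW.
  have h2 : k * `|x| <= k * m by rewrite ler_wpM2l // ltW.
  have h3 : k * m <= e / 8 * m by rewrite ler_wpM2r.
  clear -h1 h2 h3 Ex; lra.
have B : `|expR x * sin y + 0 - 0 - y| <= e / 2 * m.
  have -> : expR x * sin y + 0 - 0 - y = expR x * (sin y - y) + (expR x - 1) * y by ring.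
  rewrite (le_trans (ler_normD _ _)) // !normrM (ger0_norm (expR_ge0 _)).
  have h1 : expR x * `|sin y - y| <= 3 * (k * m).
    by rewrite ler_pM ?expR_ge0 // (le_trans Sy) // ler_wpM2l // ltW.
  have h2 : `|expR x - 1| * `|y| <= 2 * m * m by rewrite ler_pM.
  have h3 : k * m <= e / 8 * m by rewrite ler_wpM2r.
  have h4 : m * m <= e / 32 * m by rewrite ler_wpM2r // ltW.
  clear -h1 h2 h3 h4 m0 e0; nra.
move: A B; rewrite !subr0 !addr0 => A B.
have -> : e * m = e / 2 * m + e / 2 * m by field.
exact: lerD.
Qed.

Lemma cdiff_cexp z : cdiff (@cexp R) z (cexp z).
Proof.
move=> e e0; have c0 : 0 < cmod (cexp z) by rewrite cmod_cexp expR_gt0.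
have [r r0 rP] := cdiff_cexp0 (divr_gt0 e0 c0); exists r => // w wr.
have := rP (w - z); rewrite subr0 => /(_ wr); rewrite cexp0 mul1r => H.
have -> : cexp w - cexp z - cexp z * (w - z) = cexp z * (cexp (w - z) - 1 - (w - z)).
  have {1}-> : cexp w = cexp z * cexp (w - z) by rewrite -cexpD addrC subrK.
  ring.
rewrite cmodM mulrC -ler_pdivlMr // (le_trans H) // mulrAC.
by rewrite le_eqVlt eqxx.
Qed.

Lemma cdiff_comp_linear (g : R[i] -> R[i]) (c s d : R[i]) : cdiff g (c * s) d ->
  cdiff (fun w => g (c * w)) s (d * c).
Proof.
move=> gd e e0; have c0 : 0 < cmod c + 1 by rewrite ltr_wpDl // cmod_ge0.
have [r r0 rP] := gd _ (divr_gt0 e0 c0).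
exists (r / (cmod c + 1)); first by rewrite divr_gt0.
move=> w; rewrite ltr_pdivlMr // => wr.
have cw : cmod (c * w - c * s) <= (cmod c + 1) * cmod (w - s).
  by rewrite -mulrBr cmodM ler_wpM2r ?cmod_ge0 // lerDl.
have H : cmod (g (c * w) - g (c * s) - d * (c * (w - s))) <=
    e / (cmod c + 1) * cmod (c * (w - s)).
  rewrite mulrBr; apply: rP; apply: le_lt_trans cw _; by rewrite mulrC.
have -> : d * c * (w - s) = d * (c * (w - s)) by ring.
apply: (le_trans H); rewrite -mulrA ler_pM2l // ler_pdivrMl //.
by rewrite mulrBr.
Qed.

End complex_exponential.

Section dirichlet_polynomials.
Context {R : realType}.
Implicit Types (z w s : R[i]) (x y : R) (a b : seq R[i]) (n : nat).

Lemma dirichlet_termD n s w :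
  dirichlet_term n (s + w) = dirichlet_term n s * dirichlet_term n w :> R[i].
Proof. by rewrite /dirichlet_term opprD mulrDl cexpD. Qed.

Lemma cmod_dirichlet_term n s :
  cmod (dirichlet_term n s) = expR (- complex.Re s * ln (n%:R : R)).
Proof. by rewrite /dirichlet_term cmod_cexp cReM cReN /= mulr0 subr0. Qed.

Lemma cmod_dirichlet_term_le1 n s : 0 <= complex.Re s ->
  cmod (dirichlet_term n.+1 s) <= 1 :> R.
Proof.
move=> s0; rewrite cmod_dirichlet_term -[leRHS]expR0 ler_expR mulNr oppr_le0.
by rewrite mulr_ge0 // ln_ge0 // ler1n.
Qed.

Lemma cmod_dirichlet_term_imag n y : cmod (dirichlet_term n (0 +i* y)) = 1 :> R.
Proof. by rewrite cmod_dirichlet_term /= oppr0 mul0r expR0. Qed.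

Lemma cdiff_dirichlet_term n s : exists d, cdiff (@dirichlet_term R n) s d.
Proof.
pose c : R[i] := - (ln (n%:R : R))%:C.
have E : @dirichlet_term R n = fun w => cexp (c * w).
  by apply/funext => w; rewrite /dirichlet_term /c mulNr mulNr mulrC.
by rewrite E; eexists; apply: cdiff_comp_linear; exact: cdiff_cexp.
Qed.

Lemma analytic_dirichlet_poly a (U : set R[i]) : analytic_on U (dirichlet_poly a).
Proof.
move=> s _; rewrite /dirichlet_poly.
have -> : (fun s => \sum_(i < size a) a`_i * dirichlet_term i.+1 s) =
    \sum_(i < size a) (fun s => a`_i * dirichlet_term i.+1 s) :> (R[i]^o -> R[i]^o).
  by apply/funext => w; rewrite fct_sumE.
apply: derivable_sum => i; apply: derivableM; first exact: derivable_cst.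
by apply/derivable_cdiff; exact: cdiff_dirichlet_term.
Qed.

(** The coefficients of [s |-> P (w + s)]. *)
Definition shift_coef (w : R[i]) a :=
  mkseq (fun i => a`_i * dirichlet_term i.+1 w) (size a).

Lemma dirichlet_poly_shift w a s :
  dirichlet_poly (shift_coef w a) s = dirichlet_poly a (w + s).
Proof.
rewrite /dirichlet_poly size_mkseq; apply: eq_bigr => i _.
by rewrite nth_mkseq // dirichlet_termD mulrA.
Qed.

Lemma dirichlet_poly_widen a n s : (size a <= n)%N ->
  dirichlet_poly a s = \sum_(i < n) a`_i * dirichlet_term i.+1 s.
Proof.
move=> an; rewrite /dirichlet_poly.
rewrite (big_ord_widen n (fun i => a`_i * dirichlet_term i.+1 s) an).
rewrite [RHS](bigID (fun i : 'I_n => (i < size a)%N)) /= [X in _ = _ + X]big1 ?addr0 //.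
by move=> i; rewrite -leqNgt => ia; rewrite nth_default ?mul0r.
Qed.

Definition coef_lin (c : R[i]) a b :=
  mkseq (fun i => a`_i + c * b`_i) (maxn (size a) (size b)).

Lemma dirichlet_poly_lin c a b s :
  dirichlet_poly (coef_lin c a b) s = dirichlet_poly a s + c * dirichlet_poly b s.
Proof.
pose n := maxn (size a) (size b).
rewrite (@dirichlet_poly_widen a n) ?leq_maxl // (@dirichlet_poly_widen b n) ?leq_maxr //.
rewrite mulr_sumr -big_split /= /dirichlet_poly size_mkseq.
by apply: eq_bigr => i _; rewrite nth_mkseq // mulrDl mulrA.
Qed.

Lemma dirichlet_polyB a b :
  (fun s => dirichlet_poly a s - dirichlet_poly b s) = dirichlet_poly (coef_lin (-1) a b).
Proof. by apply/funext => s; rewrite dirichlet_poly_lin mulN1r. Qed.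

Definition coef_norm a : R := \sum_(i < size a) cmod a`_i.

Lemma coef_norm_ge0 a : 0 <= coef_norm a.
Proof. by apply: sumr_ge0 => i _; exact: cmod_ge0. Qed.

Lemma cmod_dirichlet_poly_le a s : 0 <= complex.Re s ->
  cmod (dirichlet_poly a s) <= coef_norm a.
Proof.
move=> s0; rewrite (le_trans (cmod_sum _ _ _)) //; apply: ler_sum => i _.
by rewrite cmodM ler_piMr ?cmod_ge0 // cmod_dirichlet_term_le1.
Qed.

Lemma cmod_dirichlet_polyB_le a s u v e : 0 <= complex.Re s ->
  (forall i, (i < size a)%N ->
     cmod (dirichlet_term i.+1 u - dirichlet_term i.+1 v) <= e) ->
  cmod (dirichlet_poly a (s + u) - dirichlet_poly a (s + v)) <= coef_norm a * e.
Proof.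
move=> s0 uv; rewrite /dirichlet_poly -sumrB (le_trans (cmod_sum _ _ _)) //.
rewrite mulr_suml; apply: ler_sum => i _.
rewrite !dirichlet_termD -mulrBr -mulrBr cmodM (cmodM (dirichlet_term _ s)).
apply: ler_wpM2l; first exact: cmod_ge0.
rewrite -[leRHS]mul1r; apply: ler_pM; rewrite ?cmod_ge0 //.
  exact: cmod_dirichlet_term_le1.
exact: uv.
Qed.

(** The increment of [n^-s] is [n^-s] times that at zero, and [|n^-s| <= 1] on the
closed right half-plane; this makes the continuity uniform. *)
Lemma dirichlet_poly_unif_cont a e : 0 < e -> exists2 d : R, 0 < d &
  forall s h, 0 <= complex.Re s -> cmod h < d ->
    cmod (dirichlet_poly a (s + h) - dirichlet_poly a s) <= e.
Proof.
move=> e0; have k0 : 0 < coef_norm a + 1 by rewrite ltr_wpDl // coef_norm_ge0.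
have ek : 0 < e / (coef_norm a + 1) by rewrite divr_gt0.
have [d d0 dP] : exists2 d : R, 0 < d & forall h, cmod h < d ->
    forall i, (i < size a)%N ->
      cmod (dirichlet_term i.+1 h - dirichlet_term i.+1 0) <= e / (coef_norm a + 1).
  elim: (size a) => [|n [d d0 dP]]; first by exists 1.
  have [d' /cdiff_ccontC /(_ _ ek)[r r0 rP]] := cdiff_dirichlet_term n.+1 (0 : R[i]).
  exists (Num.min d r); first by rewrite lt_min d0.
  move=> h; rewrite lt_min => /andP[hd hr] i; rewrite ltnS leq_eqVlt => /orP[/eqP ->|].
    by apply/ltW/rP; rewrite subr0.
  exact: dP.
exists d => // s h s0 /dP hP; rewrite -{2}[s]addr0.
rewrite (le_trans (cmod_dirichlet_polyB_le s0 hP)) //.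
by rewrite mulrCA ler_piMr ?(ltW e0) // ler_pdivrMr // mul1r lerDl.
Qed.

End dirichlet_polynomials.

(** * Means of almost periodic functions *)

Section mean_values.
Context {R : realType}.
Local Notation leb := (@lebesgue_measure R).
Implicit Types (g : R -> R) (x y t T S e : R).

(** Up to an error [e], only the translates by a bounded amount matter; this is
a form of almost periodicity. *)
Definition translates_precompact g := forall e, 0 < e -> exists2 L : R, 0 <= L &
  forall x, exists2 y, `|y| <= L & forall t, `|g (x + t) - g (y + t)| <= e.

(** Pigeonhole: finitely many cells cover the range of a bounded family, and one
point is chosen in each of them. *)
Lemma bounded_family_precompact (h : nat -> R -> R) (n : nat) :
  (forall i t, -1 <= h i t <= 1) -> forall e, 0 < e -> exists2 L : R, 0 <= L &
  forall x, exists2 y, `|y| <= L & forall i, (i < n)%N -> `|h i x - h i y| <= e.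
Proof.
move=> h1 e e0; pose M := Num.truncn (2 / e).
have cell i t : (Num.truncn ((h i t + 1) / e) < M.+1)%N.
  rewrite ltnS; apply: Num.Theory.le_truncn.
  by rewrite ler_pM2r ?invr_gt0 //; have /andP[] := h1 i t; lra.
pose K t : {ffun 'I_n -> 'I_M.+1} := [ffun i : 'I_n => Ordinal (cell i t)].
have F : forall q, exists y : R, forall t, K t = q -> K y = q.
  move=> q; have [[t Kt]|nt] := pselect (exists t, K t = q); first by exists t.
  by exists 0 => t Kt; case: nt; exists t.
have [rep repK] := choice F; have repP t : K (rep (K t)) = K t by exact: repK.
exists (\sum_q `|rep q|); first by apply: sumr_ge0.
move=> x; exists (rep (K x)).
  by rewrite (bigD1 (K x)) //= lerDl sumr_ge0.
move=> i ni; have := repP x => /ffunP /(_ (Ordinal ni)).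
rewrite !ffunE => /(congr1 val) /= E.
have c0 t : 0 <= (h i t + 1) / e.
  by rewrite divr_ge0 ?(ltW e0) //; have /andP[] := h1 i t; lra.
have /andP[a1 a2] := Num.Theory.truncn_itv (c0 x).
have /andP[b1 b2] := Num.Theory.truncn_itv (c0 (rep (K x))).
rewrite E in b1 b2; rewrite -natr1 in a2 b2.
have : `|(h i x + 1) / e - (h i (rep (K x)) + 1) / e| <= 1.
  by rewrite ler_norml; apply/andP; split; lra.
rewrite -mulrBl normrM (gtr0_norm (x := e^-1)) ?invr_gt0 // ler_pdivrMr // mul1r.
by rewrite opprD addrACA subrr addr0.
Qed.

Lemma Rintegral_translate g c a b : a <= b -> continuous g ->
  \int[leb]_(t in `[c + a, c + b]) g t = \int[leb]_(t in `[a, b]) g (c + t).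
Proof.
move=> ab gc; rewrite /Rintegral.
pose F t := c + t.
have F' : derive1 F = cst 1.
  apply/funext => t; rewrite derive1E /F.
  have /@derive_val -> // : is_derive t 1 (fun t => c + t) 1.
  by rewrite -[X in is_derive _ _ _ X]add0r; exact: is_deriveD.
congr fine; rewrite (@integration_by_substitution_increasing R F g a b ab).
- by apply: eq_integral => t _; rewrite /= F' /= mulr1.
- by move=> x y _ _ xy; rewrite /F ltrD2l.
- by rewrite F' => t _; exact: cst_continuous.
- by rewrite F'; exact: is_cvg_cst.
- by rewrite F'; exact: is_cvg_cst.
- have Fc t : {for t, continuous F}.
    by apply: continuousD; [exact: cst_continuous|exact: id].
  split.
  + by move=> t _; apply: derivableD; [exact: derivable_cst|exact: derivable_id].
  + by apply: cvg_at_right_filter; exact: Fc.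
  + by apply: cvg_at_left_filter; exact: Fc.
- exact: continuous_subspaceT.
Qed.

(** The mean over long intervals, uniformly in their position: this is what almost
periodicity provides, and it makes means invariant under translation. *)
Definition has_mean (f : R -> R) (M : R) := forall e, 0 < e -> exists2 S0 : R, 0 < S0 &
  forall x S, S0 <= S -> `|\int[leb]_(t in `[x, x + S]) f t - M * S| <= e * S.

Section means.
Variables (g : R -> R) (B : R).
Hypotheses (gc : continuous g) (g0 : forall t, 0 <= g t) (gB : forall t, g t <= B)
  (gT : translates_precompact g).

Let gi a b : leb.-integrable `[a, b] (EFin \o g).
Proof. by apply: continuous_at_integrable => t _; exact: gc. Qed.

Let I x T := \int[leb]_(t in `[x, x + T]) g t.

Let I_ge0 x T : 0 <= I x T.
Proof. exact: Rintegral_ge0. Qed.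

Let Rint_cst (c a b : R) : a <= b -> \int[leb]_(t in `[a, b]) c = c * (b - a).
Proof.
move=> ab; have fab : fine (leb `[a, b]) = b - a by rewrite lebesgue_measure_cc.
by rewrite Rintegral_cst // fab.
Qed.

Let cst_int (c a b : R) : leb.-integrable `[a, b] (EFin \o (fun=> c)).
Proof. by apply: continuous_at_integrable => t _; exact: cst_continuous. Qed.

Let I_le x T : 0 <= T -> I x T <= B * T.
Proof.
move=> T0; have xT : x <= x + T by rewrite lerDl.
have -> : B * T = \int[leb]_(t in `[x, x + T]) B by rewrite Rint_cst // addrC addKr.
by apply: le_Rintegral => //; exact: cst_int.
Qed.

Let I_add x S T : 0 <= S -> 0 <= T -> I x (S + T) = I x S + I (x + S) T.
Proof.
by move=> S0 T0; rewrite /I addrA (Rintegral_split (c := x + S)) // lerDl.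
Qed.

Let I_trans x T : 0 <= T -> I x T = \int[leb]_(t in `[0, T]) g (x + t).
Proof. by move=> T0; rewrite -Rintegral_translate // addr0. Qed.

(** Translation by [y] with [|y| <= L] changes an integral only near the ends. *)
Let I_near e : 0 < e -> exists2 L : R, 0 <= L &
  forall x T, 0 <= T -> `|I x T - I 0 T| <= e * T + B * L.
Proof.
move=> /gT[L L0 LP]; exists L => // x T T0; have [y yL yP] := LP x.
have B0 : 0 <= B by rewrite (le_trans (g0 0)).
have c1 : `|I x T - I y T| <= e * T.
  have gz z t : {for t, continuous (fun t => g (z + t))}.
    apply: (@continuous_comp _ _ _ (fun t => z + t) g); last exact: gc.
    by apply: continuousD; [exact: cst_continuous|exact: id].
  have gxi z : leb.-integrable `[0, T] (EFin \o (fun t => g (z + t))).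
    by apply: continuous_at_integrable => t _; exact: gz.
  rewrite !I_trans // -RintegralB //.
  have di : leb.-integrable `[0, T] (EFin \o (fun t => g (x + t) - g (y + t))).
    by apply: continuous_at_integrable => t _; apply: continuousB; exact: gz.
  rewrite (le_trans (le_normr_Rintegral _ di)) //.
  rewrite -[T in e * T]subr0 -Rint_cst //; apply: le_Rintegral => //.
    exact: integrable_norm di.
have c2 : `|I y T - I 0 T| <= B * `|y|.
  have [y0|y0] := leP 0 y.
    have E : I 0 T + I T y = I 0 y + I y T.
      have E1 := I_add 0 T0 y0; have E2 := I_add 0 y0 T0.
      by rewrite !add0r in E1 E2; rewrite -E1 -E2 addrC.
    have h1 := I_ge0 T y; have h2 := I_le T y0.
    have h3 := I_ge0 0 y; have h4 := I_le 0 y0.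
    by rewrite (ger0_norm y0) ler_norml; apply/andP; split; lra.
  have ny0 : 0 <= - y by rewrite oppr_ge0 ltW.
  have E : I y (- y) + I 0 T = I y T + I (y + T) (- y).
    have E1 := I_add y ny0 T0; have E2 := I_add y T0 ny0.
    by rewrite subrr in E1; rewrite -E1 -E2 addrC.
  have h1 := I_ge0 y (- y); have h2 := I_le y ny0.
  have h3 := I_ge0 (y + T) (- y); have h4 := I_le (y + T) ny0.
  by rewrite (ltr0_norm y0) ler_norml; apply/andP; split; lra.
have h5 : B * `|y| <= B * L by rewrite ler_wpM2l.
rewrite -(subrK (I y T) (I x T)) -addrA (le_trans (ler_normD _ _)) //; lra.
Qed.

Let I_mul e L : (forall x T, 0 <= T -> `|I x T - I 0 T| <= e * T + B * L) ->
  forall T n x, 0 <= T ->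
  `|I x (T *+ n) - I 0 T *+ n| <= (e * T + B * L) *+ n.
Proof.
move=> H T n x T0; elim: n x => [|n IH] x.
  have := I_le x (lexx 0); have := I_ge0 x 0; rewrite mulr0 !mulr0n => h1 h2.
  by rewrite subr0 (_ : I x 0 = 0) ?normr0 //; apply/eqP; rewrite eq_le h1 h2.
rewrite mulrS I_add ?mulrn_wge0 // !mulrS opprD addrACA.
by rewrite (le_trans (ler_normD _ _)) // lerD // H.
Qed.

(** Cut a long interval into pieces of a fixed length [T]: they all have nearly
the same mean. *)
Let I_unif e : 0 < e -> exists A S0, 0 < S0 /\
  forall x S, S0 <= S -> `|I x S - A * S| <= e * S.
Proof.
move=> e0; have e8 : 0 < e / 8 by rewrite divr_gt0.
have [L L0 LP] := I_near e8.
have B0 : 0 <= B by rewrite (le_trans (g0 0)).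
pose T := (B * L + 1) / (e / 8).
have T0 : 0 < T by rewrite divr_gt0 // ltr_wpDl // mulr_ge0.
have TBL : B * L <= e / 8 * T.
  by rewrite /T mulrCA mulfV ?gt_eqF // mulr1 lerDl.
pose A := I 0 T / T; pose S0 := 8 * B * T / e + T.
have q0 : 0 <= 8 * B * T / e.
  by apply: divr_ge0; [apply: mulr_ge0; [exact: mulr_ge0|exact: ltW]|exact: ltW].
exists A, S0; split; first by rewrite ltr_wpDl.
move=> x S S0S; have TS : T <= S.
  by rewrite (le_trans _ S0S) // lerDr.
have S00 : 0 < S by rewrite (lt_le_trans T0).
pose n := Num.truncn (S / T).
have ST0 : 0 <= S / T by rewrite divr_ge0 // ltW.
have /andP[n1 n2] := Num.Theory.truncn_itv ST0.
rewrite -/n ler_pdivlMr // in n1; rewrite -/n ltr_pdivrMr // -natr1 mulrDl mul1r in n2.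
pose r := S - n%:R * T.
have r0 : 0 <= r by rewrite subr_ge0.
have rT : r <= T by rewrite /r; lra.
have SE : S = T *+ n + r by rewrite /r -mulr_natl addrC subrK.
have IS : I x S = I x (T *+ n) + I (x + T *+ n) r.
  by rewrite {1}SE I_add // mulrn_wge0 // ltW.
have h1 := I_mul LP n x (ltW T0).
have h2 := I_ge0 (x + T *+ n) r; have h3 := I_le (x + T *+ n) r0.
have h4 : B * r <= B * T by rewrite ler_wpM2l.
have AE : A * S = I 0 T *+ n + A * r.
  by rewrite {1}SE mulrDr mulrnAr /A mulfVK // gt_eqF.
have A0 : 0 <= A by rewrite divr_ge0 // ltW.
have AB : A <= B by rewrite ler_pdivrMr // I_le // ltW.
have h5 : A * r <= B * T by rewrite ler_pM.
have h6 : 0 <= A * r by rewrite mulr_ge0.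
have h7 : (e / 8 * T + B * L) *+ n <= e / 4 * S.
  rewrite -mulr_natl; apply: (@le_trans _ _ (n%:R * (e / 4 * T))).
    by rewrite ler_wpM2l //; lra.
  by rewrite mulrCA ler_wpM2l // divr_ge0 // ltW.
have h8 : 2 * (B * T) <= e / 4 * S.
  have : e * (8 * B * T / e) <= e * S.
    by rewrite ler_wpM2l ?(ltW e0) // (le_trans _ S0S) // lerDl ltW.
  rewrite mulrCA mulfV ?gt_eqF // mulr1; lra.
have h9 : 0 <= e * S by rewrite mulr_ge0 // ltW.
rewrite IS AE; move: h1; rewrite !ler_norml => /andP[u1 u2].
by apply/andP; split; lra.
Qed.

(** The approximate means of [I_unif] are close to the means over [0, n] for large
[n], which therefore converge, and their limit is the uniform mean. *)
Lemma exists_mean : exists2 M, 0 <= M & has_mean g M.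
Proof.
pose u (n : nat) := I 0 n.+1%:R / n.+1%:R.
have uP e : 0 < e -> exists A N, forall n, (N <= n)%N -> `|u n - A| <= e.
  move=> /I_unif[A [S0 [S00 AP]]]; exists A, (Num.truncn S0) => n nN.
  have S0n : S0 <= n.+1%:R.
    rewrite (le_trans (ltW (Num.Theory.truncnS_gt _))) // ler_nat.
    exact: leq_ltn_trans nN _.
  have := AP 0 _ S0n; have n0 : 0 < n.+1%:R :> R by [].
  rewrite -{1}[I 0 _](mulfVK (lt0r_neq0 n0)) -/(u n) -mulrBl normrM.
  by rewrite (gtr0_norm n0) ler_pM2r.
have : cvgn u.
  apply/cauchy_cvgP/cauchy_exP => e e0.
  have e2 : 0 < e / 2 by rewrite divr_gt0.
  have [A [N AP]] := uP _ e2; exists A.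
  have : \forall n \near \oo, `|A - u n| < e.
    exists N => // n /= /AP; rewrite distrC => /le_lt_trans; apply.
    by rewrite ltr_pdivrMr // ltr_pMr // ltr1n.
  by apply: filterS => n; rewrite -ball_normE.
move=> /cvg_ex[M uM]; exists M.
  apply: (cvgr_to_ge uM); apply: nearW => n.
  by rewrite divr_ge0 // I_ge0.
move=> e e0; have e2 : 0 < e / 2 by rewrite divr_gt0.
have [A [S0 [S00 AP]]] := I_unif e2; exists S0 => // x S S0S.
have Sp : 0 < S by exact: lt_le_trans S0S.
have [N AN] : exists N, forall n, (N <= n)%N -> `|u n - A| <= e / 2.
  exists (Num.truncn S0) => n nN.
  have S0n : S0 <= n.+1%:R.
    rewrite (le_trans (ltW (Num.Theory.truncnS_gt _))) // ler_nat.
    exact: leq_ltn_trans nN _.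
  have := AP 0 _ S0n; have n0 : 0 < n.+1%:R :> R by [].
  rewrite -{1}[I 0 _](mulfVK (lt0r_neq0 n0)) -/(u n) -mulrBl normrM.
  by rewrite (gtr0_norm n0) ler_pM2r.
have M1 : M <= A + e / 2.
  apply: (cvgr_to_le uM); exists N => // n /= /AN.
  by rewrite ler_norml => /andP[_]; rewrite lerBlDl.
have M2 : A - e / 2 <= M.
  apply: (cvgr_to_ge uM); exists N => // n /= /AN.
  by rewrite ler_norml => /andP[+ _]; rewrite lerBrDr addrC.
have MA : `|A * S - M * S| <= e / 2 * S.
  rewrite -mulrBl normrM (gtr0_norm Sp) ler_pM2r // ler_norml.
  by apply/andP; split; lra.
rewrite -(subrK (A * S) (\int[leb]_(t in _) _)) -addrA.
rewrite (le_trans (ler_normD _ _)) //.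
have -> : e * S = e / 2 * S + e / 2 * S by field.
by apply: lerD => //; exact: AP.
Qed.

End means.
End mean_values.

(** * The norm of Dirichlet polynomials *)

Section lp_means.
Context {R : realType}.
Local Notation leb := (@lebesgue_measure R).
Implicit Types (u v : R -> R) (p T : R).

Lemma powR_superadd (x y p : R) : 1 <= p -> 0 <= x -> 0 <= y ->
  x `^ p + y `^ p <= (x + y) `^ p.
Proof.
move=> p1 x0 y0; have p0 : 0 < p by rewrite (lt_le_trans ltr01).
have xy0 : 0 <= x + y by rewrite addr_ge0.
rewrite -(mulr_powRB1 x0 p0) -(mulr_powRB1 y0 p0) -(mulr_powRB1 xy0 p0) mulrDl.
by apply: lerD; apply: ler_wpM2l => //; rewrite ge0_ler_powR ?nnegrE ?subr_ge0 // ?lerDl ?lerDr.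
Qed.

Lemma cvg_root (A : Type) (F : set_system A) {FF : Filter F} (g : A -> R) (l p : R) :
  1 <= p -> (forall t, 0 <= g t) -> 0 <= l ->
  g t @[t --> F] --> l -> g t `^ p^-1 @[t --> F] --> l `^ p^-1.
Proof.
move=> p1 g0 l0 gl; have p0 : 0 < p by rewrite (lt_le_trans ltr01).
have rp x : 0 <= x -> (x `^ p^-1) `^ p = x.
  by move=> x0; rewrite -powRrM mulVf ?powRr1 // gt_eqF.
(* superadditivity of the power makes the root Hoelder continuous *)
have key x y : 0 <= x -> x <= y -> (y `^ p^-1 - x `^ p^-1) `^ p <= y - x.
  move=> x0 xy; have y0 := le_trans x0 xy.
  have d0 : 0 <= y `^ p^-1 - x `^ p^-1.
    by rewrite subr_ge0 ge0_ler_powR ?nnegrE // invr_ge0 ltW.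
  have := powR_superadd p1 d0 (powR_ge0 x p^-1).
  by rewrite subrK !rp // lerBrDr.
apply/cvgrPdist_lt => e e0; have ep : 0 < e `^ p by rewrite powR_gt0.
move/cvgrPdist_lt : gl => /(_ _ ep); apply: filterS => t lt.
rewrite ltNge; apply/negP => He.
suff : e `^ p <= `|l - g t| by rewrite leNgt lt.
have {}He := ge0_ler_powR (ltW p0) (ltW e0 : e \in Num.nneg) (normr_ge0 _ : _ \in Num.nneg) He.
apply: (le_trans He); have [tl|/ltW tl] := leP (g t) l.
  rewrite [X in _ <= X]ger0_norm ?subr_ge0 // ger0_norm ?key // subr_ge0.
  by rewrite ge0_ler_powR ?nnegrE // invr_ge0 ltW.
rewrite distrC [X in _ <= X]distrC [X in _ <= X]ger0_norm ?subr_ge0 //.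
rewrite ger0_norm ?key // subr_ge0.
by rewrite ge0_ler_powR ?nnegrE // invr_ge0 ltW.
Qed.

Lemma continuous_powR_comp u p : 1 <= p -> continuous u -> (forall t, 0 <= u t) ->
  continuous (fun t => u t `^ p).
Proof. by move=> p1 uc u0 t; exact: cvg_powR (uc t). Qed.

Lemma minkowski_itv u v (a b p : R) : 1 <= p -> continuous u -> continuous v ->
  (forall t, 0 <= u t) -> (forall t, 0 <= v t) ->
  (\int[leb]_(t in `[a, b]) (u t + v t) `^ p) `^ p^-1 <=
  (\int[leb]_(t in `[a, b]) u t `^ p) `^ p^-1 +
  (\int[leb]_(t in `[a, b]) v t `^ p) `^ p^-1.
Proof.
move=> p1 uc vc u0 v0; have p0 : 0 < p by rewrite (lt_le_trans ltr01).
pose D := [set` `[a, b]] : set R; have mD : measurable D by exact: measurable_itv.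
have NE (w : R -> R) : continuous w -> (forall t, 0 <= w t) ->
    'N[leb]_(p%:E)[EFin \o (w \_ D)]%E =
    ((\int[leb]_(t in `[a, b]) w t `^ p) `^ p^-1)%:E.
  move=> wc w0; rewrite unlock.
  have wi : leb.-integrable D (EFin \o (fun t => w t `^ p)).
    by apply: continuous_at_integrable => t _; exact: continuous_powR_comp.
  rewrite -poweR_EFin /Rintegral fineK; last exact: integrable_fin_num.
  congr (_ `^ _)%E; rewrite [RHS]integral_mkcond; apply: eq_integral => t _.
  rewrite /= /patch; case: ifPn => _; first by rewrite ger0_norm.
  by rewrite normr0 powR0 // gt_eqF.
have mw (w : R -> R) : continuous w -> measurable_fun setT (w \_ D).
  move=> wc; apply/(measurable_restrictT _ _).1 => //.
  by apply: measurable_funTS; exact: continuous_measurable_fun.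
have := minkowski_EFin leb (mw u uc) (mw v vc) p1.
have -> : (u \_ D \+ v \_ D)%R = (fun t => u t + v t) \_ D.
  by apply/funext => t; rewrite /= /patch; case: ifP; rewrite ?addr0.
rewrite -[X in ('N[_]_(_)[X] <= _)%E]/(EFin \o _) !NE //.
- by move=> t; apply: continuousD; [exact: uc|exact: vc].
- by move=> t; rewrite addr_ge0.
Qed.

Definition mean_norm p T u :=
  ((2 * T)^-1 * \int[leb]_(t in `[- T, T]) u t `^ p) `^ p^-1.

Lemma mean_normD p T u v : 1 <= p -> 0 < T -> continuous u -> continuous v ->
  (forall t, 0 <= u t) -> (forall t, 0 <= v t) ->
  mean_norm p T (fun t => u t + v t) <= mean_norm p T u + mean_norm p T v.
Proof.
move=> p1 T0 uc vc u0 v0.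
have i0 : 0 <= (2 * T)^-1 by rewrite invr_ge0 mulr_ge0 // ltW.
have I0 w : 0 <= \int[leb]_(t in `[- T, T]) w t `^ p.
  by apply: Rintegral_ge0 => t _; exact: powR_ge0.
have E w : mean_norm p T w =
    (2 * T)^-1 `^ p^-1 * (\int[leb]_(t in `[- T, T]) w t `^ p) `^ p^-1.
  exact: powRM _ i0 (I0 w).
rewrite !E -mulrDr; apply: ler_wpM2l; first exact: powR_ge0.
exact: minkowski_itv.
Qed.

Lemma ler_mean_norm p T u v : 1 <= p -> 0 < T -> continuous u -> continuous v ->
  (forall t, 0 <= u t) -> (forall t, u t <= v t) ->
  mean_norm p T u <= mean_norm p T v.
Proof.
move=> p1 T0 uc vc u0 uv; have p0 : 0 < p by rewrite (lt_le_trans ltr01).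
have v0 t : 0 <= v t by rewrite (le_trans (u0 t)).
have i0 : 0 <= (2 * T)^-1 by rewrite invr_ge0 mulr_ge0 // ltW.
have I0 w : 0 <= \int[leb]_(t in `[- T, T]) w t `^ p.
  by apply: Rintegral_ge0 => t _; exact: powR_ge0.
apply: ge0_ler_powR.
- by rewrite invr_ge0 ltW.
- by rewrite nnegrE; exact: mulr_ge0 i0 (I0 _).
- by rewrite nnegrE; exact: mulr_ge0 i0 (I0 _).
apply: (ler_wpM2l i0); apply: le_Rintegral => //.
- by apply: continuous_at_integrable => t _; exact: continuous_powR_comp.
- by apply: continuous_at_integrable => t _; exact: continuous_powR_comp.
- by move=> t _; apply: ge0_ler_powR; rewrite ?nnegrE // ltW.
Qed.

Lemma mean_normZ p T u (c : R) : 1 <= p -> 0 < T -> 0 <= c -> continuous u ->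
  (forall t, 0 <= u t) -> mean_norm p T (fun t => c * u t) = c * mean_norm p T u.
Proof.
move=> p1 T0 c0 uc u0; have p0 : 0 < p by rewrite (lt_le_trans ltr01).
have i0 : 0 <= (2 * T)^-1 by rewrite invr_ge0 mulr_ge0 // ltW.
have I0 w : 0 <= \int[leb]_(t in `[- T, T]) w t `^ p.
  by apply: Rintegral_ge0 => t _; exact: powR_ge0.
rewrite /mean_norm.
have -> : \int[leb]_(t in `[- T, T]) (c * u t) `^ p =
    c `^ p * \int[leb]_(t in `[- T, T]) u t `^ p.
  rewrite -RintegralZl //.
    by apply: eq_Rintegral => t _; rewrite powRM.
  by apply: continuous_at_integrable => t _; exact: continuous_powR_comp.
rewrite mulrCA (powRM _ (powR_ge0 _ _) (mulr_ge0 i0 (I0 _))).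
by rewrite -powRrM mulfV ?powRr1 // gt_eqF.
Qed.

Lemma mean_norm_cst p T (c : R) : 1 <= p -> 0 < T -> 0 <= c ->
  mean_norm p T (fun=> c) = c.
Proof.
move=> p1 T0 c0; have p0 : 0 < p by rewrite (lt_le_trans ltr01).
have fT : fine (leb `[- T, T]) = 2 * T.
  rewrite lebesgue_measure_cc /=; last by rewrite ge0_cp // ltW.
  by rewrite opprK -mulr2n mulr_natl.
rewrite /mean_norm Rintegral_cst // fT mulrCA mulVf; last by rewrite gt_eqF // mulr_gt0.
by rewrite mulr1 -powRrM mulfV ?powRr1 // gt_eqF.
Qed.

End lp_means.

Section besicovitch.
Context {R : realType}.
Local Notation leb := (@lebesgue_measure R).
Implicit Types (p T t : R) (a b : seq R[i]).

Definition imag_mod a t := cmod (dirichlet_poly a (0 +i* t)).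

Lemma imag_mod_ge0 a t : 0 <= imag_mod a t.
Proof. exact: cmod_ge0. Qed.

Lemma imag_mod_le a t : imag_mod a t <= coef_norm a.
Proof. exact: cmod_dirichlet_poly_le. Qed.

Lemma continuous_imag_mod a : continuous (imag_mod a).
Proof. exact: (continuous_line (@analytic_dirichlet_poly _ a setT) (fun=> I)). Qed.

Lemma continuous_dirichlet_powR p a (x : R) : 1 <= p ->
  continuous (fun t => cmod (dirichlet_poly a (x +i* t)) `^ p).
Proof.
move=> p1.
exact: (continuous_line_powR p1 (@analytic_dirichlet_poly _ a setT) (fun=> I)).
Qed.

(** A translate of a Dirichlet polynomial is determined by finitely many unimodular
numbers. Their real and imaginary parts are listed alternately, as a bounded family
to which the pigeonhole argument applies. *)
Lemma imag_mod_precompact a : translates_precompact (imag_mod a).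
Proof.
move=> e e0; have k0 : 0 < coef_norm a + 1 by rewrite ltr_wpDl // coef_norm_ge0.
have ek : 0 < e / (coef_norm a + 1) / 2 by rewrite !divr_gt0.
pose h (k : nat) t : R := let z := dirichlet_term k./2.+1 (0 +i* t) in
  if odd k then complex.Im z else complex.Re z.
have h1 k t : -1 <= h k t <= 1.
  rewrite -ler_norml -(cmod_dirichlet_term_imag k./2.+1 t) /h.
  by case: ifP => _; [exact: Im_le_cmod|exact: Re_le_cmod].
have [L L0 LP] := bounded_family_precompact (size a).*2 h1 ek.
exists L => // x; have [y yL yP] := LP x; exists y => // t.
rewrite (le_trans (cmod_distr _ _)) //.
have add (u v : R) : 0 +i* (u + v) = (0 +i* v) + (0 +i* u) :> R[i].
  by apply: complex_ext; rewrite ?cReD ?cImD /= ?addr0 // addrC.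
rewrite !add; apply: (@le_trans _ _ (coef_norm a * (e / (coef_norm a + 1)))).
  apply: cmod_dirichlet_polyB_le => // i ia.
  rewrite (le_trans (cmod_le _)) // cReD cReN cImD cImN.
  have := yP i.*2; rewrite ltn_double => /(_ ia).
  have := yP i.*2.+1; rewrite ltn_Sdouble => /(_ ia).
  rewrite /h /= odd_double /= uphalf_double doubleK => h2 h3.
  by rewrite [e / _]splitr lerD.
by rewrite mulrCA ler_piMr ?(ltW e0) // ler_pdivrMr // mul1r lerDl.
Qed.

(** Powers inherit almost periodicity from the modulus, being Lipschitz on bounded
sets; hence the limit that defines the norm exists. *)
Lemma imag_mod_has_mean p a : 1 <= p ->
  exists2 M, 0 <= M & has_mean (fun t => imag_mod a t `^ p) M.
Proof.
move=> p1; have p0 : 0 < p by rewrite (lt_le_trans ltr01).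
apply: (@exists_mean _ _ (coef_norm a `^ p)).
- by apply: continuous_powR_comp => //; [exact: continuous_imag_mod|exact: imag_mod_ge0].
- by move=> t; exact: powR_ge0.
- move=> t; apply: ge0_ler_powR; rewrite ?nnegrE ?(ltW p0) ?imag_mod_ge0 ?coef_norm_ge0 //.
  exact: imag_mod_le.
move=> e e0; have [K K0 KP] := powR_lipschitz p1 (coef_norm_ge0 a).
have eK : 0 < e / K by rewrite divr_gt0.
have [L L0 LP] := imag_mod_precompact a eK; exists L => // x.
have [y yL yP] := LP x; exists y => // t.
apply: (@le_trans _ _ (K * `|imag_mod a (x + t) - imag_mod a (y + t)|)).
  by apply: KP; rewrite imag_mod_ge0 imag_mod_le.
by rewrite mulrC -ler_pdivlMr.
Qed.

Lemma has_mean_cvg (f : R -> R) M : has_mean f M ->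
  (2 * T)^-1 * (\int[leb]_(t in `[- T, T]) f t) @[T --> +oo] --> M.
Proof.
move=> fM; apply/cvgrPdist_le => e e0; have [S0 S00 SP] := fM e e0.
exists S0; split; first exact: num_real.
move=> T ST; have T0 : 0 < T by exact: lt_trans ST.
have TT : - T + 2 * T = T by rewrite mulr_natl mulr2n addKr.
have T2 : 0 < 2 * T by rewrite mulr_gt0.
have := SP (- T) (2 * T); rewrite TT => /(_ _) H.
rewrite distrC -[M](mulKf (lt0r_neq0 T2)) -mulrBr normrM gtr0_norm ?invr_gt0 //.
rewrite ler_pdivrMl // [X in _ - X]mulrC [leRHS]mulrC; apply: H.
by rewrite (le_trans (ltW ST)) // ler_peMl ?(ltW T0) // ler1n.
Qed.

Lemma mean_ge0 (u : R -> R) T : (forall t, 0 <= u t) ->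
  0 <= (2 * T)^-1 * (\int[leb]_(t in `[- T, T]) u t).
Proof.
move=> u0; have I0 : 0 <= \int[leb]_(t in `[- T, T]) u t by exact: Rintegral_ge0.
have [T0|T0] := leP 0 T; first by rewrite mulr_ge0 // invr_ge0 mulr_ge0.
rewrite set_itv_ge ?Rintegral_set0 ?mulr0 // bnd_simp -ltNge.
by rewrite (lt_trans T0) // oppr_gt0.
Qed.

Lemma mean_besicovitch_cvg p a M : 1 <= p -> 0 <= M ->
  has_mean (fun t => imag_mod a t `^ p) M ->
  mean_norm p T (imag_mod a) @[T --> +oo] --> M `^ p^-1.
Proof.
move=> p1 M0 aM; apply: cvg_root => //; last exact: has_mean_cvg.
by move=> T; apply: mean_ge0 => t; exact: powR_ge0.
Qed.

Lemma besicovitch_normE p a M : 1 <= p -> 0 <= M ->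
  has_mean (fun t => imag_mod a t `^ p) M ->
  besicovitch_norm p (dirichlet_poly a) = M `^ p^-1.
Proof.
move=> p1 M0 /(mean_besicovitch_cvg p1 M0) H.
exact: (cvg_lim (@Rhausdorff R) H).
Qed.

Lemma besicovitch_cvg p a : 1 <= p ->
  mean_norm p T (imag_mod a) @[T --> +oo] --> besicovitch_norm p (dirichlet_poly a).
Proof.
move=> p1; have [M M0 aM] := imag_mod_has_mean a p1.
by rewrite (besicovitch_normE p1 M0 aM); exact: mean_besicovitch_cvg.
Qed.

Lemma besicovitch_norm_ge0 p a : 1 <= p ->
  0 <= besicovitch_norm p (dirichlet_poly a).
Proof.
move=> p1; have [M M0 aM] := imag_mod_has_mean a p1.
by rewrite (besicovitch_normE p1 M0 aM) powR_ge0.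
Qed.

Lemma has_mean_translate (f : R -> R) (M c : R) : continuous f -> has_mean f M ->
  has_mean (fun t => f (c + t)) M.
Proof.
move=> fc fM e e0; have [S0 S00 SP] := fM e e0; exists S0; first exact: S00.
move=> x S S0S; have S0' : 0 <= S := le_trans (ltW S00) S0S.
have xS : x <= x + S by rewrite lerDl.
by rewrite -(Rintegral_translate c xS fc) addrA; exact: SP.
Qed.

Lemma besicovitch_norm_shift_imag p a (c : R) : 1 <= p ->
  besicovitch_norm p (dirichlet_poly (shift_coef (0 +i* c) a)) =
  besicovitch_norm p (dirichlet_poly a).
Proof.
move=> p1; have [M M0 aM] := imag_mod_has_mean a p1.
rewrite (besicovitch_normE p1 M0 aM).
have ic : continuous (fun t => imag_mod a t `^ p).
  by apply: continuous_powR_comp p1 _ _; [exact: continuous_imag_mod|exact: imag_mod_ge0].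
have E : (fun t => imag_mod a (c + t) `^ p) =
    (fun t => imag_mod (shift_coef (0 +i* c) a) t `^ p).
  apply/funext => t; rewrite /imag_mod dirichlet_poly_shift.
  have -> : (0 +i* c) + (0 +i* t) = 0 +i* (c + t) :> R[i].
    by apply: complex_ext; rewrite ?cReD ?cImD /= ?addr0.
  by [].
have := has_mean_translate c ic aM; rewrite E => cM.
exact: besicovitch_normE p1 M0 cM.
Qed.

(** Minkowski's inequality in the form in which a function is compared with the
mean of its translates to the vertices of a square. *)
Lemma besicovitch_norm_four p a b1 b2 b3 b4 (E : R) : 1 <= p -> 0 <= E ->
  (forall t, 4 * imag_mod a t <= imag_mod b1 t + imag_mod b2 t + imag_mod b3 t +
     imag_mod b4 t + E) ->
  4 * besicovitch_norm p (dirichlet_poly a) <=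
  besicovitch_norm p (dirichlet_poly b1) + besicovitch_norm p (dirichlet_poly b2) +
  besicovitch_norm p (dirichlet_poly b3) + besicovitch_norm p (dirichlet_poly b4) + E.
Proof.
move=> p1 E0 H; have ic := continuous_imag_mod; have i0 := imag_mod_ge0.
have cD (u v : R -> R) : continuous u -> continuous v -> continuous (fun t => u t + v t).
  by move=> uc vc t; apply: continuousD; [exact: uc|exact: vc].
have H1 : 4 * mean_norm p T (imag_mod a) @[T --> +oo] -->
    4 * besicovitch_norm p (dirichlet_poly a).
  apply: (cvgM (f := fun=> 4)); first exact: cvg_cst.
  exact: besicovitch_cvg.
have H2 : mean_norm p T (imag_mod b1) + mean_norm p T (imag_mod b2) +
    mean_norm p T (imag_mod b3) + mean_norm p T (imag_mod b4) + E @[T --> +oo] -->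
    besicovitch_norm p (dirichlet_poly b1) + besicovitch_norm p (dirichlet_poly b2) +
    besicovitch_norm p (dirichlet_poly b3) + besicovitch_norm p (dirichlet_poly b4) + E.
  apply: cvgD; last exact: cvg_cst.
  by apply: cvgD; [apply: cvgD; [apply: cvgD|]|]; exact: besicovitch_cvg.
apply: (ler_cvg_to H1 H2).
exists 0; split=> // T T0 /=; rewrite -mean_normZ //.
have c1 := cD _ _ (ic b1) (ic b2); have c2 := cD _ _ c1 (ic b3).
have c3 := cD _ _ c2 (ic b4); have cE : continuous (fun _ : R => E) by move=> t; exact: cst_continuous.
have n1 t : 0 <= imag_mod b1 t + imag_mod b2 t by rewrite addr_ge0.
have n2 t : 0 <= imag_mod b1 t + imag_mod b2 t + imag_mod b3 t by rewrite addr_ge0.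
have n3 t : 0 <= imag_mod b1 t + imag_mod b2 t + imag_mod b3 t + imag_mod b4 t by rewrite addr_ge0.
apply: (@le_trans _ _ (mean_norm p T (fun t => imag_mod b1 t + imag_mod b2 t +
   imag_mod b3 t + imag_mod b4 t + E))).
  apply: ler_mean_norm => //.
  - by move=> t; apply: (cvgM (f := fun=> 4)); [exact: cvg_cst|exact: ic].
  - exact: cD.
  - by move=> t; rewrite mulr_ge0.
rewrite (le_trans (mean_normD p1 T0 c3 cE n3 (fun=> E0))) // mean_norm_cst // lerD2r.
rewrite (le_trans (mean_normD p1 T0 c2 (ic b4) n2 (i0 b4))) // lerD2r.
rewrite (le_trans (mean_normD p1 T0 c1 (ic b3) n1 (i0 b3))) // lerD2r.
exact: mean_normD.
Qed.

Lemma besicovitch_norm_le_cst p a (E : R) : 1 <= p -> 0 <= E ->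
  (forall t, imag_mod a t <= E) -> besicovitch_norm p (dirichlet_poly a) <= E.
Proof.
move=> p1 E0 H; apply: (cvgr_to_le (besicovitch_cvg (a := a) p1)).
exists 0; split=> // T T0; rewrite -[leRHS](mean_norm_cst p1 T0 E0).
apply: ler_mean_norm => //; [exact: continuous_imag_mod|by move=> t; exact: cst_continuous|].
exact: imag_mod_ge0.
Qed.

Lemma besicovitch_norm_triangle p a b c : 1 <= p ->
  (forall t, imag_mod c t <= imag_mod a t + imag_mod b t) ->
  besicovitch_norm p (dirichlet_poly c) <=
  besicovitch_norm p (dirichlet_poly a) + besicovitch_norm p (dirichlet_poly b).
Proof.
move=> p1 H.
have H2 : mean_norm p T (imag_mod a) + mean_norm p T (imag_mod b) @[T --> +oo] -->
    besicovitch_norm p (dirichlet_poly a) + besicovitch_norm p (dirichlet_poly b).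
  by apply: cvgD; exact: besicovitch_cvg.
apply: (ler_cvg_to (besicovitch_cvg (a := c) p1) H2).
exists 0; split=> // T T0 /=; have ic := continuous_imag_mod; have i0 := imag_mod_ge0.
apply: (@le_trans _ _ (mean_norm p T (fun t => imag_mod a t + imag_mod b t))).
  apply: ler_mean_norm => // t; apply: continuousD; exact: ic.
exact: mean_normD.
Qed.

End besicovitch.

(** * Contractivity of translations to the right *)

Section horizontal_translates.
Context {R : realType}.
Implicit Types (p r x y l e : R) (a : seq R[i]).

(** The mean of the exponential over the four vertices of a square agrees with
the value at the centre up to [o(x^2)]. *)
Lemma four_point_exp e : 0 < e -> exists2 d : R, 0 < d & forall x, `|x| < d ->
  `|4 - (expR x + expR (- x) + 2 * cos x)| <= e * x ^+ 2.
Proof.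
move=> e0; pose k := Num.min 1 (e / 8).
have k0 : 0 < k by rewrite lt_min ltr01 divr_gt0.
have [k1 k2] : k <= 1 /\ k <= e / 8 by split; rewrite ge_min lexx ?orbT.
have [r1 r10 E] := is_derive_linear_approx (is_derive_expR 0) k0.
have [r2 r20 S] := is_derive_linear_approx (is_derive_sin 0) k0.
exists (Num.min r1 r2); first by rewrite lt_min r10.
move=> x; rewrite lt_min => /andP[x1 x2].
pose y := x / 2.
have yx : `|y| <= `|x|.
  by rewrite /y normrM ler_piMr // ger0_norm ?invr_ge0 // invf_le1 // ler1n.
have := E y (le_lt_trans yx x1); rewrite add0r expR0 mul1r => Ey.
have := E (- y); rewrite normrN => /(_ (le_lt_trans yx x1)).
rewrite add0r expR0 mul1r opprK => Ey'.
have := S y (le_lt_trans yx x2); rewrite add0r sin0 cos0 mul1r subr0 => Sy.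
have xy : x = y + y by rewrite /y -splitr.
have cx : cos x = 1 - 2 * sin y ^+ 2.
  rewrite xy cosD; have := cos2Dsin2 y => cs.
  have -> : cos y * cos y = 1 - sin y ^+ 2 by rewrite -expr2 -cs addrK.
  ring.
have ex : expR x = expR y * expR y by rewrite xy expRD.
have enx : expR (- x) = expR (- y) * expR (- y) by rewrite xy opprD expRD.
have ey1 : expR y * expR (- y) = 1 by rewrite -expRD subrr expR0.
pose s := expR y - expR (- y).
have -> : 4 - (expR x + expR (- x) + 2 * cos x) = (2 * sin y - s) * (2 * sin y + s).
  rewrite ex enx cx /s.
  have -> : (2 * sin y - (expR y - expR (- y))) * (2 * sin y + (expR y - expR (- y))) =
    4 * sin y ^+ 2 - expR y * expR y - expR (- y) * expR (- y) + 2 * (expR y * expR (- y)) by ring.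
  rewrite ey1; ring.
have m0 := normr_ge0 y.
have h1 : `|2 * sin y - s| <= 4 * k * `|y|.
  have -> : 2 * sin y - s = 2 * (sin y - y) - (expR y - 1 - y) + (expR (- y) - 1 + y).
    by rewrite /s; ring.
  rewrite (le_trans (ler_normD _ _)) //.
  have t1 := ler_normB (2 * (sin y - y)) (expR y - 1 - y).
  rewrite normrM (ger0_norm (_ : 0 <= 2)) // in t1.
  lra.
have h2 : `|2 * sin y + s| <= 8 * `|y|.
  have -> : 2 * sin y + s = 2 * (sin y - y) + (expR y - 1 - y) - (expR (- y) - 1 + y) + 4 * y.
    by rewrite /s; ring.
  rewrite (le_trans (ler_normD _ _)) //.
  have t0 := ler_normB (2 * (sin y - y) + (expR y - 1 - y)) (expR (- y) - 1 + y).
  have t1 := ler_normD (2 * (sin y - y)) (expR y - 1 - y).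
  rewrite normrM (ger0_norm (_ : 0 <= 2)) // in t1.
  rewrite [X in _ + X]normrM (ger0_norm (_ : 0 <= 4)) //.
  have : k * `|y| <= 1 * `|y| by rewrite ler_wpM2r.
  lra.
rewrite normrM (le_trans (ler_pM _ _ h1 h2)) //.
have -> : 4 * k * `|y| * (8 * `|y|) = 8 * k * x ^+ 2.
  transitivity (32 * k * `|y| ^+ 2); first by ring.
  by rewrite real_normK ?num_real // /y; field.
rewrite ler_wpM2r ?sqr_ge0 //; lra.
Qed.

Lemma exists_div_natS_lt (x c : R) : 0 < c -> exists n, x / n.+1%:R < c.
Proof.
move=> c0; exists (Num.truncn (x / c)).
by rewrite ltr_pdivrMr // -ltr_pdivrMl // mulrC Num.Theory.truncnS_gt.
Qed.

(** A bounded sequence that is nearly midpoint convex does not grow much: an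
increment could only be made up for by unbounded growth later on. *)
Lemma nearly_convex_bounded (N : nat -> R) (B E : R) (K n : nat) : 0 <= E ->
  (forall j, 0 <= N j <= B) -> (forall j, 2 * N j.+1 <= N j.+2 + N j + E) ->
  N n - N 0%N <= n%:R * (B / K.+1%:R + K.+1%:R * E).
Proof.
move=> E0 NB Nc; pose d j := N j.+1 - N j.
have dS j : d j - E <= d j.+1 by have := Nc j; rewrite /d; lra.
have dm i m : d i - m%:R * E <= d (i + m)%N.
  elim: m => [|m IH]; first by rewrite mul0r subr0 addn0.
  by rewrite addnS (le_trans _ (dS _)) // -natr1 mulrDl mul1r opprD addrA lerD2r.
have sum i m : m%:R * d i - m%:R * (m%:R * E) <= N (i + m)%N - N i.
  elim: m => [|m IH]; first by rewrite !mul0r addn0 !subrr.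
  have := dm i m; rewrite /d addnS -!natr1 => h.
  have m0 : 0 <= m%:R :> R by [].
  have : 0 <= m%:R * E by rewrite mulr_ge0.
  set x := m%:R in IH h m0 * => xE0.
  have -> : (x + 1) * ((x + 1) * E) = x * (x * E) + 2 * (x * E) + E by ring.
  have -> : (x + 1) * (N i.+1 - N i) = x * (N i.+1 - N i) + (N i.+1 - N i) by ring.
  move: IH h; rewrite /d; lra.
have d_le i : d i <= B / K.+1%:R + K.+1%:R * E.
  have := sum i K.+1; have K0 : 0 < K.+1%:R :> R by [].
  have /andP[h1 h2] := NB (i + K.+1)%N; have /andP[h3 h4] := NB i.
  set k := K.+1%:R in K0 * => h5; rewrite -(ler_pM2l K0).
  have -> : k * (B / k + k * E) = B + k * (k * E) by field; rewrite gt_eqF.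
  lra.
set X := B / _ + _ in d_le *; elim: n => [|n IH]; first by rewrite mul0r subrr.
rewrite -natr1 mulrDl mul1r; have := d_le n; rewrite /d; lra.
Qed.

(** The error in the comparison with the four vertices, for the character of
[i.+1] and a square of half diagonal [r]. *)
Definition four_defect (i : nat) (r : R) : R :=
  let l := ln i.+1%:R in
  `|4 - (expR (r * l) + expR (- (r * l)) + 2 * cos (r * l))|.

Lemma dirichlet_term_four (i : nat) (r : R) :
  cmod (4 - (dirichlet_term i.+1 r%:C + dirichlet_term i.+1 (- r)%:C +
    dirichlet_term i.+1 (0 +i* r) + dirichlet_term i.+1 (0 +i* - r))) =
  four_defect i r.
Proof.
rewrite /four_defect /dirichlet_term; set l := ln _.
have -> : - r%:C * l%:C = (- (r * l))%:C.
  by apply: complex_ext; rewrite !(cReM, cImM, cReN, cImN) /=; ring.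
have -> : - (- r)%:C * l%:C = (r * l)%:C.
  by apply: complex_ext; rewrite !(cReM, cImM, cReN, cImN) /=; ring.
have -> : - (0 +i* r) * l%:C = 0 +i* (- (r * l)).
  by apply: complex_ext; rewrite !(cReM, cImM, cReN, cImN) /=; ring.
have -> : - (0 +i* - r) * l%:C = 0 +i* (r * l).
  by apply: complex_ext; rewrite !(cReM, cImM, cReN, cImN) /=; ring.
have cR (x : R) : cexp x%:C = (expR x)%:C :> R[i].
  by rewrite /cexp /= cos0 sin0; apply: complex_ext; rewrite !(cReM, cImM) /=; ring.
have cI (x : R) : cexp (0 +i* x) = cos x +i* sin x :> R[i].
  by rewrite /cexp /= expR0; apply: complex_ext; rewrite !(cReM, cImM) /=; ring.
rewrite !cR !cI cosN sinN -[RHS]cmod_real; congr cmod.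
have E4 : 4 = (4 : R)%:C :> R[i] by rewrite rmorph_nat.
rewrite E4.
by apply: complex_ext; rewrite !(cReD, cImD, cReN, cImN) /=; ring.
Qed.

Lemma four_defect_small (n : nat) (e : R) : 0 < e -> exists2 d : R, 0 < d &
  forall r, 0 < r < d -> forall i, (i < n)%N -> four_defect i r <= e * r ^+ 2.
Proof.
move=> e0; elim: n => [|n [d d0 dP]]; first by exists 1.
pose l : R := ln n.+1%:R; have k0 : 0 < l ^+ 2 + 1 by rewrite ltr_wpDl // sqr_ge0.
have l1 : 0 < `|l| + 1 by rewrite ltr_wpDl.
have [c c0 cP] := four_point_exp (divr_gt0 e0 k0).
exists (Num.min d (c / (`|l| + 1))); first by rewrite lt_min d0 divr_gt0.
move=> r; rewrite lt_min => /andP[r0 /andP[rd]]; rewrite ltr_pdivlMr // => rc i.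
rewrite ltnS leq_eqVlt => /orP[/eqP ->|]; last by apply: dP; rewrite r0.
have rl : `|r * l| < c.
  rewrite normrM (gtr0_norm r0) (le_lt_trans _ rc) // ler_pM2l // lerDl //.
apply: (le_trans (cP _ rl)); rewrite exprMn -mulrA ler_pM2l // ler_pdivrMl //.
by rewrite mulrC ler_pM2r ?exprn_gt0 // lerDl.
Qed.

(** Let [N x] be the norm of [s |-> P (x + s)]. The value of [P] at a point is the
mean of its values at the vertices of a square of half diagonal [r], up to [o(r^2)].
Vertical translations preserve the norm, hence
[4 N x <= N (x + r) + N (x - r) + 2 N x + o(r^2)]: on every grid of step [r], the
function [N] is midpoint convex up to [o(r^2)]. A bounded convex function on a half
line does not increase. *)
Lemma besicovitch_norm_shift_real p a (x : R) : 1 <= p -> 0 <= x ->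
  besicovitch_norm p (dirichlet_poly (shift_coef x%:C a)) <=
  besicovitch_norm p (dirichlet_poly a).
Proof.
move=> p1 x0.
pose N r (j : nat) := besicovitch_norm p (dirichlet_poly (shift_coef (r * j%:R)%:C a)).
pose B := coef_norm a; have B0 : 0 <= B := coef_norm_ge0 a.
pose D r := \sum_(i < size a) cmod a`_i * four_defect i r.
have D0 r : 0 <= D r.
  by apply: sumr_ge0 => i _; apply: mulr_ge0; [exact: cmod_ge0|exact: normr_ge0].
have NB r j : 0 <= r -> 0 <= N r j <= B.
  move=> r0; rewrite besicovitch_norm_ge0 //=.
  apply: besicovitch_norm_le_cst => // t; rewrite /imag_mod dirichlet_poly_shift.
  by apply: cmod_dirichlet_poly_le; rewrite cReD /= addr0 mulr_ge0.
have Nc r j : 0 <= r -> 2 * N r j.+1 <= N r j.+2 + N r j + D r.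
  move=> r0; pose s := (r * j.+1%:R)%:C : R[i].
  have s0 : 0 <= complex.Re s by rewrite /= mulr_ge0.
  have S1 : besicovitch_norm p (dirichlet_poly (shift_coef (0 +i* r) (shift_coef s a))) =
      N r j.+1 := besicovitch_norm_shift_imag (shift_coef s a) r p1.
  have S2 : besicovitch_norm p (dirichlet_poly (shift_coef (0 +i* - r) (shift_coef s a))) =
      N r j.+1 := besicovitch_norm_shift_imag (shift_coef s a) (- r) p1.
  have H := @besicovitch_norm_four _ p (shift_coef s a)
    (shift_coef (r * j.+2%:R)%:C a) (shift_coef (r * j%:R)%:C a)
    (shift_coef (0 +i* r) (shift_coef s a)) (shift_coef (0 +i* - r) (shift_coef s a))
    (D r) p1 (D0 r).
  rewrite S1 S2 in H; clear S1 S2.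
  have H' : (forall t, 4 * imag_mod (shift_coef s a) t <=
      imag_mod (shift_coef (r * j.+2%:R)%:C a) t + imag_mod (shift_coef (r * j%:R)%:C a) t +
      imag_mod (shift_coef (0 +i* r) (shift_coef s a)) t +
      imag_mod (shift_coef (0 +i* - r) (shift_coef s a)) t + D r) ->
      4 * N r j.+1 <= N r j.+2 + N r j + N r j.+1 + N r j.+1 + D r := H.
  clear H; suff : 4 * N r j.+1 <= N r j.+2 + N r j + N r j.+1 + N r j.+1 + D r.
    by move: (N r j.+1) (N r j.+2) (N r j) (D r); clear; move=> u1 u2 u3 u4; lra.
  apply: H' => t; rewrite /imag_mod !dirichlet_poly_shift.
  set z := s + (0 +i* t).
  have z0 : 0 <= complex.Re z by rewrite cReD /= addr0.
  have -> : (r * j.+2%:R)%:C + (0 +i* t) = z + r%:C.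
    by apply: complex_ext; rewrite /z /s !(cReD, cImD) /= -?natr1; ring.
  have -> : (r * j%:R)%:C + (0 +i* t) = z + (- r)%:C.
    by apply: complex_ext; rewrite /z /s !(cReD, cImD) /= -?natr1; ring.
  have -> : s + ((0 +i* r) + (0 +i* t)) = z + (0 +i* r) by rewrite /z; ring.
  have -> : s + ((0 +i* - r) + (0 +i* t)) = z + (0 +i* - r) by rewrite /z; ring.
  set S := dirichlet_poly a (z + r%:C) + dirichlet_poly a (z + (- r)%:C) +
    dirichlet_poly a (z + (0 +i* r)) + dirichlet_poly a (z + (0 +i* - r)).
  have SP : cmod (4 * dirichlet_poly a z - S) <= D r.
    rewrite /S /dirichlet_poly mulr_sumr -!big_split /= -sumrB.
    rewrite (le_trans (cmod_sum _ _ _)) //; apply: ler_sum => i _.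
    rewrite !(dirichlet_termD _ z) -dirichlet_term_four.
    set w := dirichlet_term i.+1 z; set u1 := dirichlet_term _ r%:C.
    set u2 := dirichlet_term _ (- r)%:C; set u3 := dirichlet_term _ (0 +i* r).
    set u4 := dirichlet_term _ (0 +i* - r).
    rewrite [X in cmod X <= _](_ : _ = w * (a`_i * (4 - (u1 + u2 + u3 + u4)))); last by ring.
    rewrite cmodM [X in _ * X]cmodM ler_piMl ?mulr_ge0 ?cmod_ge0 //.
    exact: cmod_dirichlet_term_le1.
  have c4 : 4 * cmod (dirichlet_poly a z) = cmod (4 * dirichlet_poly a z).
    have E4 : 4 = (4 : R)%:C :> R[i] by rewrite rmorph_nat.
    by rewrite cmodM E4 cmod_real ger0_norm.
  rewrite c4 -[4 * dirichlet_poly a z](subrK S) (le_trans (cmodD _ _)) // addrC lerD //.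
  by do 3 (rewrite (le_trans (cmodD _ _)) // lerD2r).
have [->|xn0] := eqVneq x 0.
  rewrite le_eqVlt; apply/orP; left; apply/eqP; congr (besicovitch_norm p _).
  by apply/funext => s; rewrite dirichlet_poly_shift add0r.
have {xn0}x0 : 0 < x by rewrite lt0r xn0.
apply/ler_addgt0Pl => e e0; rewrite -lerBlDr.
have e2 : 0 < e / 2 by rewrite divr_gt0.
have [m Bm] := exists_div_natS_lt B e2.
pose k : R := m.+1%:R; have k0 : 0 < k by [].
have q0 : 0 < (B + 1) * (k * x ^+ 2 * 4) by rewrite !mulr_gt0 ?exprn_gt0 // ltr_wpDl.
have eq0 : 0 < e / ((B + 1) * (k * x ^+ 2 * 4)) by rewrite divr_gt0.
have [d d0 dP] := four_defect_small (size a) eq0.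
have [n xd] := exists_div_natS_lt x d0.
pose y : R := n.+1%:R; have y0 : 0 < y by [].
pose r := x / y; have r0 : 0 < r by rewrite divr_gt0.
have rx : r * n.+1%:R = x by rewrite /r divfK // lt0r_neq0.
have rd : 0 < r < d by rewrite r0.
have Dr : D r <= e / 4 / (k * y ^+ 2).
  apply: (@le_trans _ _ (B * (e / ((B + 1) * (k * x ^+ 2 * 4)) * r ^+ 2))).
    by rewrite /B /coef_norm mulr_suml; apply: ler_sum => i _;
       apply: ler_wpM2l; [exact: cmod_ge0|exact: dP].
  have -> : B * (e / ((B + 1) * (k * x ^+ 2 * 4)) * r ^+ 2) =
      B / (B + 1) * (e / 4 / (k * y ^+ 2)).
    rewrite /r; field.
    by rewrite !gt_eqF // ltr_wpDl.
  apply: ler_piMl; last by rewrite ler_pdivrMr ?mul1r ?lerDl // ltr_wpDl.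
  by apply: divr_ge0; [apply: divr_ge0; [exact: ltW|]|apply: mulr_ge0; [exact: ltW|exact: sqr_ge0]].
(* over [K = (n + 1)(m + 1)] further steps, that is a distance of [(m + 1) x],
   boundedness costs [B / (m + 1)] and the defects cost [K (n + 1)] of them *)
have Kn : (n.+1 * m.+1).-1.+1 = (n.+1 * m.+1)%N by rewrite prednK // muln_gt0.
have := nearly_convex_bounded (N := N r) (B := B) (n.+1 * m.+1).-1 n.+1 (D0 r).
rewrite Kn natrM -/k -/y => /(_ (fun j => NB r j (ltW r0)) (fun j => Nc r j (ltW r0))).
have N0 : N r 0%N = besicovitch_norm p (dirichlet_poly a).
  rewrite /N mulr0; congr (besicovitch_norm p _); apply/funext => s.
  by rewrite dirichlet_poly_shift add0r.
have Nn : N r n.+1 = besicovitch_norm p (dirichlet_poly (shift_coef x%:C a)).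
  by rewrite /N rx; reflexivity.
rewrite N0 Nn => NN; apply: (le_trans NN); clear NN N0 Nn.
have -> : y * (B / (y * k) + y * k * D r) = B / k + k * y ^+ 2 * D r.
  by field; rewrite !gt_eqF.
have h : k * y ^+ 2 * D r <= e / 4.
  by rewrite mulrC -ler_pdivlMr // mulr_gt0 // exprn_gt0.
have {}Bm : B / k < e / 2 := Bm.
apply: (le_trans (lerD (ltW Bm) h)); clear -e0; lra.
Qed.

End horizontal_translates.

(** * Carleson inequalities on the completion *)

Section completion.
Context {R : realType}.
Implicit Types (p : R) (a b : seq R[i]) (z : R[i]).
Local Notation bn p a := (besicovitch_norm p (dirichlet_poly a)).

Lemma dirichlet_cauchy_cst p a : 1 <= p -> dirichlet_cauchy p (fun=> a).
Proof.
move=> p1 e e0; exists 0%N => m n _ _; rewrite dirichlet_polyB.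
apply: le_lt_trans e0; apply: besicovitch_norm_le_cst => // t.
by rewrite /imag_mod dirichlet_poly_lin mulN1r subrr cmod0.
Qed.

Definition carleson_poly p (mu : {measure set (borelC R) -> \bar R}) (C : R) : Prop :=
  forall a, (\int[mu]_(s in half_plane) (cmod (dirichlet_poly a s) `^ p)%:E
     <= (C * bn p a `^ p)%:E)%E.

Lemma carleson_dirichlet_poly p mu C : 1 <= p ->
  carleson_dirichlet p mu C -> carleson_poly p mu C.
Proof.
move=> p1 muC a; have := muC (DirichletHardy (dirichlet_cauchy_cst a p1)).
have -> : dh_fun (DirichletHardy (dirichlet_cauchy_cst a p1)) = dirichlet_poly a.
  apply/funext => s; rewrite /dh_fun /=; apply: (@cvg_lim R[i]^o).
    exact: norm_hausdorff.
  exact: cvg_cst.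
suff -> : dh_norm (DirichletHardy (dirichlet_cauchy_cst a p1)) = bn p a by [].
by rewrite /dh_norm /=; apply: (@cvg_lim R); [exact: Rhausdorff|exact: cvg_cst].
Qed.

Lemma besicovitch_norm_dist p a b : 1 <= p ->
  bn p a <= bn p b + bn p (coef_lin (-1) a b).
Proof.
move=> p1; apply: besicovitch_norm_triangle => // t; rewrite /imag_mod.
rewrite dirichlet_poly_lin mulN1r; set x := dirichlet_poly a _; set y := dirichlet_poly b _.
by rewrite -{1}[x](subrK y) addrC cmodD.
Qed.

Lemma dist_lt (x y u v e : R) : x <= y + u -> y <= x + v -> u < e -> v < e ->
  `|x - y| < e.
Proof. by move=> ? ? ? ?; rewrite ltr_norml; apply/andP; split; lra. Qed.

Lemma dh_norm_cvg p (F : dirichlet_hardy p) : 1 <= p ->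
  bn p (dh_approx F n) @[n --> \oo] --> dh_norm F.
Proof.
move=> p1; apply: (@cvgP R); apply/cauchy_cvgP/cauchy_exP => e e0.
have [N NP] := dh_approx_cauchy F e0.
exists (bn p (dh_approx F N)).
have : \forall n \near \oo, `|bn p (dh_approx F N) - bn p (dh_approx F n)| < e.
  exists N => // n /= Nn.
  have := NP N n (leqnn N) Nn; have := NP n N Nn (leqnn N); rewrite !dirichlet_polyB.
  have := besicovitch_norm_dist (dh_approx F N) (dh_approx F n) p1.
  have := besicovitch_norm_dist (dh_approx F n) (dh_approx F N) p1.
  by move=> h1 h2 h3 h4; exact: (dist_lt h2 h1 h4 h3).
by apply: filterS => n; rewrite -ball_normE.
Qed.

Lemma dh_norm_ge0 p (F : dirichlet_hardy p) : 1 <= p -> 0 <= dh_norm F.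
Proof.
move=> p1; apply: (cvgr_to_ge (@dh_norm_cvg p F p1)).
by apply: nearW => n; exact: besicovitch_norm_ge0.
Qed.

Definition point_bounded p z :=
  exists2 C : R, 0 < C & forall a, cmod (dirichlet_poly a z) `^ p <= C * bn p a `^ p.

Lemma dh_fun_cvg p (F : dirichlet_hardy p) z : 1 <= p -> point_bounded p z ->
  (dirichlet_poly (dh_approx F n) z : R[i]^o) @[n --> \oo] --> (dh_fun F z : R[i]^o).
Proof.
move=> p1 [C C0 CP]; have p0 : 0 < p by rewrite (lt_le_trans ltr01).
apply: (@cvgP R[i]^o); apply: ccvg_complete => e e0.
pose k := C `^ p^-1; have k0 : 0 < k by rewrite powR_gt0.
have ek : 0 < e / k by rewrite divr_gt0.
have [N NP] := dh_approx_cauchy F ek; exists N => m n Nm Nn.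
have := NP m n Nm Nn; rewrite dirichlet_polyB; set c := coef_lin _ _ _ => bc.
have -> : dirichlet_poly (dh_approx F m) z - dirichlet_poly (dh_approx F n) z =
    dirichlet_poly c z by rewrite dirichlet_poly_lin mulN1r.
have kp : k `^ p = C by rewrite /k -powRrM mulVf ?powRr1 ?ltW // gt_eqF.
have bc0 := besicovitch_norm_ge0 c p1.
have le1 : cmod (dirichlet_poly c z) <= k * bn p c.
  rewrite leNgt; apply/negP => lt1.
  have := CP c; rewrite -kp -powRM ?(ltW k0) //; rewrite leNgt => /negP; apply.
  by apply: gt0_ltr_powR => //; rewrite nnegrE ?cmod_ge0 // mulr_ge0 // ltW.
by rewrite (le_lt_trans le1) // mulrC -ltr_pdivlMr.
Qed.

Lemma measurable_cmod_powR p (f : R[i] -> R[i]) : 1 <= p -> analytic_on half_plane f ->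
  measurable_fun (half_plane : set (borelC R))
    ((fun s => (cmod (f s) `^ p)%:E) : borelC R -> \bar R).
Proof.
move=> p1 af; apply/measurable_EFinP.
apply: (measurable_fun_borelC half_plane_open) => z hz.
by apply: continuous_cmod_powR p1 _; exact: analytic_ccontC af hz.
Qed.

Lemma measurable_half_plane : measurable (half_plane : set (borelC R)).
Proof. exact: borelC_open half_plane_open. Qed.

(** Fatou's lemma extends a Carleson inequality from Dirichlet polynomials to the
completion, provided that point evaluations are bounded, so that the
polynomials converge pointwise. *)
Lemma carleson_poly_dirichlet p mu C : 1 <= p ->
  (forall z, half_plane z -> point_bounded p z) ->
  carleson_poly p mu C -> carleson_dirichlet p mu C.
Proof.
move=> p1 pb muC F; have p0 : 0 < p by rewrite (lt_le_trans ltr01).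
pose g n (s : borelC R) := (cmod (dirichlet_poly (dh_approx F n) s) `^ p)%:E.
have mg n : measurable_fun (half_plane : set (borelC R)) (g n).
  by apply: measurable_cmod_powR p1 _; exact: analytic_dirichlet_poly.
have g0 n s : half_plane s -> (0 <= g n s)%E by move=> _; rewrite lee_fin powR_ge0.
have := fatou mu measurable_half_plane mg g0.
have -> : (\int[mu]_(s in half_plane) limn_einf (g^~ s) =
    \int[mu]_(s in half_plane) (cmod (dh_fun F s) `^ p)%:E)%E.
  apply: eq_integral => s /set_mem hs.
  suff /cvg_limn_einf_sup[] : g n s @[n --> \oo] --> (cmod (dh_fun F s) `^ p)%:E by [].
  apply: cvg_EFin; first by apply: nearW.
  apply: cvg_powR => //; [by move=> n; exact: cmod_ge0|exact: cmod_ge0|].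
  have /ccvgP H := @dh_fun_cvg p F s p1 (pb s hs).
  apply/cvgrPdist_lt => e e0; apply: filterS (H e e0) => n; apply: le_lt_trans.
  by rewrite distrC cmod_distr.
move=> /le_trans; apply.
apply/lee_addgt0Pr => e e0.
have [N _ NP] : \forall n \near \oo,
    C * bn p (dh_approx F n) `^ p <= C * dh_norm F `^ p + e.
  have : C * bn p (dh_approx F n) `^ p @[n --> \oo] --> C * dh_norm F `^ p.
    apply: (cvgM (f := fun=> C)); first exact: cvg_cst.
    apply: cvg_powR => //; [by move=> n; exact: besicovitch_norm_ge0|exact: dh_norm_ge0|].
    exact: dh_norm_cvg.
  move=> /cvgrPdist_lt /(_ e e0); apply: filterS => n; rewrite distrC => /ltW.
  by rewrite ler_norml => /andP[_]; rewrite lerBlDl.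
rewrite limn_einf_lim; apply: lime_le; first exact: is_cvg_einfs.
exists N => // n /= Nn; apply: (@le_trans _ _ (\int[mu]_(s in half_plane) g n s)%E).
  by apply: ereal_inf_lbound; exists n => //=.
by rewrite (le_trans (muC _)) // -EFinD lee_fin NP.
Qed.

End completion.

(** * From the embedding to local Carleson measures *)

Section bounded_plane_sets.
Context {R : realType}.

Lemma bounded_setC (K : set R[i]^o) :
  bounded_set K <-> exists M : R, forall z, K z -> cmod z <= M.
Proof.
split=> [[M [Mr KM]]|[M KM]].
  have ME : M = (complex.Re M)%:C by apply/esym/RRe_real.
  exists (complex.Re M + 1) => z Kz.
  have : M < (complex.Re M + 1)%:C by rewrite ME ltcR ltrDl.
  move=> /KM KM'; have : (cmod z)%:C <= (complex.Re M + 1)%:C := KM' z Kz.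
  by rewrite lecR.
exists M%:C; split; first by apply/complex_realP; exists M.
move=> x Mx z Kz; apply: le_trans (ltW Mx).
suff : (cmod z)%:C <= M%:C by [].
by rewrite lecR; exact: KM.
Qed.

Lemma cdiscC_open (M : R) : open ([set z | M < cmod z] : set R[i]^o).
Proof.
rewrite openE => z /= Mz; apply/cnbhsP; exists (cmod z - M); first by rewrite subr_gt0.
move=> w wz; have := cmodD (z - w) w; rewrite subrK.
by move: wz Mz; rewrite cmodBC /=; clear => ? ? ?; lra.
Qed.

Lemma msupport_bounded_null (mu : {measure set (borelC R) -> \bar R}) (M : R) :
  (forall z, msupport mu z -> cmod z <= M) -> mu [set z | M < cmod z] = 0%E.
Proof.
move=> sM; apply: msupport_null; first exact: cdiscC_open.
by apply/seteqP; split=> // z [/sM zM /=]; rewrite ltNge zM.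
Qed.

End bounded_plane_sets.

Section local_embedding.
Context {R : realType}.
Local Notation leb := (@lebesgue_measure R).
Implicit Types (p : R) (a : seq R[i]) (x t : R).
Local Notation bn p a := (besicovitch_norm p (dirichlet_poly a)).

(** The rational weight [(s + 1)^-2] makes a Dirichlet polynomial [p]-integrable
on vertical lines, while it is bounded above and below on compact sets. *)
Definition localized a (s : R[i]) := dirichlet_poly a s / (s + 1) / (s + 1).

Lemma localized_analytic a : analytic_on half_plane (localized a).
Proof.
move=> s hs; apply/derivable_cdiff.
have s1 : s != - 1.
  apply/eqP => /(congr1 (@complex.Re R)); rewrite cReN /=.
  by move: hs; rewrite /half_plane /= => ? ?; lra.
have [d dP] : exists d, cdiff (dirichlet_poly a) s d.
  by apply/derivable_cdiff; exact: (@analytic_dirichlet_poly _ a setT s I).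
have [d1 d1P] := cdiff_div s1 dP.
have := cdiff_div s1 d1P; congr (exists d, cdiff _ _ d).
by apply/funext => w; rewrite /localized opprK.
Qed.

Lemma cmod_localized a s : cmod (localized a s) = cmod (dirichlet_poly a s) / cmod (s + 1) ^+ 2.
Proof. by rewrite /localized !cmodM cmodV expr2 invfM mulrA. Qed.

Lemma localized_line_le p a x t : 1 <= p -> 2^-1 < x ->
  cmod (localized a (x +i* t)) `^ p <=
  cmod (dirichlet_poly a (x +i* t)) `^ p / (1 + t ^+ 2).
Proof.
move=> p1 hx; have p0 : 0 < p by rewrite (lt_le_trans ltr01).
set s := x +i* t; pose m := cmod (s + 1) ^+ 2.
have mt : 1 + t ^+ 2 <= m.
  rewrite /m cmod_sqr cReD cImD /= addr0 lerD2r.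
  by rewrite -[X in X <= _](expr1n _ 2) lerXn2r ?nnegrE //; lra.
have t1 : 0 < 1 + t ^+ 2 by rewrite ltr_wpDr // sqr_ge0.
have m1 : 1 <= m by rewrite (le_trans _ mt) // lerDl sqr_ge0.
have m0 : 0 < m by rewrite (lt_le_trans ltr01).
rewrite cmod_localized -/m -[X in X `^ p <= _]mulr1.
have -> : cmod (dirichlet_poly a s) / m * 1 = cmod (dirichlet_poly a s) * m^-1 by rewrite mulr1.
rewrite powRM ?cmod_ge0 ?invr_ge0 ?(ltW m0) //; apply: ler_wpM2l; first exact: powR_ge0.
apply: (@le_trans _ _ m^-1); last by rewrite lef_pV2 // posrE.
by apply: ge1r_powR => //; rewrite invr_gt0 m0 invf_le1.
Qed.

(** Unit intervals at height [n] carry the weight [1 / (1 + n^2)]; the sum of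
these weights is bounded by a telescoping sum. *)
Lemma localized_integral_le p a x (A : R) : 1 <= p -> 0 <= A -> 2^-1 < x ->
  (forall c, \int[leb]_(t in `[c, c + 1])
     cmod (dirichlet_poly a (x +i* t)) `^ p <= A) ->
  (\int[leb]_t (cmod (localized a (x +i* t)) `^ p)%:E <= (6 * A)%:E)%E.
Proof.
move=> p1 A0 hx PA.
pose g t := cmod (localized a (x +i* t)) `^ p.
pose h t := cmod (dirichlet_poly a (x +i* t)) `^ p.
have hp u : half_plane (x +i* u) by exact: hx.
have gc : continuous g := continuous_line_powR p1 (@localized_analytic a) hp.
have hc : continuous h by exact: continuous_dirichlet_powR.
have gi u v : leb.-integrable `[u, v] (EFin \o g).
  by apply: continuous_at_integrable => t _; exact: gc.
have hi u v : leb.-integrable `[u, v] (EFin \o h).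
  by apply: continuous_at_integrable => t _; exact: hc.
have gh t : g t <= h t / (1 + t ^+ 2) by exact: localized_line_le.
have piece (n : nat) c : (forall t, c <= t <= c + 1 -> n%:R ^+ 2 <= t ^+ 2) ->
    \int[leb]_(t in `[c, c + 1]) g t <= A / (1 + n%:R ^+ 2).
  move=> nt; have n0 : 0 < 1 + n%:R ^+ 2 :> R by rewrite ltr_wpDr // sqr_ge0.
  apply: (@le_trans _ _ (\int[leb]_(t in `[c, c + 1]) ((1 + n%:R ^+ 2)^-1 * h t))).
    apply: le_Rintegral; [exact: measurable_itv|exact: gi|exact: integrableZl (hi _ _)|].
    move=> t /=; rewrite in_itv /= => /nt ct; apply: (le_trans (gh t)).
    rewrite mulrC; apply: ler_wpM2r; first exact: powR_ge0.
    by rewrite lef_pV2 ?posrE ?lerD2l // ltr_wpDr // sqr_ge0.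
  rewrite RintegralZl; [|exact: measurable_itv|exact: hi].
  by rewrite mulrC ler_wpM2r ?PA // invr_ge0 ltW.
pose J (n : nat) := \int[leb]_(t in `[- n%:R, n%:R]) g t.
have JS n : J n.+1 <= J n + 2 * (A / (1 + n%:R ^+ 2)).
  have n1 : n.+1%:R = n%:R + 1 :> R by rewrite natr1.
  have e1 : - n.+1%:R <= - n%:R :> R by rewrite lerN2 ler_nat.
  have e2 : n%:R <= n.+1%:R :> R by rewrite ler_nat.
  have e3 : - n%:R <= n%:R :> R by rewrite ge0_cp.
  rewrite /J (Rintegral_split e1 (le_trans e3 e2) (gi _ _)).
  rewrite (Rintegral_split e3 e2 (gi _ _)).
  have p2 : \int[leb]_(t in `[n%:R, n.+1%:R]) g t <= A / (1 + n%:R ^+ 2).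
    by rewrite n1; apply: piece => t /andP[t1 _]; rewrite lerXn2r // nnegrE // (le_trans _ t1).
  have p3 : \int[leb]_(t in `[- n.+1%:R, - n%:R]) g t <= A / (1 + n%:R ^+ 2).
    have -> : - n%:R = - n.+1%:R + 1 :> R by rewrite n1 opprD subrK.
    apply: piece => t /andP[_ t1]; rewrite -[t ^+ 2]sqrrN lerXn2r // ?nnegrE //.
      by move: t1; rewrite n1 opprD subrK lerNr => t1; rewrite (le_trans _ t1).
    by move: t1; rewrite n1 opprD subrK lerNr.
  clear -p2 p3; lra.
(* [1 / (1 + k^2) <= 3 / ((k + 1) (k + 2))], which telescopes *)
have JA n : J n <= 2 * A * (3 - 3 / n.+1%:R).
  elim: n => [|n IH].
    rewrite /J oppr0 set_itv1 Rintegral_set1 divr1 subrr mulr0 //.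
  apply: (le_trans (JS n)).
  suff : 2 * (A / (1 + n%:R ^+ 2)) <= 2 * A * (3 / n.+1%:R - 3 / n.+2%:R).
    move: IH; set u := 3 / n.+1%:R; set v := 3 / n.+2%:R => IH h'.
    have -> : 2 * A * (3 - v) = 2 * A * (3 - u) + 2 * A * (u - v) by ring.
    exact: lerD.
  rewrite mulrA; apply: ler_wpM2l; first by rewrite mulr_ge0.
  have n0 : 0 <= n%:R :> R by [].
  rewrite -[n.+2%:R]natr1 -[n.+1%:R]natr1; set k := n%:R in n0 *.
  have k1 : 0 < k + 1 by rewrite ltr_wpDl.
  have k2 : 0 < k + 1 + 1 by rewrite ltr_wpDl // ltW.
  have -> : 3 / (k + 1) - 3 / (k + 1 + 1) = 3 / ((k + 1) * (k + 1 + 1)).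
    by field; rewrite !gt_eqF.
  have q0 : 0 < 1 + k ^+ 2 by rewrite ltr_wpDr // sqr_ge0.
  rewrite ler_pdivlMr ?mulr_gt0 // mulrC ler_pdivrMr //.
  (* the difference of the two sides is (2 k - 1) (k - 1), nonnegative at integers *)
  suff : 0 <= (2 * k - 1) * (k - 1) by rewrite expr2 => ?; nra.
  rewrite /k; case: n {IH n0 k1 k2 q0 k} => [|n].
    by rewrite mulr0 !sub0r mulrNN mulr1.
  by rewrite -natr1; have : 0 <= n%:R :> R by []; move=> ?; apply: mulr_ge0; lra.
have J6 n : J n <= 6 * A.
  apply: (le_trans (JA n)).
  have -> : 6 * A = 2 * A * 3 by ring.
  by rewrite ler_wpM2l ?mulr_ge0 // lerBlDr lerDl divr_ge0.
have : (\int[leb]_(t in `[(- n%:R)%R, n%:R%R]) (g t)%:E)%E @[n --> \oo] -->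
    (\int[leb]_t (g t)%:E)%E.
  rewrite -(bigcup_itvT true false).
  apply: ge0_nondecreasing_set_cvg_integral.
  - move=> m n mn; apply/subsetPset/subset_itv; rewrite bnd_simp ?lerN2 ler_nat //.
  - by move=> n; exact: measurable_itv.
  - by move=> n; exact: (measurable_int leb (gi _ _)).
  - by move=> n t _; rewrite lee_fin powR_ge0.
move=> cv; rewrite -(cvg_lim _ cv) //; apply: lime_le; first by apply/cvg_ex; eexists; exact: cv.
apply: nearW => n; have := J6 n; rewrite -lee_fin /J /Rintegral fineK //.
by apply: integrable_fin_num => //; exact: gi.
Qed.

End local_embedding.

Section local_embedding_carleson.
Context {R : realType}.
Local Notation leb := (@lebesgue_measure R).
Implicit Types (p : R) (a : seq R[i]) (x t : R) (mu : {measure set (borelC R) -> \bar R}).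
Local Notation bn p a := (besicovitch_norm p (dirichlet_poly a)).

Lemma powR_cmod_localized p a (s : R[i]) (M : R) : 0 <= p -> half_plane s -> cmod s <= M ->
  cmod (dirichlet_poly a s) `^ p <= ((M + 1) ^+ 2) `^ p * cmod (localized a s) `^ p.
Proof.
move=> p0 hs sM; have M0 : 0 <= M + 1.
  by rewrite addr_ge0 // (le_trans (cmod_ge0 s)).
rewrite -powRM ?cmod_ge0 ?sqr_ge0 //.
apply: ge0_ler_powR; rewrite ?nnegrE ?cmod_ge0 ?mulr_ge0 ?sqr_ge0 ?cmod_ge0 //.
have s1 : 0 < cmod (s + 1).
  apply: lt_le_trans (Re_le_cmod _); rewrite cReD /= ger0_norm.
    by move: hs; rewrite /half_plane /= => ?; lra.
  by move: hs; rewrite /half_plane /= => ?; lra.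
have sM1 : cmod (s + 1) <= M + 1.
  by apply: (le_trans (cmodD _ _)); rewrite lerD // cmod_real normr1.
have s2 : 0 < cmod (s + 1) ^+ 2 by rewrite exprn_gt0.
rewrite cmod_localized mulrA ler_pdivlMr // mulrC.
apply: ler_wpM2r; first exact: cmod_ge0.
by rewrite lerXn2r // nnegrE ?(ltW s1) // (le_trans (ltW s1)).
Qed.

(** By contractivity of translations to the right, the embedding on the boundary
line holds on all lines in the half-plane, and on a bounded set the modulus of a
Dirichlet polynomial is comparable to that of a function in the Hardy space. *)
Lemma local_carleson_poly p (C1 Cmu : R) mu : 1 <= p -> 0 < C1 ->
  (forall a c, \int[leb]_(t in `[c, c + 1]) cmod (dirichlet_poly a (2^-1 +i* t)) `^ p
     <= C1 * bn p a `^ p) ->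
  local_measure mu -> 0 < Cmu -> carleson_hardy p mu Cmu ->
  exists2 C : R, 0 < C & carleson_poly p mu C.
Proof.
move=> p1 C0 H1 /bounded_setC[M0 muM0] Cmu0 muC.
have p0 : 0 < p by rewrite (lt_le_trans ltr01).
pose M := Num.max M0 0.
have muM z : msupport mu z -> cmod z <= M by move=> /muM0; rewrite le_max => ->.
have M1 : 0 < M + 1 by rewrite ltr_wpDl // le_max lexx orbT.
pose k := ((M + 1) ^+ 2) `^ p.
have k0 : 0 < k by rewrite powR_gt0 // exprn_gt0.
exists (k * (Cmu * (6 * C1))); first by rewrite !mulr_gt0.
move=> a; set B := bn p a `^ p.
have B0 : 0 <= B by exact: powR_ge0.
have CB0 : 0 <= C1 * B by rewrite mulr_ge0 // ltW.
have lineA x : 2^-1 < x ->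
    (\int[leb]_t (cmod (localized a (x +i* t)) `^ p)%:E <= (6 * (C1 * B))%:E)%E.
  move=> hx; apply: localized_integral_le => // c.
  have d0 : 0 <= x - 2^-1 by rewrite subr_ge0 ltW.
  have := H1 (shift_coef (x - 2^-1)%:C a) c.
  under eq_Rintegral do rewrite dirichlet_poly_shift.
  have E t : (x - 2^-1)%:C + (2^-1 +i* t) = x +i* t.
    by apply: complex_ext; rewrite ?cReD ?cImD /= ?subrK ?add0r.
  under eq_Rintegral do rewrite E.
  move=> /le_trans; apply; apply: ler_wpM2l; first exact: ltW.
  apply: ge0_ler_powR.
  - exact: ltW.
  - by rewrite nnegrE; exact: besicovitch_norm_ge0.
  - by rewrite nnegrE; exact: besicovitch_norm_ge0.
  - exact: besicovitch_norm_shift_real.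
have A0 : 0 <= 6 * (C1 * B) by rewrite mulr_ge0.
have hn : ((hardy_norm p (localized a)) `^ p <= (6 * (C1 * B))%:E)%E.
  exact: hardy_norm_powR_le p0 A0 lineA.
have hl : hardy p (localized a).
  split; first exact: localized_analytic.
  rewrite ltNge leye_eq; apply/negP => /eqP E; move: hn.
  by rewrite E poweRyr ?gt_eqF // leye_eq.
have mP : measurable_fun (half_plane : set (borelC R))
    ((fun s => (cmod (dirichlet_poly a s) `^ p)%:E) : borelC R -> \bar R).
  by apply: measurable_cmod_powR p1 _; exact: analytic_dirichlet_poly.
have mL : measurable_fun (half_plane : set (borelC R))
    ((fun s => (cmod (localized a s) `^ p)%:E) : borelC R -> \bar R).
  by apply: measurable_cmod_powR p1 _; exact: localized_analytic.
have -> : k * (Cmu * (6 * C1)) * B = k * (Cmu * (6 * (C1 * B))) by rewrite -!mulrA.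
rewrite EFinM [X in (_ <= _ * X)%E]EFinM.
apply: (@le_trans _ _ (k%:E * \int[mu]_(s in half_plane) (cmod (localized a s) `^ p)%:E)%E);
  last first.
  apply: lee_wpmul2l; first by rewrite lee_fin ltW.
  apply: (le_trans (muC _ hl)); apply: lee_wpmul2l => //; by rewrite lee_fin ltW.
rewrite -ge0_integralZl //; first last.
- by rewrite lee_fin ltW.
- by move=> s _; rewrite lee_fin powR_ge0.
- exact: measurable_half_plane.
apply: ae_ge0_le_integral.
- exact: measurable_half_plane.
- by move=> s _; rewrite lee_fin powR_ge0.
- exact: mP.
- by move=> s _; rewrite mule_ge0 // lee_fin ?powR_ge0 // ltW.
- by apply: measurable_funeM; exact: mL.
have mN := borelC_open (@cdiscC_open R M).
exists [set z : R[i] | M < cmod z]; split.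
- exact: mN.
- exact: msupport_bounded_null muM.
move=> s /= sP; rewrite ltNge; apply/negP => sM; apply: sP => hs.
by rewrite -EFinM lee_fin; apply: powR_cmod_localized; rewrite ?(ltW p0).
Qed.

End local_embedding_carleson.

(** * Measures on equally spaced points *)

Section combs.
Context {R : realType}.
Local Notation leb := (@lebesgue_measure R).
Implicit Types (p : R) (a : seq R[i]) (x t c : R) (n : nat) (w : {nonneg R})
  (mu : {measure set (borelC R) -> \bar R}).

(** At the distance [w / 2] of the boundary line the weight [2 Re s - 1] equals the
gap [w], so that the weighted sums are Riemann sums. *)
Definition comb_point (w c : R) (j : nat) : R[i] := (2^-1 + w / 2) +i* (w * j%:R + c).

Definition comb w c n : {measure set (borelC R) -> \bar R} :=
  msum (fun j => mscale w (dirac (comb_point w%:num c j : borelC R))) n.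

Lemma comb_point_half_plane (w c : R) j : 0 < w -> half_plane (comb_point w c j).
Proof. by move=> w0; rewrite /half_plane /= ltrDl divr_gt0. Qed.

Lemma combE w c n (A : set (borelC R)) :
  comb w c n A = (\sum_(j < n) w%:num%:E * \d_(comb_point w%:num c j : borelC R) A)%E.
Proof. by []. Qed.

Lemma comb_null w c n (A : set (borelC R)) :
  (forall j, (j < n)%N -> ~ A (comb_point w%:num c j)) -> comb w c n A = 0%E.
Proof.
move=> nA; rewrite combE big1 // => j _; rewrite diracE memNset ?mule0 //.
exact: nA.
Qed.

Lemma comb_on_half_plane w c n : 0 < w%:num -> on_half_plane (comb w c n).
Proof.
move=> w0; apply: comb_null => j _; apply; exact: comb_point_half_plane.
Qed.

Lemma msupport_comb w c n (M : R) :
  (forall j, (j < n)%N -> cmod (comb_point w%:num c j) <= M) ->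
  msupport (comb w c n) `<=` [set z | cmod z <= M].
Proof.
move=> nM z /= zs; rewrite leNgt; apply/negP => Mz.
have := zs _ (@cdiscC_open R M) Mz; rewrite comb_null ?ltxx // => j /nM /=.
by rewrite leNgt => /negP.
Qed.

Lemma comb_local w c n : local_measure (comb w c n).
Proof.
apply/bounded_setC; exists (\sum_(j < n) cmod (comb_point w%:num c j)).
apply: msupport_comb => j jn; rewrite (bigD1 (Ordinal jn)) // lerDl.
by apply: sumr_ge0 => i _; exact: cmod_ge0.
Qed.

Lemma integral_comb w c n (f : borelC R -> \bar R) : 0 < w%:num ->
  measurable_fun (half_plane : set (borelC R)) f ->
  (forall s, half_plane s -> (0 <= f s)%E) ->
  (\int[comb w c n]_(s in half_plane) f s =
   \sum_(j < n) w%:num%:E * f (comb_point w%:num c j))%E.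
Proof.
move=> w0 mf f0; rewrite /comb ge0_integral_measure_sum //; last exact: measurable_half_plane.
apply: eq_bigr => j _; rewrite ge0_integral_mscale //; last exact: measurable_half_plane.
rewrite integral_dirac //; last exact: measurable_half_plane.
rewrite diracE mem_set ?mul1e //; exact: comb_point_half_plane.
Qed.

Lemma comb_weighted_dirac_sum w c n :
  weighted_dirac_sum `I_n (comb_point w%:num c) (comb w c n).
Proof.
move=> A mA; rewrite combE esum_fset; last 2 first.
- exact: finite_II.
- move=> j _; rewrite mule_ge0 // lee_fin /=.
  have -> : 2 * (2^-1 + w%:num / 2) - 1 = w%:num by field.
  exact: ge0.
rewrite -fsbig_ord; apply: eq_bigr => j _; congr (_%:E * _)%E => /=.
by field.
Qed.

(** By the sub-mean-value property, the sum over a comb is controlled by area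
integrals over disjoint squares. *)
Lemma comb_carleson p w c n : 1 <= p -> 0 < w%:num ->
  carleson_hardy p (comb w c n) (16 * 48 `^ p).
Proof.
move=> p1 w0 f [af ff]; have p0 : 0 < p by rewrite (lt_le_trans ltr01).
rewrite integral_comb //; last 2 first.
- exact: measurable_cmod_powR.
- by move=> s _; rewrite lee_fin powR_ge0.
have hn0 : (0 <= hardy_norm p f)%E by exact: hardy_norm_ge0.
have hfin : (hardy_norm p f `^ p)%E \is a fin_num.
  by move: ff hn0; case: (hardy_norm p f) => [r| |] //=; rewrite poweR_EFin.
set m := fine (hardy_norm p f `^ p)%E.
have mE : (hardy_norm p f `^ p)%E = m%:E by rewrite fineK.
under eq_bigr do rewrite -EFinM.
rewrite mE -EFinM sumEFin lee_fin.
pose r := w%:num / 4; have r0 : 0 < r by rewrite divr_gt0.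
have hx : 2^-1 < 2^-1 + w%:num / 2 - r by rewrite /r; lra.
have line x : 2^-1 < x -> (\int[leb]_t (cmod (f (x +i* t)) `^ p)%:E <= m%:E)%E.
  by move=> xx; rewrite -mE; exact: hardy_line_le.
have := lattice_carleson c n p1 r0 hx af line.
have -> : 4 * r = w%:num by rewrite /r; field.
have [k ->] : exists k : R, 48 = k by exists 48.
rewrite big_mkord => H.
have -> : 16 * k `^ p * m = 4 * (4 * k `^ p * m) by ring.
suff -> : \sum_(j < n) w%:num * cmod (f (comb_point w%:num c j)) `^ p =
    4 * \sum_(j < n) r * cmod (f ((2^-1 + w%:num / 2) +i* (w%:num * j%:R + c))) `^ p.
  by rewrite ler_pM2l.
rewrite mulr_sumr; apply: eq_bigr => j _; rewrite mulrA; congr (_ * _).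
by rewrite /r; field.
Qed.

End combs.

(** * The equivalence *)

Section implications.
Context {R : realType}.
Local Notation leb := (@lebesgue_measure R).
Implicit Types (p : R) (a : seq R[i]) (x t c : R) (n : nat) 
  (mu : {measure set (borelC R) -> \bar R}).
Local Notation bn p a := (besicovitch_norm p (dirichlet_poly a)).

Definition local_embedding p := forall len : R, exists C : R, 0 < C /\
  forall I : set R, is_interval I -> bounded_set I ->
    lebesgue_measure I = len%:E ->
    forall a, (\int[leb]_(t in I) (cmod (dirichlet_poly a (2^-1 +i* t)) `^ p)%:E
      <= (C * bn p a `^ p)%:E)%E.

Definition carleson_transfer p := forall mu,
  on_half_plane mu -> local_measure mu ->
  (exists C : R, 0 < C /\ carleson_hardy p mu C) ->
  exists C : R, 0 < C /\ carleson_dirichlet p mu C.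

Definition uniform_dirac_transfer p := forall K : set R[i]^o, bounded_set K ->
  exists D : R, 0 < D /\ forall (J : set nat) (s : nat -> R[i]) mu (C : R),
    (forall n, J n -> half_plane (s n)) -> weighted_dirac_sum J s mu ->
    msupport mu `<=` K -> 0 < C -> carleson_hardy p mu C ->
    carleson_dirichlet p mu (C * D).

(** Point masses are local Carleson measures, so that transferring Carleson
measures bounds point evaluations. *)
Lemma transfer_point_bounded p : 1 <= p ->
  (forall mu, on_half_plane mu -> local_measure mu ->
     (exists C : R, 0 < C /\ carleson_hardy p mu C) ->
     exists2 C : R, 0 < C & carleson_poly p mu C) ->
  forall z, half_plane z -> point_bounded p z.
Proof.
move=> p1 tr z hz.
have w0 : 0 < 2 * complex.Re z - 1 by move: hz; rewrite /half_plane /= => ?; lra.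
pose w := NngNum (ltW w0); have w1 : 0 < w%:num by exact: w0.
have C16 : 0 < 16 * 48 `^ p :> R by rewrite mulr_gt0 // powR_gt0.
have [C C0 CP] := tr (comb w (complex.Im z) 1) (comb_on_half_plane _ _ w1)
  (comb_local _ _ _) (ex_intro _ _ (conj C16 (comb_carleson _ _ p1 w1))).
exists (C / (2 * complex.Re z - 1)); first by rewrite divr_gt0.
move=> a; have := CP a; rewrite integral_comb //; last 2 first.
- by apply: measurable_cmod_powR p1 _; exact: analytic_dirichlet_poly.
- by move=> s _; rewrite lee_fin powR_ge0.
rewrite big_ord_recl big_ord0 adde0 -EFinM lee_fin.
have -> : comb_point w%:num (complex.Im z) (ord0 : 'I_1) = z.
  by apply: complex_ext => /=; [field|rewrite mulr0 add0r].
by move=> H; rewrite mulrAC ler_pdivlMr // mulrC.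
Qed.

Lemma local_embedding_poly_transfer p mu : 1 <= p -> local_embedding p ->
  local_measure mu -> (exists C : R, 0 < C /\ carleson_hardy p mu C) ->
  exists2 C : R, 0 < C & carleson_poly p mu C.
Proof.
move=> p1 /(_ 1)[C1 [C10 H1]] lmu [Cmu [Cmu0 muC]].
apply: (local_carleson_poly p1 C10 _ lmu Cmu0 muC) => a c.
have hc : continuous (fun t => cmod (dirichlet_poly a (2^-1 +i* t)) `^ p) by exact: continuous_dirichlet_powR.
have hi : leb.-integrable `[c, c + 1]
    (EFin \o (fun t => cmod (dirichlet_poly a (2^-1 +i* t)) `^ p)).
  by apply: continuous_at_integrable => t _; exact: hc.
have := H1 [set` `[c, c + 1]] (@interval_is_interval R `[c, c + 1]) _ _ a.
rewrite -lee_fin /Rintegral fineK; last exact: integrable_fin_num.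
apply.
- exact/compact_bounded/segment_compact.
- by rewrite lebesgue_measure_cc ?lerDl // addrAC subrr add0r.
Qed.

Lemma local_embedding_carleson_transfer p : 1 <= p ->
  local_embedding p -> carleson_transfer p.
Proof.
move=> p1 le.
have pt mu : on_half_plane mu -> local_measure mu ->
     (exists C : R, 0 < C /\ carleson_hardy p mu C) ->
     exists2 C : R, 0 < C & carleson_poly p mu C.
  by move=> _; exact: local_embedding_poly_transfer.
move=> mu hmu lmu muC; have [C C0 CP] := pt mu hmu lmu muC.
exists C; split=> //; apply: (carleson_poly_dirichlet p1 _ CP).
exact: (transfer_point_bounded p1 pt).
Qed.

Lemma weighted_dirac_sum_null (J : set nat) (s : nat -> R[i]) mu (A : set (borelC R)) :
  weighted_dirac_sum J s mu -> measurable A -> (forall n, J n -> ~ A (s n)) ->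
  mu A = 0%E.
Proof.
move=> muJ mA nA; rewrite muJ // esum1 // => n Jn.
by rewrite diracE memNset ?mule0 //; exact: nA.
Qed.

(** If no constant served for all point-mass measures, suitably weighted
counterexamples could be summed to a single local Carleson measure violating the
transfer. *)
Lemma carleson_transfer_uniform_dirac p : 1 <= p ->
  carleson_transfer p -> uniform_dirac_transfer p.
Proof.
move=> p1 tr K /bounded_setC[M KM]; apply: contrapT => nD.
have pb z : half_plane z -> point_bounded p z.
  apply: (transfer_point_bounded p1 _) => mu hmu lmu muC.
  have [C [C0 CP]] := tr mu hmu lmu muC.
  by exists C => //; exact: carleson_dirichlet_poly.
pose bad (k : nat) (x : {measure set (borelC R) -> \bar R} * R) :=
  [/\ on_half_plane x.1, msupport x.1 `<=` K, 0 < x.2, carleson_hardy p x.1 x.2 &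
     ~ carleson_dirichlet p x.1 (x.2 * 4 ^+ k)].
have [x xP] : exists x : nat -> {measure set (borelC R) -> \bar R} * R,
    forall k, bad k (x k).
  suff /choice[x xP] : forall k, exists y, bad k y by exists x.
  move=> k; apply: contrapT => nk; apply: nD; exists (4 ^+ k); split.
    by rewrite exprn_gt0.
  move=> J s mu C sJ muJ muK C0 muC; apply: contrapT => nC.
  apply: nk; exists (mu, C); split=> //.
  apply: (weighted_dirac_sum_null muJ); first by apply: measurableC; exact: (@measurable_half_plane R).
  by move=> n /sJ sn; apply.
pose m k := (x k).1; pose C k := (x k).2.
have C0 k : 0 < C k by case: (xP k).
have w0 k : 0 <= (2 ^+ k)^-1 / C k by rewrite divr_ge0 ?invr_ge0 ?exprn_ge0 ?(ltW (C0 k)).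
pose mw k : {measure set (borelC R) -> \bar R} := mscale (NngNum (w0 k)) (m k).
pose mu : {measure set (borelC R) -> \bar R} := mseries mw 0.
have mu0 A : (forall k, m k A = 0%E) -> mu A = 0%E.
  by move=> mA; apply: eseries0 => k _ _; rewrite /mw /= /mscale /= mA mule0.
have hmu : on_half_plane mu by apply: mu0 => k; case: (xP k).
have lmu : local_measure mu.
  apply/bounded_setC; exists M => z /= zs; rewrite leNgt; apply/negP => Mz.
  have := zs _ (@cdiscC_open R M) Mz; rewrite mu0 ?ltxx // => k.
  by apply: msupport_bounded_null => v vs; apply: KM; case: (xP k) => _ + _ _ _; apply.
have intmu (f : borelC R -> \bar R) : measurable_fun (half_plane : set (borelC R)) f ->
    (forall s, half_plane s -> (0 <= f s)%E) ->
    (\int[mu]_(s in half_plane) f s =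
     \sum_(k <oo) ((2 ^+ k)^-1 / C k)%:E * \int[m k]_(s in half_plane) f s)%E.
  move=> mf f0; rewrite ge0_integral_measure_series //; last exact: measurable_half_plane.
  apply: eq_eseriesr => k _; rewrite ge0_integral_mscale //; exact: measurable_half_plane.
have muC : carleson_hardy p mu 2.
  move=> f [af ff]; rewrite intmu; last 2 first.
  - exact: measurable_cmod_powR.
  - by move=> s _; rewrite lee_fin powR_ge0.
  apply: lime_le.
    apply: is_cvg_nneseries => k _ _; apply: mule_ge0; first by rewrite lee_fin.
    by apply: integral_ge0 => s _; rewrite lee_fin powR_ge0.
  apply: nearW => n; set H := (hardy_norm p f `^ p)%E.
  apply: (@le_trans _ _ (\sum_(0 <= k < n) ((2 ^+ k)^-1)%:E * H)%E).
    apply: lee_sum => k _; have [_ _ _ /(_ f (conj af ff)) kC _] := xP k.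
    rewrite EFinM -muleA; apply: lee_wpmul2l; first by rewrite lee_fin invr_ge0 exprn_ge0.
    apply: (@le_trans _ _ ((C k)^-1%:E * ((C k)%:E * H))%E).
      by apply: lee_wpmul2l kC; rewrite lee_fin invr_ge0 (ltW (C0 k)).
    by rewrite muleA -EFinM mulVf ?mul1e // gt_eqF.
  rewrite -ge0_sume_distrl; last by move=> k _; rewrite lee_fin invr_ge0 exprn_ge0.
  apply: lee_wpmul2r; first exact: poweR_ge0.
  rewrite sumEFin lee_fin.
  have -> : \sum_(0 <= k < n) (2 ^+ k)^-1 = 2 - 2 / 2 ^+ n :> R.
    elim: n => [|n IH]; first by rewrite big_nil expr0 divr1 subrr.
    by rewrite big_nat_recr // IH exprS /=; field; rewrite expf_neq0.
  by rewrite lerBlDr lerDl divr_ge0 // exprn_ge0.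
have [C' [C'0 CP']] := tr mu hmu lmu (ex_intro _ 2 (conj (ltr0Sn _ 1) muC)).
have mk k : carleson_poly p (m k) (C' * (C k * 2 ^+ k)).
  move=> a; have := carleson_dirichlet_poly p1 CP' a; rewrite intmu; last 2 first.
  - by apply: measurable_cmod_powR p1 _; exact: analytic_dirichlet_poly.
  - by move=> s _; rewrite lee_fin powR_ge0.
  set I := (X in (limn X <= _)%E -> _) => H.
  have I1 : (((2 ^+ k)^-1 / C k)%:E * \int[m k]_(s in half_plane)
      (cmod (dirichlet_poly a s) `^ p)%:E <= (C' * bn p a `^ p)%:E)%E.
    apply: le_trans H; have := @nneseries_lim_ge R (fun k => (((2 ^+ k)^-1 / C k)%:E *
      \int[m k]_(s in half_plane) (cmod (dirichlet_poly a s) `^ p)%:E)%E) xpredT 0 k.+1.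
    have g0 n : (0 <= ((2 ^+ n)^-1 / C n)%:E *
        \int[m n]_(s in half_plane) (cmod (dirichlet_poly a s) `^ p)%:E)%E.
      apply: mule_ge0; first by rewrite lee_fin.
      by apply: integral_ge0 => s _; rewrite lee_fin powR_ge0.
    move=> /(_ (fun n _ _ => g0 n)); apply: le_trans.
    by rewrite big_nat_recr // leeDr //; apply: sume_ge0 => n _; exact: g0.
  have k0 : 0 < C k * 2 ^+ k by rewrite mulr_gt0 // exprn_gt0.
  have -> : C' * (C k * 2 ^+ k) * bn p a `^ p = (C k * 2 ^+ k) * (C' * bn p a `^ p) by ring.
  rewrite EFinM -lee_pdivrMl // muleC; apply: le_trans I1.
  by rewrite muleC invfM mulrC.
have [k kP] : exists k : nat, C' <= 2 ^+ k.
  exists (Num.truncn C').+1.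
  rewrite (le_trans (ltW (Num.Theory.truncnS_gt _))) // -natrX ler_nat.
  by rewrite ltnW // ltn_expl.
have [_ _ _ _] := xP k; apply; apply: (carleson_poly_dirichlet p1 pb) => a.
apply: (le_trans (mk k a)); rewrite lee_fin; apply: ler_wpM2r; first exact: powR_ge0.
rewrite mulrCA; apply: ler_wpM2l; first exact: (ltW (C0 k)).
have -> : 4 = 2 * 2 :> R by ring.
by rewrite exprMn; apply: ler_wpM2r kP; rewrite exprn_ge0.
Qed.

End implications.

Section uniform_dirac_embedding.
Context {R : realType}.
Local Notation leb := (@lebesgue_measure R).
Implicit Types (p : R) (a : seq R[i]) (x t c : R) (n : nat)
  (mu : {measure set (borelC R) -> \bar R}).
Local Notation bn p a := (besicovitch_norm p (dirichlet_poly a)).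

Lemma powRD_le p (x y : R) : 0 <= p -> 0 <= x -> 0 <= y ->
  (x + y) `^ p <= 2 `^ p * (x `^ p + y `^ p).
Proof.
move=> p0; wlog xy : x y / x <= y => [H x0 y0|x0 y0].
  have [xy|/ltW yx] := leP x y; first exact: H.
  by rewrite addrC [X in _ * X]addrC; exact: H.
apply: (@le_trans _ _ (2 `^ p * y `^ p)).
  rewrite -powRM //; apply: ge0_ler_powR; rewrite ?nnegrE ?addr_ge0 ?mulr_ge0 //.
  by rewrite mulr_natl mulr2n lerD2r.
by rewrite ler_wpM2l ?powR_ge0 // lerDr powR_ge0.
Qed.

(** Along the comb points the sums are Riemann sums of the integral on a line close
to the boundary; as the gap tends to zero they reach the boundary integral, by
uniform continuity. The factor [2^p] is lost in comparing powers. *)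
Lemma comb_bound_line_integral p a (L A : R) : 1 <= p -> 0 < L -> 0 <= A ->
  (forall n, L / n.+1%:R <= 1 -> \sum_(j < n.+1) L / n.+1%:R *
     cmod (dirichlet_poly a (comb_point (L / n.+1%:R) 0 j)) `^ p <= A) ->
  \int[leb]_(t in `[0, L]) cmod (dirichlet_poly a (2^-1 +i* t)) `^ p <= 2 `^ p * A.
Proof.
move=> p1 L0 A0 HA; have p0 : 0 < p by rewrite (lt_le_trans ltr01).
pose h t := cmod (dirichlet_poly a (2^-1 +i* t)) `^ p.
have hc : continuous h by exact: continuous_dirichlet_powR.
have hi u v : leb.-integrable `[u, v] (EFin \o h).
  by apply: continuous_at_integrable => t _; exact: hc.
have q0 : 0 < 2 `^ p :> R by rewrite powR_gt0.
apply/ler_addgt0Pr => e e0.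
have e1 : 0 < e / (2 `^ p * L) by rewrite divr_gt0 ?mulr_gt0.
pose eta := (e / (2 `^ p * L)) `^ p^-1.
have eta0 : 0 < eta by rewrite powR_gt0.
have etap : eta `^ p = e / (2 `^ p * L) by rewrite /eta -powRrM mulVf ?powRr1 ?ltW // gt_eqF.
have [d d0 dP] := dirichlet_poly_unif_cont a eta0.
have [n nd] := @exists_div_natS_lt R (2 * L) (Num.min d 1) ltac:(by rewrite lt_min d0 ltr01).
pose w := L / n.+1%:R; have w0 : 0 < w by rewrite divr_gt0.
have wd : 2 * w < d by move: nd; rewrite lt_min -mulrA => /andP[].
have w1 : w <= 1.
  have : 2 * w < 1 by move: nd; rewrite lt_min -mulrA => /andP[].
  by move: w0; clear => ? ?; lra.
pose z j := comb_point w 0 j.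
have piece j : \int[leb]_(t in `[w * j%:R, w * j.+1%:R]) h t <=
    2 `^ p * (w * cmod (dirichlet_poly a (z j)) `^ p) + w * (e / L).
  have wj : w * j%:R <= w * j.+1%:R by rewrite ler_pM2l // ler_nat.
  have -> : 2 `^ p * (w * cmod (dirichlet_poly a (z j)) `^ p) + w * (e / L) =
      (2 `^ p * (cmod (dirichlet_poly a (z j)) `^ p + eta `^ p)) * (w * j.+1%:R - w * j%:R).
    by rewrite etap -natr1; field; rewrite !gt_eqF.
  rewrite -lee_fin /Rintegral fineK; last exact: integrable_fin_num.
  rewrite -integral_itv_cst //; apply: ge0_le_integral.
  - exact: measurable_itv.
  - by move=> t _; rewrite lee_fin powR_ge0.
  - exact: measurable_int (hi _ _).
  - exact: measurable_cst.
  move=> t /=; rewrite in_itv /= => /andP[t1 t2]; rewrite lee_fin.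
  apply: (le_trans _ (powRD_le (ltW p0) (cmod_ge0 _) (ltW eta0))).
  apply: ge0_ler_powR; rewrite ?nnegrE ?cmod_ge0 ?addr_ge0 ?cmod_ge0 ?(ltW p0) ?(ltW eta0) //.
  pose g := z j - (2^-1 +i* t).
  have gE : z j = (2^-1 +i* t) + g by rewrite /g addrC subrK.
  have gd : cmod g < d.
    apply: le_lt_trans wd; apply: (le_trans (cmod_le _)).
    have -> : complex.Re g = w / 2 by rewrite /g cReD cReN /=; ring.
    have -> : complex.Im g = w * j%:R - t by rewrite /g cImD cImN /=; ring.
    rewrite (ger0_norm (divr_ge0 (ltW w0) (ler0n _ 2))) ler0_norm ?subr_le0 //.
    rewrite opprB; move: t2; rewrite -natr1 mulrDr mulr1.
    by move: w0; clear; set u := w * j%:R => ? ?; lra.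
  have g0 : 0 <= complex.Re (2^-1 +i* t : R[i]) by rewrite /= invr_ge0.
  have := dP _ g g0 gd; rewrite -gE => H.
  rewrite -lerBlDl; apply: le_trans H; apply: (le_trans (ler_norm _)).
  by rewrite distrC cmod_distr.
have sum m : \int[leb]_(t in `[0, w * m%:R]) h t <=
    2 `^ p * (\sum_(j < m) w * cmod (dirichlet_poly a (z j)) `^ p) + w * m%:R * (e / L).
  elim: m => [|m IH].
    by rewrite big_ord0 !mulr0 mul0r addr0 set_itv1 Rintegral_set1.
  have m0 : 0 <= w * m%:R by rewrite mulr_ge0 // ltW.
  have mm : w * m%:R <= w * m.+1%:R by rewrite ler_pM2l // ler_nat.
  rewrite (Rintegral_split m0 mm (hi _ _)) big_ord_recr /=.
  have -> : w * m.+1%:R = w * m%:R + w by rewrite -natr1 mulrDr mulr1.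
  have := piece m; rewrite -[m.+1%:R]natr1 mulrDr mulr1 => pm.
  rewrite mulrDr [(_ + w) * _]mulrDl addrACA; exact: lerD.
have wL : w * n.+1%:R = L by rewrite /w divfK.
have := sum n.+1; rewrite wL => /le_trans; apply.
have -> : L * (e / L) = e by rewrite mulrC divfK // gt_eqF.
by rewrite lerD2r ler_pM2l //; exact: HA.
Qed.

Lemma uniform_dirac_transfer_local_embedding p : 1 <= p ->
  uniform_dirac_transfer p -> local_embedding p.
Proof.
move=> p1 ud len; have p0 : 0 < p by rewrite (lt_le_trans ltr01).
pose L := 2 * `|len| + 1.
have L0 : 0 < L by rewrite ltr_wpDl // mulr_ge0.
pose K : set R[i]^o := [set z | cmod z <= 2 + L].
have [D [D0 DP]] : exists D : R, 0 < D /\ forall (J : set nat) (s : nat -> R[i]) mu (C : R),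
    (forall n, J n -> half_plane (s n)) -> weighted_dirac_sum J s mu ->
    msupport mu `<=` K -> 0 < C -> carleson_hardy p mu C ->
    carleson_dirichlet p mu (C * D).
  by apply: ud; apply/bounded_setC; exists (2 + L).
(* only the sign of the constant 48 matters here *)
have [k kE] : exists k : R, k = 48 by exists 48.
have k0 : 0 < 16 * k `^ p by rewrite mulr_gt0 // powR_gt0 // kE.
exists (2 `^ p * (16 * k `^ p * D)); split.
  by rewrite !mulr_gt0 // ?powR_gt0 // kE.
have box a : \int[leb]_(t in `[0, L]) cmod (dirichlet_poly a (2^-1 +i* t)) `^ p <=
    2 `^ p * (16 * k `^ p * D * bn p a `^ p).
  apply: comb_bound_line_integral => //.
    by rewrite mulr_ge0 ?powR_ge0 // mulr_ge0 ?(ltW D0) // (ltW k0).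
  move=> n w1; set w := L / n.+1%:R in w1 *.
  have w0 : 0 < w by rewrite divr_gt0.
  pose v := NngNum (ltW w0); have v0 : 0 < v%:num by exact: w0.
  have vC := comb_carleson 0 n.+1 p1 v0; rewrite -kE in vC.
  have vK : msupport (comb v 0 n.+1) `<=` K.
    apply: msupport_comb => j jn; apply: (le_trans (cmod_le _)).
    rewrite /comb_point /= addr0.
    rewrite (ger0_norm (mulr_ge0 (ltW w0) (ler0n _ j))) ger0_norm; last first.
      by have := w0; clear => ?; lra.
    have : w * j%:R <= L.
      have -> : L = w * n.+1%:R by rewrite /w divfK.
      by rewrite ler_pM2l // ler_nat ltnW.
    by move: w1; clear => ? ?; lra.
  have hp j : `I_n.+1 j -> half_plane (comb_point v%:num 0 j).
    by move=> _; exact: comb_point_half_plane.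
  have := carleson_dirichlet_poly p1
    (DP _ _ _ _ hp (comb_weighted_dirac_sum v 0 n.+1) vK k0 vC) a.
  rewrite integral_comb //; last 2 first.
  - by apply: measurable_cmod_powR p1 _; exact: analytic_dirichlet_poly.
  - by move=> s _; rewrite lee_fin powR_ge0.
  under eq_bigr do rewrite -EFinM.
  by rewrite sumEFin lee_fin.
move=> I Ii _ mI a.
have [->|/set0P[u Iu]] := eqVneq I set0.
  by rewrite integral_set0 lee_fin mulr_ge0 ?powR_ge0 // !mulr_ge0 ?powR_ge0 ?(ltW D0) //
    ?(ltW k0).
(* an interval of length len around u lies within distance len of u *)
have I_len x y : I x -> I y -> x <= y -> y - x <= `|len|.
  move=> Ix Iy xy; apply: le_trans (ler_norm _).
  rewrite -lee_fin -mI -(lebesgue_measure_cc xy); apply: le_measure; rewrite ?inE.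
  - exact: measurable_itv.
  - exact: is_interval_measurable.
  by move=> t /=; rewrite in_itv /=; exact: Ii.
pose c := u - `|len|.
have IL : I `<=` `[c, c + L].
  move=> t It /=; rewrite in_itv /= /c /L.
  have [tu|/ltW ut] := leP t u.
    by have := I_len _ _ It Iu tu; have := normr_ge0 len; move: tu; clear => ? ? ?;
      apply/andP; split; lra.
  by have := I_len _ _ Iu It ut; have := normr_ge0 len; move: ut; clear => ? ? ?;
    apply/andP; split; lra.
pose h t := cmod (dirichlet_poly a (2^-1 +i* t)) `^ p.
have hc : continuous h by exact: continuous_dirichlet_powR.
have hi x y : leb.-integrable `[x, y] (EFin \o h).
  by apply: continuous_at_integrable => t _; exact: hc.
have mI' : measurable I by exact: is_interval_measurable.
apply: (@le_trans _ _ (\int[leb]_(t in `[c, (c + L)%R]) (h t)%:E)%E).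
  apply: (@ge0_subset_integral _ _ _ lebesgue_measure I _ mI' _ (fun t => (h t)%:E)).
  - exact: measurable_itv.
  - exact: measurable_int (hi _ _).
  - by move=> t _; rewrite lee_fin powR_ge0.
  - exact: IL.
have -> : (\int[leb]_(t in `[c, (c + L)%R]) (h t)%:E =
    (\int[leb]_(t in `[c, (c + L)%R]) h t)%:E)%E.
  by rewrite /Rintegral fineK //; exact: integrable_fin_num.
rewrite lee_fin.
have := box (shift_coef (0 +i* c) a); rewrite besicovitch_norm_shift_imag // -!mulrA.
apply: le_trans; rewrite le_eqVlt; apply/orP; left; apply/eqP.
rewrite -{1}[c]addr0 (Rintegral_translate _ (ltW L0) hc).
apply: eq_Rintegral => t _; rewrite /h dirichlet_poly_shift; congr (cmod (dirichlet_poly a _) `^ p).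
by apply: complex_ext; rewrite ?cReD ?cImD /= ?add0r.
Qed.

End uniform_dirac_embedding.

Theorem theorem4 (R : realType) (p : R) (hp : 1 <= p) :
  let cond_a :=
    forall len : R, exists C : R, 0 < C /\
      forall I : set R, is_interval I -> bounded_set I ->
        lebesgue_measure I = len%:E ->
        forall a : seq R[i],
          (\int[@lebesgue_measure R]_(t in I)
             (cmod (dirichlet_poly a (2^-1 +i* t)) `^ p)%:E
           <= (C * besicovitch_norm p (dirichlet_poly a) `^ p)%:E)%E in
  let cond_b :=
    forall mu : {measure set (borelC R) -> \bar R},
      on_half_plane mu -> local_measure mu ->
      (exists C : R, 0 < C /\ carleson_hardy p mu C) ->
      exists C : R, 0 < C /\ carleson_dirichlet p mu C in
  (* D depends on a bounded set containing the support, but not on S or C *)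
  let cond_c :=
    forall K : set R[i]^o, bounded_set K ->
      exists D : R, 0 < D /\
        forall (J : set nat) (s : nat -> R[i])
               (mu : {measure set (borelC R) -> \bar R}) (C : R),
          (forall n, J n -> half_plane (s n)) ->
          weighted_dirac_sum J s mu ->
          msupport mu `<=` K ->
          0 < C -> carleson_hardy p mu C ->
          carleson_dirichlet p mu (C * D) in
  (cond_a <-> cond_b) /\ (cond_b <-> cond_c).
Proof.
have ab := @local_embedding_carleson_transfer R p hp.
have bc := @carleson_transfer_uniform_dirac R p hp.
have ca := @uniform_dirac_transfer_local_embedding R p hp.
split; split=> H.
- exact: ab.
- exact/ca/bc.
- exact: bc.
- exact/ab/ca.
Qed.
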